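(* Let $(\Delta,\mathbf L)$ be a compact convex simple labelled polytope in $\mathbb R^m$ and $f$ an affine function positive on $\Delta$. If the weighted Abreu equation $$-f^{2m+1}\sum_{i,j=1}^m\big(f^{1-2m}\mathbf H^v_{ij}\big)_{,ij}=s_{(\Delta,\mathbf L,f)}$$ has a solution $v\in\mathcal S$, then $(\Delta,\mathbf L,f)$ is uniformly K-stable, i.e. there exists $\lambda>0$ such that $\mathcal F_{(\Delta,f)}(u)\ge\lambda\|u\|_b$ for all $u\in\widetilde{\mathcal C}$.
   Context: $\mathfrak t^*\cong\mathbb R^m$ ($m\ge2$) has coordinates $x=(x_1,\dots,x_m)$ and Lebesgue measure $d\mu$; subscripts $_{,i}$ denote $\partial/\partial x_i$. $\Delta=\{x:L_j(x)\ge0,\ j=1,\dots,d\}$ with affine $\mathbf L=(L_1,\dots,L_d)$, facets $F_j=\Delta\cap\{L_j=0\}$, inward normals $u_j=dL_j$, interior $\Delta^0$; on $F_j$ the measure $d\sigma$ is defined by $dL_j\wedge d\sigma=-d\mu$. $\mathcal S$ is the set of smooth strictly convex functions $u$ on $\Delta^0$ such that $\mathbf H^u=(\mathrm{Hess}\,u)^{-1}$ (i) extends smoothly to $\Delta$; (ii) at each point $\xi$ of a facet $F_j$, $\mathbf H^u_\xi(u_j,\cdot)=0$ and $(d\mathbf H^u)_\xi(u_j,u_j)=2u_j$; (iii) for $\xi$ in the interior of any face $F$, $\mathbf H^u_\xi$ is positive definite on $(\mathfrak t/\mathfrak t_F)^*$, $\mathfrak t_F$ being spanned by the normals of facets containing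 $F$. $s_{(\Delta,\mathbf L,f)}$ is the unique affine function with $2\int_{\partial\Delta}\varphi f^{1-2m}d\sigma=\int_\Delta s_{(\Delta,\mathbf L,f)}\varphi f^{-2m-1}d\mu$ for all affine $\varphi$. $\mathcal F_{(\Delta,f)}(u)=2\int_{\partial\Delta}u f^{1-2m}d\sigma-\int_\Delta s_{(\Delta,\mathbf L,f)}u f^{-2m-1}d\mu$. $\mathcal C_\infty$: continuous convex functions on $\Delta$ smooth in $\Delta^0$; for a fixed $x_0\in\Delta^0$, $\widetilde{\mathcal C}=\{u\in\mathcal C_\infty:u\ge u(x_0)=0\}$; $\|u\|_b=\int_{\partial\Delta}u f^{1-2m}d\sigma$. *)

(* Defs.v *)
From HB Require Import structures.
From mathcomp Require Import all_boot all_order all_algebra.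
From mathcomp Require Import all_classical all_reals all_analysis.
Set Implicit Arguments. Unset Strict Implicit. Unset Printing Implicit Defensive.
Import Order.TTheory GRing.Theory Num.Theory.
Import numFieldNormedType.Exports.
Local Open Scope classical_set_scope.
Local Open Scope ring_scope.

Section Defs.
Variable R : realType.

Definition coord (m : nat) (x : 'rV[R]_m) (i : 'I_m) : R := x 0 i.

Definition aff (m : nat) (a : 'rV[R]_m) (b : R) (x : 'rV[R]_m) : R :=
  \sum_(i < m) a 0 i * x 0 i + b.

Definition affine_fun (m : nat) (g : 'rV[R]_m -> R) : Prop :=
  exists (a : 'rV[R]_m) (b : R), forall x, g x = aff a b x.

(* labelled polytope data: L_j = aff (u j) (c j); inward normals u_j = dL_j *)
Definition polytope (m d : nat) (u : 'I_d -> 'rV[R]_m) (c : 'I_d -> R)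
  : set 'rV[R]_m := [set x | forall j, 0 <= aff (u j) (c j) x].

Definition facet (m d : nat) (u : 'I_d -> 'rV[R]_m) (c : 'I_d -> R) (j : 'I_d)
  : set 'rV[R]_m := [set x | polytope u c x /\ aff (u j) (c j) x = 0].

Definition extreme_point (m : nat) (D : set 'rV[R]_m) (x : 'rV[R]_m) : Prop :=
  D x /\ forall y z t, D y -> D z -> 0 < t < 1 ->
    x = t *: y + (1 - t) *: z -> y = z.

Definition simple_labelled_polytope (m d : nat)
    (u : 'I_d -> 'rV[R]_m) (c : 'I_d -> R) : Prop :=
  [/\ compact (polytope u c),
      interior (polytope u c) !=set0,
      (forall j, u j != 0),
      (* each F_j is a genuine facet, the L_j being pairwise non-redundant *)
      (forall j, exists x, polytope u c x /\ aff (u j) (c j) x = 0 /\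
                 forall k, k != j -> 0 < aff (u k) (c k) x) &
      (forall x, extreme_point (polytope u c) x ->
         #|[set j : 'I_d | `[< aff (u j) (c j) x = 0 >] ]| = m :> nat)
  ].

(* Lebesgue integral over R^m as an iterated one-dimensional Lebesgue
   integral (Fubini) *)
Fixpoint iint (m : nat) : ('rV[R]_m -> R) -> R :=
  match m with
  | 0 => fun g => g 0
  | m'.+1 => fun g =>
      Rintegral (@lebesgue_measure R) setT
        (fun t => iint (fun y : 'rV[R]_m' =>
                          g (row_mx (const_mx t : 'rV[R]_1) y)))
  end.

Definition int_on (m : nat) (D : set 'rV[R]_m) (g : 'rV[R]_m -> R) : R :=
  iint (fun x => if `[< D x >] then g x else 0).

Definition unit_vec (m : nat) (k : 'I_m) : 'rV[R]_m := delta_mx 0 k.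

Definition hproj (m : nat) (a : 'rV[R]_m) (b : R) (k : 'I_m) (y : 'rV[R]_m)
  : 'rV[R]_m := y - (aff a b y / a 0 k) *: unit_vec k.

(* \int_{F_j} g dsigma, where dL_j /\ dsigma = - dmu.  If u_j has a nonzero
   k-th coordinate, dsigma = |u_jk|^{-1} d x_1..^x_k..dx_m on {L_j = 0}; the
   extra coordinate y_k is integrated over [0,1] (contributing a factor 1). *)
Definition int_facet (m d : nat) (u : 'I_d -> 'rV[R]_m) (c : 'I_d -> R)
    (j : 'I_d) (g : 'rV[R]_m -> R) : R :=
  match [pick k : 'I_m | u j 0 k != 0] with
  | Some k =>
      iint (fun y => if `[< facet u c j (hproj (u j) (c j) k y) >]
                        && (0 <= y 0 k <= 1)
                     then g (hproj (u j) (c j) k y) else 0) / `|u j 0 k|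
  | None => 0
  end.

Definition int_bdry (m d : nat) (u : 'I_d -> 'rV[R]_m) (c : 'I_d -> R)
    (g : 'rV[R]_m -> R) : R :=
  \sum_(j < d) int_facet u c j g.

Definition is_extremal_affine (m d : nat) (u : 'I_d -> 'rV[R]_m)
    (c : 'I_d -> R) (f s : 'rV[R]_m -> R) : Prop :=
  affine_fun s /\
  forall phi, affine_fun phi ->
    2 * int_bdry u c (fun x => phi x * f x ^- (2 * m - 1)) =
    int_on (polytope u c) (fun x => s x * phi x * f x ^- (2 * m + 1)).

Definition futaki (m d : nat) (u : 'I_d -> 'rV[R]_m) (c : 'I_d -> R)
    (f s w : 'rV[R]_m -> R) : R :=
  2 * int_bdry u c (fun x => w x * f x ^- (2 * m - 1))
  - int_on (polytope u c) (fun x => s x * w x * f x ^- (2 * m + 1)).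

Definition bnorm (m d : nat) (u : 'I_d -> 'rV[R]_m) (c : 'I_d -> R)
    (f w : 'rV[R]_m -> R) : R :=
  int_bdry u c (fun x => w x * f x ^- (2 * m - 1)).

Definition pd (m : nat) (i : 'I_m) (g : 'rV[R]_m -> R) : 'rV[R]_m -> R :=
  fun x => 'D_(unit_vec i) g x.

Fixpoint dpart (m : nat) (s : seq 'I_m) (g : 'rV[R]_m -> R) : 'rV[R]_m -> R :=
  match s with
  | [::] => g
  | i :: s' => pd i (dpart s' g)
  end.

Definition smooth_on (m : nat) (U : set 'rV[R]_m) (g : 'rV[R]_m -> R) : Prop :=
  forall s : seq 'I_m,
    (forall x, U x -> {for x, continuous (dpart s g)}) /\
    (forall x i, U x -> derivable (dpart s g) x (unit_vec i)).

Definition hessian (m : nat) (g : 'rV[R]_m -> R) (x : 'rV[R]_m) : 'M[R]_m :=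
  \matrix_(i, j) dpart [:: i; j] g x.

Definition convex_on (m : nat) (D : set 'rV[R]_m) (g : 'rV[R]_m -> R) : Prop :=
  forall x y t, D x -> D y -> 0 <= t <= 1 ->
    g (t *: x + (1 - t) *: y) <= t * g x + (1 - t) * g y.

Definition strictly_convex_on (m : nat) (D : set 'rV[R]_m) (g : 'rV[R]_m -> R)
  : Prop :=
  forall x y t, D x -> D y -> x != y -> 0 < t < 1 ->
    g (t *: x + (1 - t) *: y) < t * g x + (1 - t) * g y.

Definition Hinv (m : nat) (g : 'rV[R]_m -> R) (x : 'rV[R]_m) : 'M[R]_m :=
  invmx (hessian g x).

Definition face_of (m d : nat) (u : 'I_d -> 'rV[R]_m) (c : 'I_d -> R)
    (J : {set 'I_d}) : set 'rV[R]_m :=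
  [set x | polytope u c x /\ forall j, j \in J -> aff (u j) (c j) x = 0].

Definition face_in_facet (m d : nat) (u : 'I_d -> 'rV[R]_m) (c : 'I_d -> R)
    (J : {set 'I_d}) (k : 'I_d) : bool :=
  `[< face_of u c J `<=` facet u c k >].

Definition face_rel_interior (m d : nat) (u : 'I_d -> 'rV[R]_m)
    (c : 'I_d -> R) (J : {set 'I_d}) : set 'rV[R]_m :=
  [set x | face_of u c J x /\
     forall k, ~~ face_in_facet u c J k -> 0 < aff (u k) (c k) x].

(* t_F : spanned by the normals of the facets containing F (as a row space) *)
Definition tF (m d : nat) (u : 'I_d -> 'rV[R]_m) (c : 'I_d -> R)
    (J : {set 'I_d}) : 'M[R]_(d, m) :=
  \matrix_(k < d) (if face_in_facet u c J k then u k else 0).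

Definition in_S (m d : nat) (u : 'I_d -> 'rV[R]_m) (c : 'I_d -> R)
    (v : 'rV[R]_m -> R) : Prop :=
  let D := polytope u c in
  [/\ smooth_on (interior D) v,
      strictly_convex_on (interior D) v,
      (forall x, interior D x -> hessian v x \in unitmx) &
      exists (W : set 'rV[R]_m) (Hb : 'rV[R]_m -> 'M[R]_m),
        [/\ open W /\ D `<=` W,
            (forall i j, smooth_on W (fun x => Hb x i j)),
            (forall x, interior D x -> Hb x = Hinv v x),
            (forall j xi, facet u c j xi ->
               u j *m Hb xi = 0 /\
               forall i, 'D_(unit_vec i)
                           (fun x => (u j *m Hb x *m (u j)^T) 0 0) xi
                         = 2 * u j 0 i) &
            (* (iii) positivity on (t/t_F)^* at interior points of faces F *)
            (forall (J : {set 'I_d}) xi, face_of u c J !=set0 ->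
               face_rel_interior u c J xi ->
               forall w : 'rV[R]_m, ~~ (w <= tF u c J)%MS ->
                 0 < (w *m Hb xi *m w^T) 0 0)]].

Definition in_Cinf (m : nat) (D : set 'rV[R]_m) (w : 'rV[R]_m -> R) : Prop :=
  [/\ {within D, continuous w}, convex_on D w & smooth_on (interior D) w].

Definition in_Ctilde (m : nat) (D : set 'rV[R]_m) (x0 : 'rV[R]_m)
    (w : 'rV[R]_m -> R) : Prop :=
  [/\ in_Cinf D w, w x0 = 0 & forall x, D x -> w x0 <= w x].

End Defs.

(* Main.v *)
Require Import Defs.
From HB Require Import structures.
From mathcomp Require Import all_boot all_order all_algebra.
From mathcomp Require Import all_classical all_reals all_analysis.
From mathcomp Require Import ring lra measurable_realfun.
Set Implicit Arguments. Unset Strict Implicit. Unset Printing Implicit Defensive.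
Import Order.TTheory GRing.Theory Num.Theory.
Import numFieldNormedType.Exports.
Local Open Scope classical_set_scope.
Local Open Scope ring_scope.

(** Let G = f^(1-2m) H^v.  For u smooth near the polytope, convex and normalized at x0, the divergence
    theorem for the field sum_j G_ij u_j - u sum_j G_ij,j, together with the Abreu equation and the boundary
    conditions on H^v, gives F(u) >= int sum_ij G_ij u_ij; only this inequality is needed, and only the
    corresponding inequality form of the divergence theorem is proved, by smooth cutoffs of the polytope.
    Since H^v is positive definite inside, F(u) controls the integral of every second directional derivative
    of u over compact subsets of the interior.  Comparing mollified second differences of u at points q and
    q +- e, this bounds u(q + e) by 2 sup u near q plus a multiple of F(u); starting at the minimum x0 and
    propagating outwards, one gets sup u <= C F(u) on each compact subset of the interior.  Near the boundary,
    the divergence theorem for u rho (x - x0), with rho a sum of N-th powers of (1 - L_j / L_j(x0))^+, shows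
    that a thin collar carries at most a fraction O(1/N) of the boundary norm.  Hence int u is at most
    eps |u|_b + C_eps F(u), and 2 |u|_b = F(u) + int s u f^(-2m-1) yields |u|_b <= C F(u).  A general u is
    the limit of its dilations u(x0 + r (x - x0)), r -> 1. *)

(** * One-dimensional integrals of bounded functions with bounded support *)

Section OneDim.
Variable R : realType.
Implicit Types f g : R -> R.
Notation mu := (@lebesgue_measure R).

(** The integrals are nested one-dimensional ones, so additivity, monotonicity and limits are
    available only where every inner integral is measurable and bounded. The analysis is therefore
    done with sequentially continuous functions satisfying [bdd_supp] (one constant bounds both
    values and support) and with their bounded pointwise limits, the class [good], which contains
    the restrictions of continuous functions to the polytope. The divergence inequality has to cope
    with corners: the cutoff is a function of a sum of profiles of the L_j, and where several facets
    meet the extra summands only lower the limiting boundary layer. Hence a one-sided result, for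
    fields with nonnegative outward flux. The energy bounds only integrals of second derivatives,
    whereas the interior estimate is pointwise. Averaging against an even kernel bridges the two:
    for a convex function the average is at least the value at the centre and at most the local
    supremum. Since G degenerates on the facets, such bounds cannot reach the boundary, which is why
    the collar needs a separate divergence argument. *)

Definition bdd_supp (V : normedModType R) (M : R) (g : V -> R) : Prop :=
  forall x, `|g x| <= M /\ (M < `|x| -> g x = 0).

Lemma bdd_supp_ge0 (V : normedModType R) M (g : V -> R) : bdd_supp M g -> 0 <= M.
Proof. by move=> /(_ 0)[h _]; exact: le_trans h. Qed.

Lemma bdd_suppW (V : normedModType R) M N (g : V -> R) :
  M <= N -> bdd_supp M g -> bdd_supp N g.
Proof.
move=> MN h x; have [h1 h2] := h x; split; first exact: le_trans MN.
by move=> Nx; apply: h2; exact: le_lt_trans Nx.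
Qed.

Lemma bdd_supp_shift (V : normedModType R) M (g : V -> R) v : bdd_supp M g ->
  bdd_supp (M + `|v|) (fun x => g (v + x)).
Proof.
move=> bf x; split.
  by apply: le_trans (bf _).1 _; rewrite lerDl.
move=> h; apply: (bf _).2; rewrite -(ltrD2r `|v|); apply: lt_le_trans h _.
by have := ler_normB (v + x) v; rewrite [v + x]addrC addrK.
Qed.

Definition integ1 f : R := Rintegral mu setT f.

Lemma integrable_bdd_supp f M : measurable_fun setT f -> bdd_supp M f ->
  mu.-integrable setT (EFin \o f).
Proof.
move=> mf bf.
have M0 := bdd_supp_ge0 bf.
have ->: f = f \_ (`[- M, M]%classic : set R).
  apply/funext => x; rewrite /patch; case: ifPn => // /negP xN.
  apply: (bf x).2; rewrite ltNge; apply/negP => xM; apply: xN.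
  by rewrite inE /= in_itv /= -ler_norml.
rewrite -restrict_EFin.
rewrite -integrable_mkcond//.
apply: measurable_bounded_integrable => //.
- rewrite [X in (X < _)%E](lebesgue_measure_itv `[- M, M]) /=; case: ifP => // _.
  by rewrite -EFinD ltry.
- exact: measurable_funTS.
- exists M; split => //; first exact: num_real.
  by move=> y My x _ /=; apply: le_trans (ltW My); exact: (bf x).1.
Qed.

Lemma bdd_supp_cvg (V : normedModType R) (F : nat -> V -> R) (f : V -> R) M :
  (forall n, bdd_supp M (F n)) -> (forall x, F n x @[n --> \oo] --> f x) -> bdd_supp M f.
Proof.
move=> bF Ff x; split.
  apply: (ler_cvg_to (cvg_norm (Ff x)) (cvg_cst M)).
  by apply: nearW => n; exact: (bF n x).1.
move=> Mx; apply: (cvg_unique _ (Ff x)) => //.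
rewrite (_ : (fun n => F n x) = fun=> 0); first exact: cvg_cst.
by apply/funext => n; exact: (bF n x).2.
Qed.

(** Integrable majorant. Height and radius are separate because the bound on an inner integral
    differs from the radius of its support. *)
Definition box_cst (a M : R) : R -> R := fun x => a * \1_(`[- M, M]%classic : set R) x.

Lemma box_cst_measurable a M : measurable_fun setT (box_cst a M).
Proof. exact: measurable_funM. Qed.

Lemma box_cst_bdd a M : bdd_supp (Num.max M `|a|) (box_cst a M).
Proof.
move=> x; rewrite /box_cst indicE; split.
  by case: (x \in _); rewrite ?mulr1 ?mulr0 ?normr0 le_max ?lexx ?normr_ge0 orbT.
rewrite gt_max => /andP[Mx _]; rewrite memNset ?mulr0//= in_itv /= -ler_norml.
by apply/negP; rewrite -ltNge.
Qed.

Lemma le_box_cst f M a x : `|f x| <= a -> (M < `|x| -> f x = 0) -> `|f x| <= box_cst a M x.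
Proof.
move=> fa f0; rewrite /box_cst indicE; have [xM|/negP xM] := boolP (x \in _); first by rewrite mulr1.
rewrite f0 ?normr0 ?mulr0// ltNge; apply/negP => h; apply: xM.
by rewrite inE /= in_itv /= -ler_norml.
Qed.

Lemma integ1_dct (F : nat -> R -> R) f M :
  (forall n, measurable_fun setT (F n)) -> (forall n, bdd_supp M (F n)) ->
  (forall x, F n x @[n --> \oo] --> f x) ->
  integ1 (F n) @[n --> \oo] --> integ1 f.
Proof.
move=> mF bF Ff.
have mf : measurable_fun setT f.
  by apply: (@measurable_realfun.measurable_fun_cvg _ _ _ _ F) => // x _.
pose g := box_cst M M.
have ig := integrable_bdd_supp (box_cst_measurable M M) (box_cst_bdd M M).
have Fg n x : `|F n x| <= g x by apply: le_box_cst; [exact: (bF n x).1|exact: (bF n x).2].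
have mF' n : measurable_fun setT (EFin \o F n) by apply/measurable_EFinP.
have mf' : measurable_fun setT (EFin \o f) by apply/measurable_EFinP.
have bf := bdd_supp_cvg bF Ff.
have aec : {ae mu, forall x, setT x -> (EFin \o F n) x @[n --> \oo] --> (EFin \o f) x}.
  by apply: aeW => x _; apply: cvg_EFin; [exact: nearW|exact: Ff].
have aed : {ae mu, forall x n, setT x -> (`|(EFin \o F n) x| <= (EFin \o g) x)%E}.
  by apply: aeW => x n _; rewrite lee_fin.
have [_ _ H] := @dominated_convergence _ _ _ mu setT measurableT _ _ _ mF' mf' aec ig aed.
by apply: fine_cvg; rewrite fineK//; exact: integrable_fin_num (integrable_bdd_supp mf bf).
Qed.

Lemma integ1_le f g M N : measurable_fun setT f -> bdd_supp M f ->
  measurable_fun setT g -> bdd_supp N g -> (forall x, f x <= g x) ->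
  integ1 f <= integ1 g.
Proof.
move=> mf bf mg bg fg; apply: le_Rintegral => //.
- exact: integrable_bdd_supp bf.
- exact: integrable_bdd_supp bg.
Qed.

Lemma integ1D f g M N : measurable_fun setT f -> bdd_supp M f ->
  measurable_fun setT g -> bdd_supp N g ->
  integ1 (fun x => f x + g x) = integ1 f + integ1 g.
Proof.
move=> mf bf mg bg; apply: RintegralD => //.
- exact: integrable_bdd_supp bf.
- exact: integrable_bdd_supp bg.
Qed.

Lemma integ1Z a f M : measurable_fun setT f -> bdd_supp M f ->
  integ1 (fun x => a * f x) = a * integ1 f.
Proof. by move=> mf bf; apply: RintegralZl => //; exact: integrable_bdd_supp bf. Qed.

Lemma integ1_indic (M : R) : 0 <= M -> integ1 (\1_(`[- M, M]%classic : set R)) = 2 * M.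
Proof.
move=> M0; rewrite /integ1 /Rintegral integral_indic// setIT.
rewrite [X in fine X](lebesgue_measure_itv `[- M, M]) /=.
rewrite lte_fin; case: ltP => [_|]; rewrite ?opprK /=; lra.
Qed.

Lemma integ1_bound f M : measurable_fun setT f -> bdd_supp M f ->
  `|integ1 f| <= 2 * M ^+ 2.
Proof.
move=> mf bf; have M0 := bdd_supp_ge0 bf.
have E a : integ1 (box_cst a M) = a * (2 * M).
  rewrite -integ1_indic// -(@integ1Z a _ (Num.max M `|1 : R|))//.
  by have := box_cst_bdd 1 M; rewrite (_ : box_cst 1 M = \1_(`[- M, M]%classic : set R))//; apply/funext => x; rewrite /box_cst mul1r.
have fg x : `|f x| <= box_cst M M x by apply: le_box_cst; [exact: (bf x).1|exact: (bf x).2].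
rewrite ler_norml; apply/andP; split.
  have -> : - (2 * M ^+ 2) = - M * (2 * M) by ring.
  rewrite -E; apply: (integ1_le (box_cst_measurable _ _) (box_cst_bdd _ _) mf bf) => x.
  by rewrite /box_cst mulNr; have := fg x; rewrite ler_norml => /andP[].
have -> : 2 * M ^+ 2 = M * (2 * M) by ring.
rewrite -E; apply: (integ1_le mf bf (box_cst_measurable _ _) (box_cst_bdd _ _)) => x.
exact: le_trans (ler_norm _) (fg x).
Qed.

(** The pushforward gives half-open intervals their usual length, and Lebesgue measure is the only
    measure doing so. *)
Lemma lebesgue_measure_shift (a : R) (A : set R) : measurable A ->
  pushforward mu ((fun x => a + x) : R -> measurableTypeR R) A = mu A.
Proof.
have ma : measurable_fun setT ((fun x => a + x) : R -> measurableTypeR R).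
  by apply: measurable_funD.
move=> mA; apply/esym/(@lebesgue_measure_unique _ (pushforward mu ((fun x => a + x) : R -> measurableTypeR R))) => //= _ [[c d]] _ <-.
rewrite /pushforward.
rewrite (_ : _ @^-1` _ = `]c - a, d - a]%classic); last first.
  by apply/seteqP; split => x /=; rewrite !in_itv/= ltrBlDl lerBrDl.
rewrite !lebesgue_measure_itv/= !lte_fin ltrD2r; case: ifP => // _.
by rewrite -!EFinB; congr (_%:E); lra.
Qed.

Lemma lebesgue_measure_scale (b : R) (A : set R) : 0 < b -> measurable A ->
  (b%:E * mu ((fun x => (b * x)%R) @^-1` A) = mu A)%E.
Proof.
move=> b1 mA.
have ma : measurable_fun setT ((fun x => b * x) : R -> measurableTypeR R).
  by apply: measurable_funM.
apply/esym/(@lebesgue_measure_unique _ (mscale (NngNum (ltW b1)) (pushforward mu ((fun x => (b * x)%R) : R -> measurableTypeR R)))) => //= _ [[c d]] _ <-.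
rewrite /mscale /= /pushforward.
rewrite (_ : _ @^-1` _ = `]c / b, d / b]%classic); last first.
  by apply/seteqP; split => x /=; rewrite !in_itv/= ltr_pdivrMr// ler_pdivlMr// [x * _]mulrC.
rewrite !lebesgue_measure_itv/= !lte_fin ltr_pM2r ?invr_gt0//; case: ifP => // _; last by rewrite mule0.
by rewrite -!EFinB -EFinM; congr (_%:E); field; rewrite gt_eqF.
Qed.

Lemma integ1_shift f M (a : R) : measurable_fun setT f -> bdd_supp M f ->
  integ1 (fun x => f (a + x)) = integ1 f.
Proof.
move=> mf bf; rewrite /integ1 /Rintegral; congr fine.
have ma : measurable_fun setT ((fun x => a + x) : R -> measurableTypeR R).
  by apply: measurable_funD.
rewrite -[RHS](@eq_measure_integral _ _ _ setT _ (pushforward mu ((fun x => a + x) : R -> measurableTypeR R))); last first.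
  by move=> A mA _; exact: lebesgue_measure_shift.
rewrite integral_pushforward//=.
- by apply/measurable_EFinP.
- rewrite preimage_setT.
  apply: (@integrable_bdd_supp (fun x => f (a + x)) (M + `|a|)).
    exact: (measurableT_comp mf).
  exact: bdd_supp_shift.
Qed.

Lemma integ1_opp f M : measurable_fun setT f -> bdd_supp M f ->
  integ1 (fun x => f (- x)) = integ1 f.
Proof.
move=> mf bf; rewrite /integ1 /Rintegral; congr fine.
rewrite -[RHS](@eq_measure_integral _ _ _ setT _ (pushforward mu (-%R : R -> measurableTypeR R))); last first.
  by move=> A mA _; exact: lebesgue_measureN.
rewrite integral_pushforward//=.
- by apply/measurable_EFinP.
- rewrite preimage_setT.
  apply: (@integrable_bdd_supp (fun x => f (- x)) M).
    exact: (measurableT_comp mf).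
  by move=> x; split; [exact: (bf _).1|move=> h; apply: (bf _).2; rewrite normrN].
Qed.

Lemma integ1_scale f M (b : R) : 0 < b -> measurable_fun setT f -> bdd_supp M f ->
  b * integ1 (fun x => f (b * x)) = integ1 f.
Proof.
move=> b0 mf bf.
have mb : measurable_fun setT ((fun x => b * x) : R -> measurableTypeR R).
  by apply: measurable_funM.
have ib : mu.-integrable setT (EFin \o (fun x => f (b * x))).
  apply: (@integrable_bdd_supp (fun x => f (b * x)) (Num.max M (M / b))).
    exact: (measurableT_comp mf).
  move=> x; split; first by rewrite le_max (bf _).1.
  rewrite gt_max => /andP[_]; rewrite ltr_pdivrMr// => h; apply: (bf _).2.
  by rewrite normrM gtr0_norm// mulrC.
have E : integ1 (fun x => f (b * x)) = fine (\int[pushforward mu ((fun x => (b * x)%R) : R -> measurableTypeR R)]_y (f y)%:E)%E.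
  rewrite integral_pushforward//=.
  by apply/measurable_EFinP.
have ip : (pushforward mu ((fun x => (b * x)%R) : R -> measurableTypeR R)).-integrable setT (EFin \o f).
  by apply: integrable_pushforward => //; apply/measurable_EFinP.
rewrite E -[LHS]/(fine b%:E * _) -fineM//; last exact: integrable_fin_num ip.
rewrite /integ1 /Rintegral; congr fine.
rewrite -[RHS](@eq_measure_integral _ _ _ setT _ (mscale (NngNum (ltW b0)) (pushforward mu ((fun x => (b * x)%R) : R -> measurableTypeR R)))); last first.
  by move=> A mA _; exact: lebesgue_measure_scale.
have mef : measurable_fun setT (EFin \o f) by apply/measurable_EFinP.
rewrite [RHS]integralE !ge0_integral_mscale//=; last 2 first.
- exact: measurable_funeneg.
- exact: measurable_funepos.
rewrite [in LHS]integralE muleBr//.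
exact: (integrable_add_def measurableT ip).
Qed.

Lemma integ1_affine f M (a b : R) : b != 0 -> measurable_fun setT f -> bdd_supp M f ->
  `|b| * integ1 (fun x => f (a + b * x)) = integ1 f.
Proof.
move=> b0 mf bf.
have mfa : measurable_fun setT (fun x => f (a + x)).
  by apply: (measurableT_comp mf); apply: measurable_funD.
have bfa : bdd_supp (M + `|a|) (fun x => f (a + x)).
  exact: bdd_supp_shift.
rewrite -(integ1_shift a mf bf).
have [b1|b1] := ltP 0 b.
  by rewrite gtr0_norm// (integ1_scale b1 mfa bfa).
rewrite ltr0_norm ?lt_neqAle ?b0// -(integ1_opp mfa bfa).
rewrite -(@integ1_scale (fun x => f (a + - x)) (M + `|a|) (- b)).
- by congr (_ * _); congr integ1; apply/funext => x; rewrite mulNr opprK.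
- by rewrite oppr_gt0 lt_neqAle b0.
- by apply: (measurableT_comp mfa).
- by move=> x; split; [exact: (bfa _).1|move=> h; apply: (bfa _).2; rewrite normrN].
Qed.

(** Turns sequential continuity, which dominated convergence yields for inner integrals, into
    measurability. *)
Lemma measurable_scont1 f :
  (forall (u : nat -> R) x, u n @[n --> \oo] --> x -> f (u n) @[n --> \oo] --> f x) ->
  measurable_fun setT f.
Proof.
move=> sf; apply: continuous_measurable_fun => x.
apply: (proj2 (@cvg_nbhsP R R^o f x (f x))) => u ux.
exact: sf.
Qed.

(** Rounding the first argument down to a multiple of 1/(n+1) makes every preimage a countable union
    of measurable rectangles; joint continuity recovers the function as n grows. *)
Lemma seq_cont2_measurable (h : R -> R -> R) :
  (forall (u v : nat -> R) x y, u n @[n --> \oo] --> x -> v n @[n --> \oo] --> y ->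
     h (u n) (v n) @[n --> \oo] --> h x y) ->
  measurable_fun setT (fun z : R * R => h z.1 z.2).
Proof.
move=> hc.
pose phi (n : nat) (s : R) : R := (Num.floor (n.+1%:R * s))%:~R / n.+1%:R.
have phic s : phi n s @[n --> \oo] --> s.
  apply/cvgrPdist_le => e e0.
  near=> n.
  have n0 : 0 < n.+1%:R :> R by [].
  have /andP[h1 h2] := floor_itv (n.+1%:R * s).
  have -> : s - phi n s = (n.+1%:R * s - (Num.floor (n.+1%:R * s))%:~R) / n.+1%:R.
    by rewrite /phi; field; rewrite gt_eqF.
  rewrite ger0_norm; last by rewrite divr_ge0// subr_ge0.
  rewrite ler_pdivrMr//.
  have : 1 <= e * n.+1%:R.
    rewrite -ler_pdivrMr// mul1r ltW//.
    by near: n; exact: (near_infty_natSinv_lt (PosNum e0)).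
  by apply: le_trans; rewrite lerBlDr addrC ltW//; move: h2; rewrite intrD.
apply: (@measurable_realfun.measurable_fun_cvg _ _ _ _
  (fun n (z : R * R) => h (phi n z.1) z.2)) => [n|z _]; last first.
  by apply: hc; [exact: phic|exact: cvg_cst].
move=> _ A mA; rewrite setTI.
have -> : (fun z : R * R => h (phi n z.1) z.2) @^-1` A =
  \bigcup_(k in [set: int]) ((fun s : R => Num.floor (n.+1%:R * s) == k) `*`
      ((fun t => h (k%:~R / n.+1%:R) t) @^-1` A)).
  apply/seteqP; split => [[s t] /= hA|[s t] [k _] [/= /eqP sk hA]].
    by exists (Num.floor (n.+1%:R * s)) => //=; split => //=.
  by rewrite /phi sk.
apply: countable_bigcupT_measurable => // k; apply: measurableX.
  rewrite (_ : (fun s => _) = `[k%:~R / n.+1%:R, (k + 1)%:~R / n.+1%:R[%classic)//.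
  apply/seteqP; split => s /=; rewrite in_itv/=.
    move=> /eqP <-; have := floor_itv (n.+1%:R * s) => /andP[h1 h2].
    by rewrite ler_pdivrMr// ltr_pdivlMr// [s * _]mulrC h1 h2.
  rewrite ler_pdivrMr// ltr_pdivlMr// [s * _]mulrC => /andP[h1 h2].
  by apply/eqP/floor_def; rewrite h1 h2.
rewrite -[X in measurable X]setTI; apply: measurable_scont1 => // u x ux.
by apply: hc => //; exact: cvg_cst.
Unshelve. all: by end_near. Qed.

(** Fubini's theorem applies because the inner integral of [|h|] is at most [2 * M ^+ 2] and
    vanishes for arguments outside [[- M, M]]. *)
Lemma integ1_swap (h : R -> R -> R) M :
  (forall (u v : nat -> R) x y, u n @[n --> \oo] --> x -> v n @[n --> \oo] --> y ->
     h (u n) (v n) @[n --> \oo] --> h x y) ->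
  (forall x, bdd_supp M (h x)) -> (forall y, bdd_supp M (h^~ y)) ->
  integ1 (fun x => integ1 (h x)) = integ1 (fun y => integ1 (h^~ y)).
Proof.
move=> hc h1 h2.
have mh := seq_cont2_measurable hc.
have M0 := bdd_supp_ge0 (h1 0).
have ih x : mu.-integrable setT (EFin \o h x).
  apply: (integrable_bdd_supp _ (h1 x)); apply: measurable_scont1 => u y uy.
  by apply: hc => //; exact: cvg_cst.
have ih2 y : mu.-integrable setT (EFin \o h^~ y).
  apply: (integrable_bdd_supp _ (h2 y)); apply: measurable_scont1 => u x ux.
  by apply: hc => //; exact: cvg_cst.
have im : (mu \x mu)%E.-integrable setT (EFin \o (fun z : R * R => h z.1 z.2)).
  apply/integrable12ltyP; first by apply/measurable_EFinP.
  pose g := box_cst (2 * M ^+ 2) M.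
  have ig : mu.-integrable setT (EFin \o g) by exact: integrable_bdd_supp (box_cst_measurable _ _) (box_cst_bdd _ _).
  have /integrableP[_] := ig; apply: le_lt_trans.
  apply: ge0_le_integral => //.
  - by move=> x _; apply: integral_ge0.
  - apply: (@measurable_fun_fubini_tonelli_F _ _ _ _ _ mu
      (fun z : R * R => `|(h z.1 z.2)%:E|%E)) => //.
    by apply: measurableT_comp => //; apply/measurable_EFinP.
  - by apply: measurableT_comp => //; exact: (measurable_int mu ig).
  - move=> x _ /=.
    have mhx := measurable_int mu (ih x).
    have bhx : bdd_supp M (fun y => `|h x y|).
      move=> y; rewrite normr_id; split; first exact: (h1 x y).1.
      by move=> /(h1 x y).2 ->; rewrite normr0.
    have mhx' : measurable_fun setT (fun y => `|h x y|).
      by apply: measurableT_comp => //; apply/measurable_EFinP.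
    have -> : (\int[mu]_y `|h x y|%:E = (integ1 (fun y => `|h x y|))%:E)%E.
      by rewrite /integ1 /Rintegral fineK//; exact: integrable_fin_num (integrable_bdd_supp mhx' bhx).
    rewrite lee_fin; apply: le_trans (ler_norm _) (le_trans _ (ler_norm _)).
    apply: (@le_box_cst (fun x => integ1 (fun y => `|h x y|)) M) => [|Mx]; first exact: integ1_bound.
    rewrite (_ : (fun y => _) = fun=> 0) ?/integ1 ?Rintegral_cst ?mul0r//.
    by apply/funext => y; rewrite (h2 y x).2 ?normr0.
congr fine.
have E1 x : (integ1 (h x))%:E = (\int[mu]_y (h x y)%:E)%E.
  by rewrite /integ1 /Rintegral fineK//; exact: integrable_fin_num (ih x).
have E2 y : (integ1 (h^~ y))%:E = (\int[mu]_x (h x y)%:E)%E.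
  by rewrite /integ1 /Rintegral fineK//; exact: integrable_fin_num (ih2 y).
under eq_integral do rewrite E1.
under [in RHS]eq_integral do rewrite E2.
exact: (Fubini im).
Qed.
End OneDim.

(** * Iterated integrals *)

Section Iterated.
Variable R : realType.

Lemma cvg_eqf (u v : nat -> R) (l : R) : (forall n, u n = v n) ->
  v n @[n --> \oo] --> l -> u n @[n --> \oo] --> l.
Proof. by move=> /funext ->. Qed.

Lemma cvg_maxr (u v : nat -> R) (a b : R) : u n @[n --> \oo] --> a -> v n @[n --> \oo] --> b ->
  Num.max (u n) (v n) @[n --> \oo] --> Num.max a b.
Proof.
move=> ua vb; rewrite maxr_absE; under eq_fun do rewrite maxr_absE.
by apply: cvgMl; apply: cvgD; [exact: cvgD|apply: cvg_norm; exact: cvgB].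
Qed.

(** The coordinatewise form is compatible with splitting off the first coordinate, on which all
    inductions on the dimension rely; [ccvgP] identifies it with topological convergence. *)
Definition ccvg (m : nat) (u : nat -> 'rV[R]_m) (x : 'rV[R]_m) : Prop :=
  forall i, u n 0 i @[n --> \oo] --> x 0 i.

Definition scont (m : nat) (g : 'rV[R]_m -> R) : Prop :=
  forall u x, ccvg u x -> g (u n) @[n --> \oo] --> g x.

Definition slice (m : nat) (g : 'rV[R]_m.+1 -> R) (t : R) (y : 'rV[R]_m) : R :=
  g (row_mx (const_mx t : 'rV[R]_1) y).

Lemma iintS (m : nat) (g : 'rV[R]_m.+1 -> R) :
  iint g = integ1 (fun t => iint (slice g t)).
Proof. by []. Qed.

Lemma coord_le_norm (m : nat) (x : 'rV[R]_m) i : `|x 0 i| <= `|x|.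
Proof.
rewrite [leRHS]/Num.norm /= mx_normrE; apply: (le_bigmax _ (fun ij => `|x ij.1 ij.2|) (0, i)).
Qed.

Lemma norm_leP (m : nat) (x : 'rV[R]_m) (M : R) : 0 <= M ->
  (forall i, `|x 0 i| <= M) -> `|x| <= M.
Proof.
move=> M0 h; rewrite [leLHS]/Num.norm /= mx_normrE; apply/bigmax_leP; split=> //= -[i j] _ /=.
by rewrite (ord1 i); exact: h.
Qed.

Lemma ccvgP (m : nat) (u : nat -> 'rV[R]_m) (x : 'rV[R]_m) :
  ccvg u x <-> u n @[n --> \oo] --> x.
Proof.
split=> [h|h i]; last first.
  exact: (cvg_comp _ _ h (@coord_continuous _ _ _ 0 i x)).
apply/cvgrPdist_le => e e0.
have : \forall n \near \oo, forall i, `|x 0 i - u n 0 i| <= e.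
  apply: filter_forall => i; have /cvgrPdist_le/(_ e e0) := h i.
  by [].
apply: filterS => n hn; apply: norm_leP; first exact: ltW.
by move=> i; rewrite !mxE; exact: hn.
Qed.

Lemma continuous_scont (m : nat) (g : 'rV[R]_m -> R) : continuous g -> scont g.
Proof. by move=> cg u x /ccvgP ux; exact: (cvg_comp _ _ ux (cg x)). Qed.

Lemma row_cons0 (m : nat) (t : R) (y : 'rV[R]_m) :
  (row_mx (const_mx t : 'rV[R]_1) y : 'rV[R]_m.+1) 0 ord0 = t.
Proof.
have -> : ord0 = lshift m (ord0 : 'I_1) by apply: val_inj.
exact: etrans (row_mxEl _ _ _ _) (mxE _ _ _ _).
Qed.

Lemma row_consS (m : nat) (t : R) (y : 'rV[R]_m) i :
  (row_mx (const_mx t : 'rV[R]_1) y : 'rV[R]_m.+1) 0 (lift ord0 i) = y 0 i.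
Proof.
have -> : lift ord0 i = rshift 1 i by apply: val_inj.
exact: row_mxEr.
Qed.

Lemma ccvg_cons (m : nat) (s : nat -> R) t (u : nat -> 'rV[R]_m) y :
  s n @[n --> \oo] --> t -> ccvg u y ->
  @ccvg m.+1 (fun n => row_mx (const_mx (s n) : 'rV[R]_1) (u n))
    (row_mx (const_mx t : 'rV[R]_1) y).
Proof.
move=> st uy i; case: (unliftP ord0 i) => [j|] ->.
  by rewrite row_consS; under eq_fun do rewrite row_consS; exact: uy.
by rewrite row_cons0; under eq_fun do rewrite row_cons0; exact: st.
Qed.

Lemma ccvg_cst (m : nat) (x : 'rV[R]_m) : ccvg (fun=> x) x.
Proof. by move=> i; exact: cvg_cst. Qed.

Lemma slice_scont (m : nat) (g : 'rV[R]_m.+1 -> R) t : scont g -> scont (slice g t).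
Proof. by move=> sg u x ux; apply: sg; apply: ccvg_cons => //; exact: cvg_cst. Qed.

Lemma norm_cons_ge (m : nat) t (y : 'rV[R]_m) :
  `|y| <= `|row_mx (const_mx t : 'rV[R]_1) y : 'rV[R]_m.+1|.
Proof.
apply: norm_leP => // i; rewrite -(row_consS t).
exact: coord_le_norm.
Qed.

Lemma norm_cons_ge0 (m : nat) t (y : 'rV[R]_m) :
  `|t| <= `|row_mx (const_mx t : 'rV[R]_1) y : 'rV[R]_m.+1|.
Proof. by rewrite -{1}(row_cons0 t y); exact: coord_le_norm. Qed.

Lemma slice_bdd (m : nat) M (g : 'rV[R]_m.+1 -> R) t : bdd_supp M g -> bdd_supp M (slice g t).
Proof.
move=> bg y; split; first exact: (bg _).1.
by move=> My; apply: (bg _).2; apply: lt_le_trans My _; exact: norm_cons_ge.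
Qed.

Lemma slice_out (m : nat) M (g : 'rV[R]_m.+1 -> R) t : bdd_supp M g -> M < `|t| ->
  slice g t = fun=> 0.
Proof.
move=> bg Mt; apply/funext => y; apply: (bg _).2; apply: lt_le_trans Mt _.
exact: norm_cons_ge0.
Qed.

Lemma integ1_0 : integ1 (fun _ : R => 0) = 0 :> R.
Proof. by rewrite /integ1 Rintegral_cst// mul0r. Qed.

Lemma iint0 (m : nat) : iint (fun _ : 'rV[R]_m => 0) = 0.
Proof.
elim: m => // m IH; rewrite iintS -[RHS]integ1_0; congr integ1.
by apply/funext => t; exact: IH.
Qed.

(** Iterates the one-dimensional bound; the maximum provides one constant that serves as both bound
    and support radius of the inner integral. *)
Fixpoint ibound (m : nat) (M : R) : R :=
  if m is m'.+1 then 2 * Num.max M (ibound m' M) ^+ 2 else M.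

(** Both parts go through one induction: the bound in dimension m+1 needs the inner integral to be
    measurable, which follows from its continuity, that is, from dominated convergence in dimension
    m. *)
Lemma iint_dct_aux (m : nat) (M : R) :
  (forall g : 'rV[R]_m -> R, scont g -> bdd_supp M g -> `|iint g| <= ibound m M) /\
  (forall (F : nat -> 'rV[R]_m -> R) g, (forall n, scont (F n)) ->
     (forall n, bdd_supp M (F n)) -> (forall x, F n x @[n --> \oo] --> g x) ->
     iint (F n) @[n --> \oo] --> iint g).
Proof.
elim: m => [|m [IHb IHc]].
  by split => [g sg bg|F g sF bF Fg]; [exact: (bg _).1|exact: Fg].
have H (g : 'rV[R]_m.+1 -> R) : scont g -> bdd_supp M g ->
    measurable_fun setT (fun t => iint (slice g t)) /\
    bdd_supp (Num.max M (ibound m M)) (fun t => iint (slice g t)).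
  move=> sg bg; split.
    apply: measurable_scont1 => u x ux; apply: IHc.
    - by move=> n; exact: slice_scont.
    - by move=> n; exact: slice_bdd.
    - by move=> y; apply: sg; apply: ccvg_cons => //; exact: ccvg_cst.
  move=> t; split.
    by rewrite le_max IHb ?orbT//; [exact: slice_scont|exact: slice_bdd].
  by rewrite gt_max => /andP[Mt _]; rewrite (slice_out bg Mt) iint0.
split.
  move=> g sg bg; rewrite iintS; have [mg bg'] := H g sg bg.
  exact: integ1_bound.
move=> F g sF bF Fg; rewrite iintS.
apply: (@integ1_dct _ (fun n t => iint (slice (F n) t)) _ (Num.max M (ibound m M))).
- by move=> n; exact: (H _ (sF n) (bF n)).1.
- by move=> n; exact: (H _ (sF n) (bF n)).2.
- move=> t; apply: IHc => [n|n|y].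
  + exact: slice_scont.
  + exact: slice_bdd.
  + exact: Fg.
Qed.

Lemma iint_dct (m : nat) (M : R) (F : nat -> 'rV[R]_m -> R) g :
  (forall n, scont (F n)) -> (forall n, bdd_supp M (F n)) ->
  (forall x, F n x @[n --> \oo] --> g x) -> iint (F n) @[n --> \oo] --> iint g.
Proof. by move=> *; apply: (iint_dct_aux m M).2. Qed.

Lemma iint_slice_reg (m : nat) (M : R) (g : 'rV[R]_m.+1 -> R) :
  scont g -> bdd_supp M g ->
  measurable_fun setT (fun t => iint (slice g t)) /\
  bdd_supp (Num.max M (ibound m M)) (fun t => iint (slice g t)).
Proof.
move=> sg bg; split.
  apply: measurable_scont1 => u x ux; apply: (@iint_dct _ M).
  - by move=> n; exact: slice_scont.
  - by move=> n; exact: slice_bdd.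
  - by move=> y; apply: sg; apply: ccvg_cons => //; exact: ccvg_cst.
move=> t; split.
  by rewrite le_max (iint_dct_aux m M).1 ?orbT//; [exact: slice_scont|exact: slice_bdd].
by rewrite gt_max => /andP[Mt _]; rewrite (slice_out bg Mt) iint0.
Qed.

Lemma scontD (m : nat) (f g : 'rV[R]_m -> R) : scont f -> scont g -> scont (fun x => f x + g x).
Proof. by move=> sf sg u x ux; apply: cvgD; [exact: sf|exact: sg]. Qed.
Lemma scontM (m : nat) (f g : 'rV[R]_m -> R) : scont f -> scont g -> scont (fun x => f x * g x).
Proof. by move=> sf sg u x ux; apply: cvgM; [exact: sf|exact: sg]. Qed.
Lemma scont_cst (m : nat) a : scont (fun _ : 'rV[R]_m => a).
Proof. by move=> u x ux; exact: cvg_cst. Qed.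
Lemma scontZ (m : nat) a (g : 'rV[R]_m -> R) : scont g -> scont (fun x => a * g x).
Proof. by move=> sg; apply: scontM => //; exact: scont_cst. Qed.
Lemma scont_max (m : nat) (f g : 'rV[R]_m -> R) : scont f -> scont g ->
  scont (fun x => Num.max (f x) (g x)).
Proof. by move=> sf sg u x ux; apply: cvg_maxr; [exact: sf|exact: sg]. Qed.

Lemma bdd_suppD (V : normedModType R) M N (f g : V -> R) : bdd_supp M f -> bdd_supp N g ->
  bdd_supp (M + N) (fun x => f x + g x).
Proof.
move=> bf bg x; have M0 := bdd_supp_ge0 bf; have N0 := bdd_supp_ge0 bg; split.
  by apply: le_trans (ler_normD _ _) _; rewrite lerD ?(bf x).1 ?(bg x).1.
move=> h; rewrite (bf x).2 ?(bg x).2 ?addr0//; apply: le_lt_trans h.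
  by rewrite lerDr.
by rewrite lerDl.
Qed.

Lemma bdd_suppZ (V : normedModType R) M a (g : V -> R) : bdd_supp M g ->
  bdd_supp (M * (1 + `|a|)) (fun x => a * g x).
Proof.
move=> bg x; have M0 := bdd_supp_ge0 bg; split.
  rewrite normrM mulrC; apply: ler_pM => //; first exact: (bg x).1.
  by rewrite lerDr.
move=> h; rewrite (bg x).2 ?mulr0//; apply: le_lt_trans h.
by rewrite ler_peMr// lerDl.
Qed.

Lemma bdd_supp_max (V : normedModType R) M N (f g : V -> R) : bdd_supp M f -> bdd_supp N g ->
  bdd_supp (Num.max M N) (fun x => Num.max (f x) (g x)).
Proof.
move=> bf bg x; split.
  have := (bf x).1; have := (bg x).1; rewrite le_max.
  by case: (leP (f x) (g x)) => _ h1 h2; rewrite ?h1 ?h2 ?orbT.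
by rewrite gt_max => /andP[h1 h2]; rewrite (bf x).2// (bg x).2// maxxx.
Qed.

Lemma iintD_scont (m : nat) M N (f g : 'rV[R]_m -> R) :
  scont f -> bdd_supp M f -> scont g -> bdd_supp N g ->
  iint (fun x => f x + g x) = iint f + iint g.
Proof.
elim: m M N f g => // m IH M N f g sf bf sg bg; rewrite !iintS.
have [mf bf'] := iint_slice_reg sf bf.
have [mg bg'] := iint_slice_reg sg bg.
rewrite -(integ1D mf bf' mg bg'); congr integ1; apply/funext => t.
apply: IH.
- exact: slice_scont sf.
- exact: slice_bdd bf.
- exact: slice_scont sg.
- exact: slice_bdd bg.
Qed.

Lemma iintZ_scont (m : nat) a M (g : 'rV[R]_m -> R) :
  scont g -> bdd_supp M g -> iint (fun x => a * g x) = a * iint g.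
Proof.
elim: m M g => // m IH M g sg bg; rewrite !iintS.
have [mg bg'] := iint_slice_reg sg bg.
rewrite -(integ1Z a mg bg'); congr integ1; apply/funext => t.
apply: IH; [exact: slice_scont sg|exact: slice_bdd bg].
Qed.

Lemma iint_le_scont (m : nat) M N (f g : 'rV[R]_m -> R) :
  scont f -> bdd_supp M f -> scont g -> bdd_supp N g ->
  (forall x, f x <= g x) -> iint f <= iint g.
Proof.
elim: m M N f g => [|m IH] M N f g sf bf sg bg fg; first exact: fg.
rewrite !iintS.
have [mf bf'] := iint_slice_reg sf bf.
have [mg bg'] := iint_slice_reg sg bg.
apply: (integ1_le mf bf' mg bg') => t; apply: (IH M N).
- exact: slice_scont sf.
- exact: slice_bdd bf.
- exact: slice_scont sg.
- exact: slice_bdd bg.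
- by move=> y; exact: fg.
Qed.

(** A substitute for integrability over the product: bounded limits of continuous functions with a
    common bounded support. Sharp indicators of closed sets enter in this way, and linearity,
    monotonicity and translation invariance pass to the limit. *)
Definition good (m : nat) (g : 'rV[R]_m -> R) : Prop :=
  exists M F, [/\ forall n, scont (F n), forall n, bdd_supp M (F n) &
    forall x, F n x @[n --> \oo] --> g x].

Lemma good_scont (m : nat) M (g : 'rV[R]_m -> R) : scont g -> bdd_supp M g -> good g.
Proof. by move=> sg bg; exists M, (fun=> g); split => // x; exact: cvg_cst. Qed.

Lemma good_cvg (m : nat) M F (g : 'rV[R]_m -> R) : (forall n, scont (F n)) ->
  (forall n, bdd_supp M (F n)) -> (forall x, F n x @[n --> \oo] --> g x) -> good g.
Proof. by move=> *; exists M, F. Qed.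

Lemma goodD (m : nat) (f g : 'rV[R]_m -> R) : good f -> good g -> good (fun x => f x + g x).
Proof.
move=> [M [F [sF bF Ff]]] [N [G [sG bG Gg]]].
exists (M + N), (fun n x => F n x + G n x); split => [n|n|x].
- exact: scontD.
- exact: bdd_suppD.
- exact: cvgD.
Qed.

Lemma goodZ (m : nat) a (g : 'rV[R]_m -> R) : good g -> good (fun x => a * g x).
Proof.
move=> [N [G [sG bG Gg]]].
exists (N * (1 + `|a|)), (fun n x => a * G n x); split => [n|n|x].
- exact: scontZ.
- exact: bdd_suppZ.
- by apply: cvgM => //; exact: cvg_cst.
Qed.

Lemma good0 (m : nat) : good (fun _ : 'rV[R]_m => 0).
Proof.
apply: (@good_scont _ 0); first exact: scont_cst.
by move=> x; rewrite normr0.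
Qed.

Lemma good_sum (m : nat) (I : Type) (r : seq I) (g : I -> 'rV[R]_m -> R) :
  (forall i, good (g i)) -> good (fun x => \sum_(i <- r) g i x).
Proof.
move=> gg; elim: r => [|i r IH].
  by under eq_fun do rewrite big_nil; exact: good0.
by under eq_fun do rewrite big_cons; exact: goodD.
Qed.

Lemma iintD (m : nat) (f g : 'rV[R]_m -> R) : good f -> good g ->
  iint (fun x => f x + g x) = iint f + iint g.
Proof.
move=> [M [F [sF bF Ff]]] [N [G [sG bG Gg]]].
apply: (@cvg_unique _ _ (iint (fun x => F n x + G n x) @[n --> \oo])) => //.
  apply: (@iint_dct _ (M + N) (fun n x => F n x + G n x)) => [n|n|x].
  - exact: scontD.
  - exact: bdd_suppD.
  - exact: cvgD.
apply: (cvg_eqf (fun n => iintD_scont (sF n) (bF n) (sG n) (bG n))).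
by apply: cvgD; apply: iint_dct; eauto.
Qed.

Lemma iintZ (m : nat) a (g : 'rV[R]_m -> R) : good g ->
  iint (fun x => a * g x) = a * iint g.
Proof.
move=> [M [F [sF bF Ff]]].
apply: (@cvg_unique _ _ (iint (fun x => a * F n x) @[n --> \oo])) => //.
  apply: (@iint_dct _ (M * (1 + `|a|)) (fun n x => a * F n x)) => [n|n|x].
  - exact: scontZ.
  - exact: bdd_suppZ.
  - by apply: cvgM => //; exact: cvg_cst.
apply: (cvg_eqf (fun n => iintZ_scont a (sF n) (bF n))).
by apply: cvgM; [exact: cvg_cst|apply: iint_dct; eauto].
Qed.

Lemma iint_sum (m : nat) (I : Type) (r : seq I) (g : I -> 'rV[R]_m -> R) :
  (forall i, good (g i)) -> iint (fun x => \sum_(i <- r) g i x) = \sum_(i <- r) iint (g i).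
Proof.
move=> gg; elim: r => [|i r IH].
  by under eq_fun do rewrite big_nil; rewrite big_nil iint0.
under eq_fun do rewrite big_cons.
by rewrite big_cons -IH iintD//; exact: good_sum.
Qed.

(** The two approximating sequences need not be ordered. Replacing the second by the pointwise
    maximum of both orders them without changing its limit. *)
Lemma iint_le (m : nat) (f g : 'rV[R]_m -> R) : good f -> good g ->
  (forall x, f x <= g x) -> iint f <= iint g.
Proof.
move=> [M [F [sF bF Ff]]] [N [G [sG bG Gg]]] fg.
have sH n : scont (fun x => Num.max (F n x) (G n x)) by exact: scont_max.
have bH n : bdd_supp (Num.max M N) (fun x => Num.max (F n x) (G n x)) by exact: bdd_supp_max.
have Hg x : Num.max (F n x) (G n x) @[n --> \oo] --> g x.
  by rewrite -(max_idPr (fg x)); exact: cvg_maxr.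
apply: (ler_cvg_to (iint_dct sF bF Ff) (iint_dct sH bH Hg)).
apply: nearW => n; apply: (iint_le_scont (sF n) (bF n) (sH n) (bH n)) => x.
by rewrite le_max lexx.
Qed.

Lemma iint_shift_scont (m : nat) M (g : 'rV[R]_m -> R) v :
  scont g -> bdd_supp M g -> iint (fun x => g (v + x)) = iint g.
Proof.
elim: m M g v => [|m IH] M g v sg bg.
  by congr iint; apply/funext => x; congr g; apply/rowP => -[].
rewrite !iintS; have [mg bg'] := iint_slice_reg sg bg.
rewrite -(integ1_shift (v 0 ord0) mg bg'); congr integ1; apply/funext => t.
pose v' : 'rV[R]_m := \row_i v 0 (lift ord0 i).
rewrite -(IH M (slice g (v 0 ord0 + t)) v'); last 2 first.
- exact: slice_scont sg.
- exact: slice_bdd bg.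
congr iint; apply/funext => y; rewrite /slice; congr g.
apply/rowP => i; case: (unliftP ord0 i) => [j|] ->.
  by rewrite mxE !row_consS !mxE.
by rewrite mxE !row_cons0.
Qed.

Lemma ccvgD (m : nat) (u w : nat -> 'rV[R]_m) x y : ccvg u x -> ccvg w y ->
  ccvg (fun n => u n + w n) (x + y).
Proof.
by move=> ux wy i; rewrite mxE; under eq_fun do rewrite mxE; exact: cvgD.
Qed.

Lemma ccvgZ (m : nat) (a : nat -> R) (b : R) (u : nat -> 'rV[R]_m) x :
  a n @[n --> \oo] --> b -> ccvg u x -> ccvg (fun n => a n *: u n) (b *: x).
Proof.
by move=> ab ux i; rewrite mxE; under eq_fun do rewrite mxE; exact: cvgM.
Qed.

Lemma scont_shift (m : nat) (g : 'rV[R]_m -> R) v : scont g -> scont (fun x => g (v + x)).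
Proof. by move=> sg u x ux; apply: sg; apply: ccvgD => //; exact: ccvg_cst. Qed.

Lemma good_shift (m : nat) (g : 'rV[R]_m -> R) v : good g -> good (fun x => g (v + x)).
Proof.
move=> [M [F [sF bF Ff]]]; exists (M + `|v|), (fun n x => F n (v + x)).
by split => [n|n|x]; [exact: scont_shift|exact: bdd_supp_shift|exact: Ff].
Qed.

Lemma iint_shift (m : nat) (g : 'rV[R]_m -> R) v : good g ->
  iint (fun x => g (v + x)) = iint g.
Proof.
move=> [M [F [sF bF Ff]]].
apply: (@cvg_unique _ _ (iint (fun x => F n (v + x)) @[n --> \oo])) => //.
  apply: (@iint_dct _ (M + `|v|) (fun n x => F n (v + x))).
  - by move=> n; exact: scont_shift.
  - by move=> n; exact: bdd_supp_shift.
  - by move=> x; exact: Ff.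
apply: (cvg_eqf (fun n => iint_shift_scont v (sF n) (bF n))).
exact: iint_dct bF Ff.
Qed.

Lemma iint_swap (m : nat) M (h : R -> 'rV[R]_m -> R) :
  (forall (s : nat -> R) u t y, s n @[n --> \oo] --> t -> ccvg u y ->
     h (s n) (u n) @[n --> \oo] --> h t y) ->
  (forall t, bdd_supp M (h t)) -> (forall y, bdd_supp M (h^~ y)) ->
  integ1 (fun t => iint (h t)) = iint (fun y => integ1 (h^~ y)).
Proof.
elim: m M h => [|m IH] M h sh b1 b2 //.
rewrite iintS.
transitivity (integ1 (fun s => integ1 (fun t => iint (slice (h t) s)))).
  rewrite (_ : (fun t => iint (h t)) = (fun t => integ1 (fun s => iint (slice (h t) s)))); last by [].
  apply: (@integ1_swap _ (fun t s => iint (slice (h t) s)) (Num.max M (ibound m M))).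
  - move=> u v x y ux vy; apply: (@iint_dct _ M).
    + by move=> n; apply: slice_scont => w z wz; apply: sh => //; exact: cvg_cst.
    + by move=> n; exact: slice_bdd.
    + by move=> z; apply: sh => //; apply: ccvg_cons => //; exact: ccvg_cst.
  - move=> t; apply: (iint_slice_reg _ (b1 t)).2 => w z wz.
    by apply: sh => //; exact: cvg_cst.
  - move=> s t; split.
      rewrite le_max (iint_dct_aux m M).1 ?orbT//; last exact: slice_bdd.
      by apply: slice_scont => w z wz; apply: sh => //; exact: cvg_cst.
    rewrite gt_max => /andP[Mt _].
    rewrite (_ : slice (h t) s = fun=> 0) ?iint0//.
    by apply/funext => y; exact: (b2 _ _).2.
congr integ1; apply/funext => s.
apply: (IH M (fun t => slice (h t) s)).
- move=> v u t y vt uy; apply: sh => //; apply: ccvg_cons => //; exact: cvg_cst.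
- by move=> t; exact: slice_bdd.
- by move=> y; exact: b2.
Qed.

End Iterated.

(** * Coordinate changes and derivatives *)

Section CoordDeriv.
Variable R : realType.

Lemma ccvg_norm m (u : nat -> 'rV[R]_m) x : ccvg u x -> `|u n| @[n --> \oo] --> `|x|.
Proof. by move=> /ccvgP ux; exact: cvg_norm. Qed.

Lemma unit_vecE m (k i : 'I_m) : unit_vec R k 0 i = (i == k)%:R.
Proof. by rewrite /unit_vec mxE eqxx. Qed.

Lemma addv_coord m (k i : 'I_m) (y : 'rV[R]_m) (t : R) :
  (y + t *: unit_vec R k) 0 i = y 0 i + t * (i == k)%:R.
Proof. by rewrite mxE; congr (_ + _); rewrite mxE unit_vecE. Qed.

Lemma norm_unit_vec m (k : 'I_m) : `|unit_vec R k| = 1.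
Proof.
apply/eqP; rewrite eq_le; apply/andP; split.
  by apply: norm_leP => // i; rewrite unit_vecE; case: eqP; rewrite ?normr1 ?normr0.
by have := coord_le_norm (unit_vec R k) k; rewrite unit_vecE eqxx normr1.
Qed.

(** Expresses an integral over the whole space through integrals over the lines parallel to the k-th
    axis, the redundant coordinate [y 0 k] being absorbed by a weight [eta]. This matches the
    redundant coordinate in [int_facet]. *)
Lemma iint_coord m (k : 'I_m) M N (g : 'rV[R]_m -> R) (eta : R -> R) :
  scont g -> bdd_supp M g ->
  (forall (u : nat -> R) x, u n @[n --> \oo] --> x -> eta (u n) @[n --> \oo] --> eta x) ->
  bdd_supp N eta ->
  iint (fun y => eta (y 0 k) * integ1 (fun t => g (y + (t - y 0 k) *: unit_vec R k)))
  = integ1 eta * iint g.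
Proof.
move=> sg bg se be.
have M0 := bdd_supp_ge0 bg; have N0 := bdd_supp_ge0 be.
set e := unit_vec R k.
have me : measurable_fun setT eta by exact: measurable_scont1.
have cg (s : nat -> R) u (t : R) y : s n @[n --> \oo] --> t -> ccvg u y ->
    g (u n + s n *: e) @[n --> \oo] --> g (y + t *: e).
  by move=> st uy; apply: sg; apply: ccvgD => //; apply: ccvgZ => //; exact: ccvg_cst.
have line (y : 'rV[R]_m) (t : R) : M < `|y 0 k + t| -> g (y + t *: e) = 0.
  move=> h; apply: (bg _).2; apply: lt_le_trans h _.
  by have := coord_le_norm (y + t *: e) k; rewrite addv_coord eqxx mulr1.
have line' (y : 'rV[R]_m) (t : R) i : i != k -> M < `|y 0 i| -> g (y + t *: e) = 0.
  move=> ik h; apply: (bg _).2; apply: lt_le_trans h _.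
  by have := coord_le_norm (y + t *: e) i; rewrite addv_coord (negPf ik) mulr0 addr0.
(* [K] exceeds every bound and every support radius occurring in the two exchanges of integrals. *)
pose K := M * N + M + N.
have MK : M <= K by rewrite /K -addrA addrCA lerDl addr_ge0 ?mulr_ge0.
have NK : N <= K by rewrite /K lerDr addr_ge0 ?mulr_ge0.
have MNK : M + N <= K by rewrite /K -addrA lerDr mulr_ge0.
have MmNK : M * N <= K by rewrite /K -addrA lerDl addr_ge0.
have bdK t z : `|eta t * g z| <= K.
  by rewrite normrM mulrC; apply: le_trans MmNK; apply: ler_pM => //; [exact: (bg _).1|exact: (be _).1].
have bK (t : R) : bdd_supp K (fun y : 'rV[R]_m => eta (y 0 k) * g (y + t *: e)).
  move=> y; split; first exact: bdK.
  move=> h; have [Nk|Nk] := ltP N `|y 0 k|; first by rewrite (be _).2// mul0r.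
  have [i Ki] : exists i, K < `|y 0 i|.
    apply: contrapT => /forallNP hi; move: h; rewrite ltNge => /negP; apply.
    by apply: norm_leP => [|i]; [exact: le_trans MK|rewrite leNgt; apply/negP; exact: hi].
  have ik : i != k by apply/eqP => ik; move: Ki; rewrite ik ltNge (le_trans Nk).
  by rewrite (line' y t i ik) ?mulr0//; exact: le_lt_trans Ki.
transitivity (iint (fun y => integ1 (fun t => eta (y 0 k) * g (y + t *: e)))).
  congr iint; apply/funext => y.
  have mgy : measurable_fun setT (fun t : R => g (y + (t - y 0 k) *: e)).
    apply: measurable_scont1 => u x ux; apply: cg; last exact: ccvg_cst.
    by apply: cvgB => //; exact: cvg_cst.
  have bgy : bdd_supp M (fun t : R => g (y + (t - y 0 k) *: e)).
    move=> t; split; first exact: (bg _).1.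
    by move=> h; apply: line; rewrite addrC subrK.
  rewrite -(integ1_shift (y 0 k) mgy bgy).
  rewrite (_ : (fun t : R => g (y + (y 0 k + t - y 0 k) *: e)) = (fun t : R => g (y + t *: e))); last first.
    by apply/funext => t; rewrite [y 0 k + t]addrC addrK.
  rewrite (@integ1Z _ (eta (y 0 k)) (fun t : R => g (y + t *: e)) (M + `|y 0 k|))//.
    by apply: measurable_scont1 => u x ux; apply: cg => //; exact: ccvg_cst.
  move=> t; split; first by apply: le_trans (bg _).1 _; rewrite lerDl.
  move=> h; apply: line; rewrite -(ltrD2r `|y 0 k|); apply: lt_le_trans h _.
  by have := ler_normB (y 0 k + t) (y 0 k); rewrite [y 0 k + t]addrC addrK.
rewrite -(@iint_swap _ _ K (fun t y => eta (y 0 k) * g (y + t *: e))).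
(* For fixed [t], a translation of [y] by a multiple of the k-th unit vector moves the offset from
   [g] to [eta]. After the second exchange the inner integral involves [eta] alone. *)
- transitivity (integ1 (fun t => iint (fun y => eta (y 0 k - t) * g y))).
    congr integ1; apply/funext => t.
    have gH : good (fun y : 'rV[R]_m => eta (y 0 k) * g (y + t *: e)).
      apply: (good_scont _ (bK t)) => u x ux.
      by apply: cvgM; [apply: se; exact: ux|apply: cg => //; exact: cvg_cst].
    rewrite -(iint_shift (- (t *: e)) gH); congr iint; apply/funext => y.
    rewrite [- (t *: e) + y]addrC -scaleNr addv_coord eqxx mulr1; congr (_ * g _).
    by rewrite scaleNr subrK.
  rewrite (@iint_swap _ _ K (fun t y => eta (y 0 k - t) * g y)).
  + rewrite -(iintZ _ (good_scont sg bg)); congr iint; apply/funext => y.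
    have mt : measurable_fun setT (fun t : R => eta (y 0 k - t)).
      apply: measurable_scont1 => u x ux; apply: se; apply: cvgB => //; exact: cvg_cst.
    have bt : bdd_supp (N + `|y 0 k|) (fun t : R => eta (y 0 k - t)).
      move=> t; split; first by apply: le_trans (be _).1 _; rewrite lerDl.
      move=> h; apply: (be _).2; rewrite -(ltrD2r `|y 0 k|); apply: lt_le_trans h _.
      by have := ler_normD (t - y 0 k) (y 0 k); rewrite subrK distrC.
    rewrite (_ : (fun t : R => _) = fun t : R => g y * eta (y 0 k - t)); last first.
      by apply/funext => t; rewrite mulrC.
    rewrite (integ1Z _ mt bt) mulrC; congr (_ * _).
    rewrite -(integ1_opp mt bt).
    rewrite (_ : (fun t : R => _) = fun t : R => eta (y 0 k + t)); last by apply/funext => t; rewrite opprK.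
    exact: integ1_shift be.
  + move=> s u t y st uy; apply: cvgM; last exact: sg.
    by apply: se; apply: cvgB => //; exact: uy.
  + move=> t y; split; first exact: bdK.
    by move=> h; rewrite (bg _).2 ?mulr0//; exact: le_lt_trans h.
  + move=> y t; split; first exact: bdK.
    move=> h; have [Mk|Mk] := ltP M `|y|; first by rewrite (bg _).2// mulr0.
    rewrite (be _).2 ?mul0r//.
    have := le_lt_trans MNK h; have := le_trans (coord_le_norm y k) Mk.
    have := ler_normD (t - y 0 k) (y 0 k); rewrite subrK distrC; lra.
- move=> s u t y st uy; apply: cvgM; last exact: cg.
  by apply: se; exact: uy.
- exact: bK.
- move=> y t; split; first exact: bdK.
  move=> h; have [Nk|Nk] := ltP N `|y 0 k|; first by rewrite (be _).2// mul0r.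
  rewrite line ?mulr0//.
  have := le_lt_trans MNK h.
  have := ler_normB (y 0 k + t) (y 0 k); rewrite [y 0 k + t]addrC addrK; lra.
Qed.

Lemma is_deriveP (V : normedModType R) (x v : V) (f : V -> R) (d : R) :
  is_derive x v f d <-> (fun h : R => h^-1 * (f (h *: v + x) - f x)) @ 0^' --> d.
Proof.
split=> [[df <-]|h].
  exact: df.
have df : derivable f x v by apply/cvg_ex; exists d.
by apply: DeriveDef => //; exact: cvg_lim.
Qed.

Lemma is_derive_line (V : normedModType R) (x v : V) (f : V -> R) (t d : R) :
  is_derive (x + t *: v) v f d <-> is_derive t (1 : R) (fun s : R => f (x + s *: v)) d.
Proof.
rewrite !is_deriveP.
rewrite (_ : (fun h : R => h^-1 * (f (h *: v + (x + t *: v)) - f (x + t *: v))) =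
  (fun h : R => h^-1 * (f (x + (h *: (1 : R) + t) *: v) - f (x + t *: v))))//.
apply/funext => h; congr (_ * (f _ - _)).
by rewrite [h *: 1]mulr1 scalerDl addrCA.
Qed.

Lemma is_derive_line0 (V : normedModType R) (x v : V) (f : V -> R) (d : R) :
  is_derive x v f d <-> is_derive (0 : R) (1 : R) (fun s : R => f (x + s *: v)) d.
Proof. by rewrite -is_derive_line scale0r addr0. Qed.

Lemma is_derive_comp1 (V : normedModType R) (x v : V) (g : V -> R) (p : R -> R) (dg dp : R) :
  is_derive x v g dg -> is_derive (g x) (1 : R) p dp -> is_derive x v (fun y => p (g y)) (dp * dg).
Proof.
move=> /is_derive_line0 hg hp; apply/is_derive_line0.
apply: is_derive1_comp.
by rewrite scale0r addr0.
Qed.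

Lemma cvg_natinv : (n.+1%:R^-1 : R) @[n --> \oo] --> (0 : R).
Proof. exact: cvg_harmonic. Qed.

Lemma is_derive_seq (V : normedModType R) (x v : V) (f : V -> R) (d : R) (r : nat -> R) :
  (forall n, r n != 0) -> r n @[n --> \oo] --> (0 : R) ->
  is_derive x v f d -> (r n)^-1 * (f (x + r n *: v) - f x) @[n --> \oo] --> d.
Proof.
move=> rn r0 /is_deriveP h.
have : r n @[n --> \oo] --> 0^'.
  move=> A hA.
  have H : \forall n \near \oo, (r n != 0 -> A (r n)) := r0 _ hA.
  by change (\forall n \near \oo, A (r n)); apply: filterS H => n; apply; exact: rn.
move=> /cvg_comp/(_ h) /=; apply: cvg_trans; apply: near_eq_cvg; apply: nearW => n /=.
by rewrite [r n *: v + x]addrC.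
Qed.

Lemma MVT_line (V : normedModType R) (x v : V) (f df : V -> R) (a : R) : 0 <= a ->
  (forall t : R, 0 <= t <= a -> is_derive (x + t *: v) v f (df (x + t *: v))) ->
  exists2 t : R, 0 <= t <= a & f (x + a *: v) - f x = a * df (x + t *: v).
Proof.
move=> a0 h.
have h' (t : R) : t \in `[0, a]%R -> is_derive t (1:R) (fun s : R => f (x + s *: v)) (df (x + t *: v)).
  by move=> ht; apply: (proj1 (is_derive_line x v f t _)); apply: h; move: ht; rewrite in_itv.
have h1 (t : R) : t \in `]0, a[%R -> is_derive t (1:R) (fun s : R => f (x + s *: v)) (df (x + t *: v)).
  by move=> ht; apply: h'; exact: subset_itv_oo_cc.
have hc : {within `[0, a], continuous (fun s : R => f (x + s *: v))}.
  by apply: derivable_within_continuous => t /h' [].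
have [t ht E] := MVT_segment a0 h1 hc.
exists t; first by move: ht; rewrite in_itv.
by move: E; rewrite scale0r addr0 subr0 mulrC.
Qed.

(** Translation invariance makes the integral of each difference quotient zero; the mean value
    theorem bounds the quotients, so dominated convergence applies. *)
Lemma iint_derive0 m (k : 'I_m) M (g g' : 'rV[R]_m -> R) :
  scont g -> bdd_supp M g -> (forall x, `|g' x| <= M) ->
  (forall x, is_derive x (unit_vec R k) g (g' x)) -> iint g' = 0.
Proof.
move=> sg bg bg' dg.
have M0 := bdd_supp_ge0 bg.
set e := unit_vec R k.
pose r (n : nat) : R := n.+1%:R^-1.
have r0 n : 0 < r n by rewrite /r invr_gt0.
have r1 n : r n <= 1 by rewrite /r invf_le1// ler1n.
pose Q n x := (r n)^-1 * (g (r n *: e + x) + (-1) * g x).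
have QE n x : Q n x = (r n)^-1 * (g (x + r n *: e) - g x) by rewrite /Q mulN1r addrC [_ + x]addrC addrC.
have sQ n : scont (Q n).
  by apply: scontZ; apply: scontD; [exact: scont_shift|exact: scontZ].
have bQ n : bdd_supp (M + 1) (Q n).
  move=> x; rewrite QE; split.
    have [t _ ->] := MVT_line (ltW (r0 n)) (fun t _ => dg (x + t *: e)).
    by rewrite mulKf ?gt_eqF//; apply: le_trans (bg' _) _; rewrite lerDl.
  move=> h; rewrite (bg x).2 ?subr0; last by apply: le_lt_trans h; rewrite lerDl.
  rewrite (bg _).2 ?mulr0//.
  have := ler_normB (x + r n *: e) (r n *: e); rewrite addrK normrZ norm_unit_vec mulr1 gtr0_norm//.
  by have := r1 n; lra.
have Qc x : Q n x @[n --> \oo] --> g' x.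
  apply: (cvg_eqf (fun n => QE n x)).
  apply: is_derive_seq => //.
  - by move=> n; rewrite gt_eqF.
  - exact: cvg_natinv.
have := iint_dct sQ bQ Qc.
have gg : good g := good_scont sg bg.
rewrite (_ : (fun n => iint (Q n)) = fun=> 0).
  by move=> h; apply/esym; apply: (@cvg_unique _ _ ((0 : R) @[_ --> (\oo : set_system nat)])) => //; exact: cvg_cst.
apply/funext => n; rewrite /Q iintZ; last by apply: goodD; [exact: good_shift|exact: goodZ].
rewrite iintD; [|exact: good_shift|exact: goodZ].
by rewrite iint_shift// iintZ// mulN1r subrr mulr0.
Qed.

Lemma exists_natS_gt (x : R) : exists n : nat, x < n.+1%:R.
Proof.
exists (Num.bound `|x|); apply: le_lt_trans (ler_norm _) _.
by apply: lt_trans (archi_boundP (normr_ge0 x)) _; rewrite ltr_nat.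
Qed.

Definition bump m (M : R) (x : 'rV[R]_m) : R := Num.max 0 (Num.min 1 (M + 1 - `|x|)).

Lemma cvg_minr (u v : nat -> R) (a b : R) : u n @[n --> \oo] --> a -> v n @[n --> \oo] --> b ->
  Num.min (u n) (v n) @[n --> \oo] --> Num.min a b.
Proof.
move=> ua vb; rewrite minr_absE; under eq_fun do rewrite minr_absE.
by apply: cvgMl; apply: cvgB; [exact: cvgD|apply: cvg_norm; exact: cvgB].
Qed.

Lemma bump_scont m M : scont (@bump m M).
Proof.
move=> u x ux; apply: cvg_maxr; first exact: cvg_cst.
apply: cvg_minr; first exact: cvg_cst.
by apply: cvgB; [exact: cvg_cst|exact: ccvg_norm].
Qed.

Lemma bump_ge0 m M (x : 'rV[R]_m) : 0 <= bump M x.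
Proof. by rewrite /bump le_max lexx. Qed.

Lemma bump_le1 m M (x : 'rV[R]_m) : bump M x <= 1.
Proof. by rewrite /bump ge_max ler01 ge_min lexx. Qed.

Lemma bump_1 m M (x : 'rV[R]_m) : `|x| <= M -> bump M x = 1.
Proof.
move=> h; rewrite /bump (min_idPl _) ?(max_idPr _)//; lra.
Qed.

Lemma bump_0 m M (x : 'rV[R]_m) : M + 1 <= `|x| -> bump M x = 0.
Proof.
move=> h; rewrite /bump; apply: max_idPl; rewrite ge_min; apply/orP; right; lra.
Qed.

Lemma bump_bdd m M : 0 <= M -> bdd_supp (M + 1) (@bump m M).
Proof.
move=> M0 x; split; last by move=> h; rewrite bump_0// ltW.
by rewrite ger0_norm ?bump_ge0// (le_trans (bump_le1 _ _))// lerDr.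
Qed.

Lemma aff_scont m (a : 'rV[R]_m) b : scont (aff a b).
Proof.
move=> u x ux; rewrite /aff; apply: cvgD; last exact: cvg_cst.
by apply: cvg_big => //; [exact: add_continuous|move=> i _; apply: cvgM; [exact: cvg_cst|exact: ux]].
Qed.

Lemma affD m (a : 'rV[R]_m) b x y : aff a b (x + y) = aff a b x + \sum_i a 0 i * y 0 i.
Proof.
rewrite /aff addrAC -big_split /=; congr (_ + _); apply: eq_bigr => i _.
by rewrite mxE mulrDr.
Qed.

Lemma affDu m (a : 'rV[R]_m) b x (t : R) k : aff a b (x + t *: unit_vec R k) = aff a b x + t * a 0 k.
Proof.
rewrite affD (bigD1 k)//= big1 ?addr0.
  by rewrite mxE unit_vecE eqxx mulr1 mulrC.
by move=> i ik; rewrite mxE unit_vecE (negPf ik) !mulr0.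
Qed.

Lemma good_hyperplane m (a : 'rV[R]_m) b M (g : 'rV[R]_m -> R) : scont g -> bdd_supp M g ->
  good (fun x => if aff a b x == 0 then g x else 0).
Proof.
move=> sg bg.
apply: (@good_cvg _ _ M (fun n x => Num.max 0 (1 - n%:R * `|aff a b x|) * g x)).
- move=> n; apply: scontM => //; apply: scont_max; first exact: scont_cst.
  move=> u x ux; apply: cvgB; first exact: cvg_cst.
  by apply: cvgM; [exact: cvg_cst|apply: cvg_norm; exact: aff_scont].
- move=> n x; split; last by move=> h; rewrite (bg x).2// mulr0.
  rewrite normrM; apply: le_trans (bg x).1; apply: ler_piMl => //.
  rewrite ger0_norm; last by rewrite le_max lexx.
  by rewrite ge_max ler01 gerBl mulr_ge0.
- move=> x; case: eqP => [->|/eqP L0].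
    under eq_fun do rewrite normr0 mulr0 subr0 (max_idPr ler01) mul1r.
    exact: cvg_cst.
  apply: cvg_near_cst; near=> n.
  rewrite (max_idPl _) ?mul0r// subr_le0 -ler_pdivrMr ?normr_gt0// mul1r.
  by near: n; exact: nbhs_infty_ger.
Unshelve. all: by end_near. Qed.

(** Arbitrarily many disjoint translates of a bump on the hyperplane have equal integrals, and their
    sum stays below one fixed bump; so each integral is zero. *)
Lemma iint_hyperplane m (a : 'rV[R]_m) b M (g : 'rV[R]_m -> R) : a != 0 -> scont g -> bdd_supp M g ->
  iint (fun x => if aff a b x == 0 then g x else 0) = 0.
Proof.
move=> a0 sg bg; have M0 := bdd_supp_ge0 bg.
have [k ak] : exists k, a 0 k != 0.
  by apply/existsP; apply: contraNT a0 => /existsPn h; apply/eqP/rowP => i; rewrite mxE; apply/eqP; rewrite -[_ == _]negbK h.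
(* Normalized so that the affine function grows by exactly 1 along [v]. *)
pose v := (a 0 k)^-1 *: unit_vec R k.
pose q (x : 'rV[R]_m) := if aff a b x == 0 then bump M x else 0.
have sb := @bump_scont m M; have bb := @bump_bdd m _ M0.
have gq : good q by exact: good_hyperplane sb bb.
have q0 x : 0 <= q x by rewrite /q; case: ifP => // _; exact: bump_ge0.
have Iq : iint q = 0.
  apply/eqP; rewrite eq_le; apply/andP; split; last first.
    by rewrite -(iint0 R m); apply: iint_le => //; exact: good0.
  pose B := bump (m := m) (M + 1 + `|v|).
  have gB : good B by apply: (good_scont (@bump_scont _ _)); apply: bump_bdd; rewrite !addr_ge0.
  rewrite leNgt; apply/negP => I0.
  (* The translate by [i / (N + 1)] times [v] lives on the level set of value [i / (N + 1)], so at
     most one translate is nonzero at any point. *)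
  have H N : N.+1%:R * iint q <= iint B.
    have -> : N.+1%:R * iint q = \sum_(i < N.+1) iint (fun x => q (- (i%:R / N.+1%:R) *: v + x)).
      rewrite (eq_bigr (fun=> iint q)); last by move=> i _; exact: iint_shift.
      by rewrite sumr_const card_ord mulr_natl.
    have gqi (i : 'I_N.+1) : good (fun x => q (- (i%:R / N.+1%:R) *: v + x)) by exact: good_shift.
    rewrite -iint_sum//; apply: iint_le => [|//|x]; first exact: good_sum.
    have qE (i : 'I_N.+1) : aff a b (- (i%:R / N.+1%:R) *: v + x) = aff a b x - i%:R / N.+1%:R.
      by rewrite addrC /v scalerA affDu mulNr mulNr mulfVK.
    have [/existsP[i /eqP hi]|/existsPn hn] := boolP [exists i : 'I_N.+1, aff a b x == i%:R / N.+1%:R].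
      rewrite (bigD1 i)//= big1 ?addr0; last first.
        move=> j ji; rewrite /q qE hi -mulrBl mulf_eq0 invr_eq0 pnatr_eq0 orbF subr_eq0 eqr_nat.
        by rewrite ifF//; apply/negbTE; move: ji; apply: contraNN => /eqP/val_inj ->.
      rewrite /q; case: ifP => _; last exact: bump_ge0.
      have [xM|xM] := leP `|x| (M + 1 + `|v|); first by apply: le_trans (bump_le1 _ _) _; rewrite /B bump_1.
      rewrite bump_0 ?bump_ge0//.
      have := ler_normB (- (i%:R / N.+1%:R) *: v + x) (- (i%:R / N.+1%:R) *: v).
      rewrite [_ *: v + x]addrC addrK normrZ normrN ger0_norm ?divr_ge0//.
      have : i%:R / N.+1%:R * `|v| <= `|v|.
        by rewrite ler_piMl// ler_pdivrMr// mul1r ler_nat ltnW.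
      move: (i%:R / _ * _) => z; lra.
    rewrite big1 ?bump_ge0// => i _; rewrite /q qE subr_eq0 ifF//; apply/negbTE; exact: hn.
  have [n hn] : exists n : nat, iint B / iint q < n.+1%:R.
    exact: exists_natS_gt.
  by move: hn; rewrite ltr_pdivrMr// ltNge H.
have gg := good_hyperplane a b sg bg.
have hq x : `|if aff a b x == 0 then g x else 0| <= M * q x.
  rewrite /q; case: ifP => _; last by rewrite normr0 mulr0.
  have [xM|xM] := leP `|x| M; first by rewrite bump_1// mulr1; exact: (bg x).1.
  by rewrite (bg x).2// normr0 mulr_ge0// bump_ge0.
apply/eqP; rewrite eq_le; apply/andP; split.
  have E : iint (fun x => M * q x) = 0 by rewrite iintZ// Iq mulr0.
  rewrite -[leRHS]E.
  by apply: iint_le; [exact: gg|exact: goodZ|move=> x; apply: le_trans (ler_norm _) (hq x)].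
have E : iint (fun x => - M * q x) = 0 by rewrite iintZ// Iq mulr0.
rewrite -[leLHS]E.
apply: iint_le; [exact: goodZ|exact: gg|move=> x].
by rewrite mulNr; have := hq x; rewrite ler_norml => /andP[].
Qed.

End CoordDeriv.

(** * Cutoffs and integrals over the polytope *)

Section Cutoff.
Variable R : realType.

Definition posX (n : nat) (t : R) : R := Num.max 0 t ^+ n.

Lemma posX_ge0 n t : 0 <= posX n t.
Proof. by rewrite exprn_ge0// le_max lexx. Qed.

Lemma posX_cvg n (u : nat -> R) x : u k @[k --> \oo] --> x -> posX n (u k) @[k --> \oo] --> posX n x.
Proof.
move=> ux; rewrite /posX; elim: n => [|n IH].
  by under eq_fun do rewrite expr0; rewrite expr0; exact: cvg_cst.
rewrite exprS; under eq_fun do rewrite exprS.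
by apply: cvgM => //; apply: cvg_maxr => //; exact: cvg_cst.
Qed.

Lemma posX_continuous n : continuous (posX n).
Proof.
by move=> x; apply: (proj2 (@cvg_nbhsP R R^o (posX n) x (posX n x))) => u; exact: posX_cvg.
Qed.

(** An exponent of at least 2 makes both one-sided derivatives at 0 vanish. *)
Lemma is_derive_posX n (t : R) :
  is_derive t (1 : R) (posX n.+2) (n.+2%:R * posX n.+1 t).
Proof.
have [t0|t0|<-] := ltgtP 0 t.
- have -> : n.+2%:R * posX n.+1 t = n.+2%:R *: t ^+ n.+1 by rewrite /posX (max_idPr (ltW t0)).
  have H : is_derive t (1 : R) (fun x : R => x ^+ n.+2) (n.+2%:R *: t ^+ n.+1).
    by apply: DeriveDef; [exact: exprn_derivable|rewrite exp_derive /GRing.scale /= mulr1].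
  apply: near_eq_is_derive H.
  near=> s; rewrite /posX (max_idPr _)// ltW//.
  by near: s; exact: lt_nbhsr.
- have -> : n.+2%:R * posX n.+1 t = 0 by rewrite /posX (max_idPl (ltW t0)) expr0n mulr0.
  apply: (@near_eq_is_derive _ _ _ (cst (0 : R))).
  near=> s; rewrite /posX (max_idPl _) ?expr0n// ltW//.
  by near: s; exact: lt_nbhsl.
- apply/is_deriveP.
  have -> : n.+2%:R * posX n.+1 0 = 0 by rewrite /posX maxxx expr0n mulr0.
  have : posX n.+1 h @[h --> (0:R)^'] --> (0:R).
    apply: cvg_within_filter.
    by have := @posX_continuous n.+1 0; rewrite /continuous_at {2}/posX maxxx expr0n.
  apply: cvg_trans; apply: near_eq_cvg; near=> h.
  have h0 : h != 0 by near: h; exact: nbhs_dnbhs_neq.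
  rewrite /= addr0 /GRing.scale /= mulr1 /posX maxxx expr0n subr0.
  have [hp|hp] := leP 0 h; first by rewrite [in RHS]exprS mulKf.
  by rewrite !expr0n mulr0.
Unshelve. all: by end_near. Qed.

(** A C^1 profile: 1 at 0, zero from 1 on, and at least 1 for negative arguments. The last feature
    matters because it is used in composition with itself: a negative argument inside sends the
    outer value to 0. *)
Definition pcut (t : R) : R := posX 2 (1 - t).
Definition dpcut (t : R) : R := - (2 * posX 1 (1 - t)).

Lemma is_derive_pcut (t : R) : is_derive t (1 : R) pcut (dpcut t).
Proof.
have H : is_derive t (1 : R) (fun s : R => 1 - s) (-1).
  have -> : (-1 : R) = 0 - 1 by rewrite sub0r.
  exact: is_deriveB.
have := is_derive_comp1 H (is_derive_posX 0 (1 - t)).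
by rewrite mulrN1.
Qed.

Lemma pcut_ge0 t : 0 <= pcut t. Proof. exact: posX_ge0. Qed.
Lemma pcut_ge1 t : t <= 0 -> 1 <= pcut t.
Proof.
move=> t0; rewrite /pcut /posX (max_idPr _); last lra.
by rewrite -[1]mulr1 expr2; apply: ler_pM; lra.
Qed.
Lemma pcut_0 t : 1 <= t -> pcut t = 0.
Proof. by move=> t1; rewrite /pcut /posX (max_idPl _) ?expr0n//; lra. Qed.
Lemma dpcut_0 t : 1 <= t -> dpcut t = 0.
Proof. by move=> t1; rewrite /dpcut /posX (max_idPl _) ?expr0n ?mulr0 ?oppr0//; lra. Qed.
Lemma pcut_le1 t : 0 <= t -> pcut t <= 1.
Proof.
move=> t0; rewrite /pcut /posX expr2 -[leRHS]mulr1.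
by apply: ler_pM; rewrite ?le_max ?lexx// ge_max ler01 gerBl.
Qed.
Lemma dpcut_le0 t : dpcut t <= 0.
Proof. by rewrite /dpcut oppr_le0 mulr_ge0// posX_ge0. Qed.
Lemma dpcut_ge t : 0 <= t -> -2 <= dpcut t.
Proof.
move=> t0; rewrite /dpcut lerN2 ler_piMr// /posX expr1 ge_max ler01 gerBl//.
Qed.
Lemma dpcut_homo s t : s <= t -> dpcut s <= dpcut t.
Proof.
move=> st; rewrite /dpcut lerN2 ler_pM2l// /posX !expr1.
by rewrite ge_max !le_max lexx /=; apply/orP; right; rewrite lerB.
Qed.
Lemma pcut_0' : pcut 0 = 1.
Proof. by rewrite /pcut /posX subr0 (max_idPr ler01) expr1n. Qed.
Lemma pcut_cvg (u : nat -> R) x : u k @[k --> \oo] --> x -> pcut (u k) @[k --> \oo] --> pcut x.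
Proof. by move=> ux; apply: posX_cvg; apply: cvgB => //; exact: cvg_cst. Qed.
Lemma dpcut_cvg (u : nat -> R) x : u k @[k --> \oo] --> x -> dpcut (u k) @[k --> \oo] --> dpcut x.
Proof.
move=> ux; apply: cvgN; apply: cvgM; first exact: cvg_cst.
by apply: posX_cvg; apply: cvgB => //; exact: cvg_cst.
Qed.

(* the profile [dpcut (pcut s) * dpcut s] is the derivative of [pcut \o pcut] *)
Lemma integ1_profile : integ1 (fun s => dpcut (pcut s) * dpcut s) = 1.
Proof.
rewrite /integ1.
have -> : (fun s => dpcut (pcut s) * dpcut s) =
    (fun s => dpcut (pcut s) * dpcut s) \_ (`[0, 1]%classic : set R).
  apply/funext => s; rewrite /patch; case: ifPn => // /negP hs.
  have [s0|s0] := leP s 0; first by rewrite dpcut_0 ?mul0r ?pcut_ge1.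
  have [s1|s1] := leP 1 s; first by rewrite [dpcut s]dpcut_0 ?mulr0.
  by exfalso; apply: hs; rewrite inE /= in_itv /= !ltW.
rewrite -Rintegral_mkcond /Rintegral.
have dP (s : R) : is_derive s (1 : R) (pcut \o pcut) (dpcut (pcut s) * dpcut s).
  exact: is_derive_comp1 (is_derive_pcut s) (is_derive_pcut (pcut s)).
have cdp : continuous dpcut.
  by move=> x; apply: (proj2 (@cvg_nbhsP R R^o dpcut x (dpcut x))) => u; exact: dpcut_cvg.
have cp : continuous pcut.
  by move=> x; apply: (proj2 (@cvg_nbhsP R R^o pcut x (pcut x))) => u; exact: pcut_cvg.
have cP : continuous (pcut \o pcut) by move=> x; apply: continuous_comp; [exact: cp|exact: cp].
rewrite (@continuous_FTC2 _ _ (pcut \o pcut)) //=.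
- by rewrite (@pcut_0 1)// pcut_0' pcut_0// subr0.
- apply: continuous_subspaceT => x; apply: cvgM; last exact: cdp.
  by apply: continuous_comp; [exact: cp|exact: cdp].
- split => [x _||].
  + by have [] := dP x.
  + by apply: cvg_at_right_filter; exact: cP.
  + by apply: cvg_at_left_filter; exact: cP.
- move=> x _; rewrite derive1E; exact: derive_val.
Qed.

End Cutoff.

(** * Integrability of continuous functions on the polytope *)

Section PolytopeGood.
Variables (R : realType) (m d : nat) (u : 'I_d -> 'rV[R]_m) (c : 'I_d -> R).
Notation D := (polytope u c).
Notation L j := (aff (u j) (c j)).
Hypothesis cD : compact D.

(** A continuous penalty vanishing exactly on the polytope, from which outer approximations of its
    indicator are built. *)
Definition pdefect (x : 'rV[R]_m) : R := \sum_(j < d) Num.max 0 (- L j x).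

Lemma scont_sum (I : Type) (r : seq I) (g : I -> 'rV[R]_m -> R) :
  (forall i, scont (g i)) -> scont (fun x => \sum_(i <- r) g i x).
Proof.
move=> sg; elim: r => [|i r IH].
  by under eq_fun do rewrite big_nil; exact: scont_cst.
by under eq_fun do rewrite big_cons; exact: scontD.
Qed.

Lemma pdefect_scont : scont pdefect.
Proof.
apply: scont_sum => j; apply: scont_max; first exact: scont_cst.
by move=> v x vx; apply: cvgN; exact: aff_scont.
Qed.

Lemma pdefect_ge0 x : 0 <= pdefect x.
Proof. by apply: sumr_ge0 => j _; rewrite le_max lexx. Qed.

Lemma pdefect0 x : D x -> pdefect x = 0.
Proof. by move=> Dx; apply: big1 => j _; apply: max_idPl; rewrite oppr_le0. Qed.

Lemma pdefect_gt0 x : ~ D x -> 0 < pdefect x.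
Proof.
move=> /existsNP[j /negP]; rewrite -ltNge => Lj.
rewrite /pdefect (bigD1 j)//= ltr_wpDr//.
  by apply: sumr_ge0 => i _; rewrite le_max lexx.
by rewrite lt_max oppr_gt0 Lj orbT.
Qed.

Lemma polytope_bounded : exists2 M : R, 0 <= M & forall x, D x -> `|x| <= M.
Proof.
have [M [_ h]] := compact_bounded cD.
exists (`|M| + 1); first by rewrite addr_ge0.
by move=> x Dx; apply: h => //; rewrite (le_lt_trans (ler_norm _))// ltrDl.
Qed.

Lemma within_bounded (g : 'rV[R]_m -> R) : {within D, continuous g} -> exists2 B : R, 0 < B & forall x, D x -> `|g x| <= B.
Proof.
move=> cg.
have [M [_ h]] := compact_bounded (continuous_compact cg cD).
exists (`|M| + 1); first by rewrite ltr_wpDl.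
by move=> x Dx; apply: h; [rewrite (le_lt_trans (ler_norm _))// ltrDl|exists x].
Qed.

(** Tietze extension. The global bound lets products with a bump function satisfy [bdd_supp]. *)
Lemma polytope_extension (g : 'rV[R]_m -> R) : {within D, continuous g} ->
  exists h (B : R), [/\ scont h, forall x, D x -> h x = g x & forall x, `|h x| <= B].
Proof.
move=> cg; have [B B0 gB] := within_bounded cg.
have clD : closed D.
  by apply: compact_closed => //; exact: norm_hausdorff.
have [h [h1 h2 h3]] := continuous_bounded_extension (@pseudometric_normal _ _) clD B0 cg gB.
exists h, B; split => //; first exact: continuous_scont.
by move=> x Dx; rewrite h1// inE.
Qed.

(* continuous approximations from outside of the indicator function of {q = 0} *)
Lemma cvg_outer (q : R) (a : nat -> R) (l : R) : 0 <= q -> a n @[n --> \oo] --> l ->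
  Num.max 0 (1 - n.+1%:R * q) * a n @[n --> \oo] --> (if q == 0 then l else 0).
Proof.
move=> q0 al; case: eqP => [->|/eqP qn0].
  by under eq_fun do rewrite mulr0 subr0 (max_idPr ler01) mul1r.
apply: cvg_near_cst; near=> n.
rewrite (max_idPl _) ?mul0r// subr_le0 -ler_pdivrMr ?lt_neqAle ?q0 1?eq_sym ?qn0//.
rewrite (@le_trans _ _ n%:R) ?ler_nat//.
by near: n; exact: nbhs_infty_ger.
Unshelve. all: by end_near. Qed.

Lemma outer_bound (q : R) n : 0 <= q -> 0 <= Num.max 0 (1 - n.+1%:R * q) <= 1.
Proof.
by move=> q0; rewrite le_max lexx /= ge_max ler01 gerBl mulr_ge0.
Qed.

Lemma good_polytope (g : 'rV[R]_m -> R) : {within D, continuous g} ->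
  good (fun x => if `[< D x >] then g x else 0).
Proof.
move=> cg; have [h [B [sh hg hB]]] := polytope_extension cg.
have [M M0 DM] := polytope_bounded.
have B0 : 0 <= B := le_trans (normr_ge0 _) (hB 0).
apply: (@good_cvg _ _ (B + (M + 1))
  (fun n x => Num.max 0 (1 - n.+1%:R * pdefect x) * (bump M x * h x))).
- move=> n; apply: scontM; last by apply: scontM => //; exact: bump_scont.
  apply: scont_max; first exact: scont_cst.
  move=> v x vx; apply: cvgB; first exact: cvg_cst.
  by apply: cvgM; [exact: cvg_cst|exact: pdefect_scont].
- move=> n x; have /andP[a0 a1] := outer_bound n (pdefect_ge0 x); split.
    rewrite normrM normrM ger0_norm// ger0_norm ?bump_ge0//.
    apply: (@le_trans _ _ (1 * (1 * B))); last by rewrite !mul1r lerDl addr_ge0.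
    by apply: ler_pM => //; [rewrite mulr_ge0 ?bump_ge0|apply: ler_pM => //; [exact: bump_ge0|exact: bump_le1]].
  by move=> hx; rewrite bump_0 ?mul0r ?mulr0//; apply/ltW; apply: le_lt_trans hx; rewrite lerDr.
- move=> x.
  have := @cvg_outer _ _ _ (pdefect_ge0 x) (@cvg_cst _ (bump M x * h x) nat \oo eventually_filter).
  case: asboolP => Dx.
    by rewrite pdefect0// eqxx bump_1 ?mul1r ?hg//; exact: DM.
  by rewrite gt_eqF ?pdefect_gt0.
Qed.

End PolytopeGood.

(** * The divergence inequality *)

Section Trapezoid.
Variable R : realType.

(** Continuous approximations from above of the indicator of [0,1], the range of the redundant
    coordinate in [int_facet]; [iint_coord] needs a continuous weight. *)
Definition trap (n : nat) (t : R) : R :=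
  Num.max 0 (1 - n.+1%:R * (Num.max 0 (- t) + Num.max 0 (t - 1))).

Let def (t : R) : R := Num.max 0 (- t) + Num.max 0 (t - 1).

Let def_ge0 t : 0 <= def t.
Proof. by rewrite addr_ge0// le_max lexx. Qed.

Lemma trap_cvg n (v : nat -> R) x : v k @[k --> \oo] --> x -> trap n (v k) @[k --> \oo] --> trap n x.
Proof.
move=> vx; apply: cvg_maxr; first exact: cvg_cst.
apply: cvgB; first exact: cvg_cst.
apply: cvgM; first exact: cvg_cst.
apply: cvgD; apply: cvg_maxr; try exact: cvg_cst; first exact: cvgN.
by apply: cvgB => //; exact: cvg_cst.
Qed.

Lemma trap_ge0 n t : 0 <= trap n t.
Proof. by rewrite /trap le_max lexx. Qed.

Lemma trap_le1 n t : trap n t <= 1.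
Proof. by rewrite /trap ge_max ler01 gerBl mulr_ge0 ?def_ge0. Qed.

Lemma trap_bdd n : bdd_supp 2 (trap n).
Proof.
move=> t; split; first by rewrite ger0_norm ?trap_ge0// (le_trans (trap_le1 _ _))// ler1n.
move=> t2; apply: max_idPl; rewrite subr_le0.
have h : 1 <= def t.
  rewrite /def; have [t0|t0] := leP 0 t.
    rewrite ger0_norm// in t2.
    by rewrite (max_idPl _) ?oppr_le0// add0r le_max; apply/orP; right; lra.
  rewrite ltr0_norm// in t2.
  by rewrite [X in _ + X](max_idPl _) ?addr0 ?le_max; [apply/orP; right; lra|lra].
rewrite -[leLHS]mulr1; apply: ler_pM => //; first by rewrite ler1n.
Qed.

Lemma cvg_trap (t : R) (a : nat -> R) (l : R) : a n @[n --> \oo] --> l ->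
  trap n t * a n @[n --> \oo] --> (if 0 <= t <= 1 then l else 0).
Proof.
move=> al; have := @cvg_outer _ (def t) a l (def_ge0 t) al.
suff -> : (def t == 0) = (0 <= t <= 1) by [].
have [/andP[t0 t1]|h] := boolP (0 <= t <= 1).
  have h1 : Num.max 0 (- t) = 0 by apply: max_idPl; rewrite oppr_le0.
  have h2 : Num.max 0 (t - 1) = 0 by apply: max_idPl; rewrite subr_le0.
  by rewrite /def h1 h2 addr0 eqxx.
apply: negbTE; apply: contraNN h => /eqP h.
have a1 : - t <= Num.max 0 (- t) by rewrite le_max lexx orbT.
have a2 : t - 1 <= Num.max 0 (t - 1) by rewrite le_max lexx orbT.
have a3 : 0 <= Num.max 0 (- t) by rewrite le_max lexx.
have a4 : 0 <= Num.max 0 (t - 1) by rewrite le_max lexx.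
move: h a1 a2 a3 a4; rewrite /def; move: (Num.max _ _) (Num.max _ _) => p q h a1 a2 a3 a4.
by apply/andP; split; lra.
Qed.

Lemma trap_measurable n : measurable_fun setT (trap n).
Proof. by apply: measurable_scont1 => v x; exact: trap_cvg. Qed.

Lemma integ1_trap_cvg : integ1 (trap n) @[n --> \oo] --> (1 : R).
Proof.
have -> : (1 : R) = integ1 (fun t : R => if 0 <= t <= 1 then 1 else 0).
  rewrite /integ1 (_ : (fun t : R => _) = cst (1:R) \_ (`[0, 1]%classic : set R)); last first.
    by apply/funext => t; rewrite /patch mem_setE in_itv /=; case: ifP.
  rewrite -Rintegral_mkcond Rintegral_cst// mul1r.
  by rewrite [X in fine X](lebesgue_measure_itv `[0, 1]) /= lte_fin ltr01 oppr0 adde0.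
apply: (@integ1_dct _ (fun n => trap n) _ 2).
- exact: trap_measurable.
- exact: trap_bdd.
- move=> t; have := @cvg_trap t (fun=> 1) 1 (@cvg_cst _ _ _ \oo eventually_filter).
  by under eq_fun do rewrite mulr1.
Qed.

(** The integrals decrease with [n] towards 1. *)
Lemma integ1_trap_gt0 n : 0 < integ1 (trap n).
Proof.
have h k : integ1 (trap (n + k)) <= integ1 (trap n).
  apply: (integ1_le (trap_measurable _) (trap_bdd _) (trap_measurable n) (trap_bdd n)) => t.
  rewrite /trap ge_max !le_max lexx /=; apply/orP; right.
  by rewrite lerB// ler_wpM2r ?def_ge0// ler_nat ltnS leq_addr.
apply: lt_le_trans ltr01 _.
have H : integ1 (trap (n + k)) @[k --> \oo] --> (1 : R).
  have := integ1_trap_cvg; rewrite -(cvg_shiftn n).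
  by under eq_fun do rewrite addnC.
by apply: (ler_cvg_to H (@cvg_cst _ (integ1 (trap n)) _ \oo eventually_filter)); exact: nearW.
Qed.

End Trapezoid.

Lemma cont_cst (R : realType) (T : topologicalType) (a : R) (x : T) :
  {for x, continuous (fun _ : T => a)}.
Proof. exact: cst_continuous. Qed.

Lemma cont_M (R : realType) (T : topologicalType) (f g : T -> R) x :
  {for x, continuous f} -> {for x, continuous g} -> {for x, continuous (fun z => f z * g z)}.
Proof. by move=> cf cg; exact: (continuousM cf cg). Qed.

Lemma cont_D (R : realType) (T : topologicalType) (f g : T -> R) x :
  {for x, continuous f} -> {for x, continuous g} -> {for x, continuous (fun z => f z + g z)}.
Proof. by move=> cf cg; exact: (continuousD cf cg). Qed.

Lemma cont_N (R : realType) (T : topologicalType) (f : T -> R) x :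
  {for x, continuous f} -> {for x, continuous (fun z => - f z)}.
Proof. by move=> cf; exact: (continuousN cf). Qed.

Lemma continuous_at_sum (R : realType) (T : topologicalType) (I : Type) (r : seq I)
    (F : I -> T -> R) x :
  (forall i, {for x, continuous (F i)}) -> {for x, continuous (fun z => \sum_(i <- r) F i z)}.
Proof.
move=> cF; rewrite /prop_for /continuous_at; elim: r => [|i r IH].
  by rewrite big_nil; under eq_fun do rewrite big_nil; exact: cvg_cst.
rewrite big_cons; under eq_fun do rewrite big_cons.
by apply: cvgD => //; exact: cF.
Qed.

(** * Cutoffs of the polytope and their boundary layers *)

Section Layer.
Variables (R : realType) (m d : nat) (u : 'I_d -> 'rV[R]_m) (c : 'I_d -> R).
Notation D := (polytope u c).
Notation L j := (aff (u j) (c j)).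
Hypothesis cD : compact D.
Implicit Types (x y z : 'rV[R]_m).

(** If some L_l is nonpositive, its summand alone is at least 1; at an interior point the sum tends
    to 0. Applying [pcut] once more gives a cutoff that vanishes off the interior and tends to 1 on
    it. *)
Definition csum (n : nat) x : R := \sum_(l < d) pcut (n.+1%:R * L l x).
Definition cutoff (n : nat) x : R := pcut (csum n x).
(** The coefficient of [u j] in the gradient of [cutoff n]. It is nonnegative, being a product of
    two nonpositive derivatives, and concentrates on the j-th facet. *)
Definition layer (n : nat) (j : 'I_d) x : R :=
  n.+1%:R * (dpcut (csum n x) * dpcut (n.+1%:R * L j x)).

Lemma csum_scont n : scont (csum n).
Proof.
apply: scont_sum => l v x vx; apply: pcut_cvg; apply: cvgM; first exact: cvg_cst.
exact: aff_scont.
Qed.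

Lemma cutoff_scont n : scont (cutoff n).
Proof. by move=> v x vx; apply: pcut_cvg; exact: csum_scont. Qed.

Lemma layer_scont n j : scont (layer n j).
Proof.
apply: scontZ => v x vx; apply: cvgM; first by apply: dpcut_cvg; exact: csum_scont.
by apply: dpcut_cvg; apply: cvgM; [exact: cvg_cst|exact: aff_scont].
Qed.

Lemma csum_ge n l x : pcut (n.+1%:R * L l x) <= csum n x.
Proof. by rewrite /csum (bigD1 l)//= lerDl sumr_ge0// => i _; exact: pcut_ge0. Qed.

Lemma csum_ge0 n x : 0 <= csum n x.
Proof. by apply: sumr_ge0 => l _; exact: pcut_ge0. Qed.

Lemma csum_ge1 n l x : L l x <= 0 -> 1 <= csum n x.
Proof.
move=> h; apply: le_trans (csum_ge n l x); apply: pcut_ge1.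
by rewrite mulr_ge0_le0.
Qed.

Lemma cutoff_out n l x : L l x <= 0 -> cutoff n x = 0.
Proof. by move=> h; rewrite /cutoff pcut_0// (csum_ge1 n h). Qed.

Lemma layer_out n j l x : L l x <= 0 -> layer n j x = 0.
Proof. by move=> h; rewrite /layer dpcut_0 ?mul0r ?mulr0// (csum_ge1 n h). Qed.

Lemma outP x : ~ D x -> exists l, L l x < 0.
Proof. by move=> /existsNP[l /negP]; rewrite -ltNge; exists l. Qed.

Lemma cutoff_outD n x : ~ D x -> cutoff n x = 0.
Proof. by move=> /outP[l /ltW]; exact: cutoff_out. Qed.

Lemma layer_outD n j x : ~ D x -> layer n j x = 0.
Proof. by move=> /outP[l /ltW]; exact: layer_out. Qed.

Lemma layer_bound n j x : 0 <= layer n j x <= n.+1%:R * 4.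
Proof.
rewrite /layer mulr_ge0//=; last by rewrite mulr_le0 ?dpcut_le0.
rewrite ler_pM2l//.
have [h|h] := leP (L j x) 0; first by rewrite [dpcut (csum _ _)]dpcut_0 ?mul0r// (csum_ge1 n h).
have h1 : 0 <= n.+1%:R * L j x by rewrite mulr_ge0// ltW.
have := dpcut_ge h1; have := dpcut_ge (csum_ge0 n x).
have := dpcut_le0 (csum n x); have := dpcut_le0 (n.+1%:R * L j x); nra.
Qed.

Lemma cutoff_01 n x : 0 <= cutoff n x <= 1.
Proof. by rewrite /cutoff pcut_ge0 pcut_le1// csum_ge0. Qed.

Lemma is_derive_aff (a : 'rV[R]_m) b x i : is_derive x (unit_vec R i) (aff a b) (a 0 i).
Proof.
apply/is_deriveP; apply: cvg_near_cst; near=> h.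
have h0 : h != 0 by near: h; exact: nbhs_dnbhs_neq.
by rewrite [h *: _ + x]addrC affDu addrC addKr mulKf.
Unshelve. all: by end_near. Qed.

Lemma is_derive_cutoff n x i :
  is_derive x (unit_vec R i) (cutoff n) (\sum_j layer n j x * u j 0 i).
Proof.
have H l : is_derive x (unit_vec R i) (fun y => pcut (n.+1%:R * L l y))
    (dpcut (n.+1%:R * L l x) * (n.+1%:R * u l 0 i)).
  apply: (@is_derive_comp1 _ _ x (unit_vec R i) (fun y => n.+1%:R * L l y)); last exact: is_derive_pcut.
  by have := @is_deriveZ _ _ _ _ n.+1%:R x (unit_vec R i) _ (is_derive_aff (u l) (c l) x i).
have HS : is_derive x (unit_vec R i) (csum n) (\sum_l dpcut (n.+1%:R * L l x) * (n.+1%:R * u l 0 i)).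
  have := @is_derive_sum _ _ _ d (fun l y => pcut (n.+1%:R * L l y)) x (unit_vec R i) _ H.
  by congr (is_derive _ _ _ _); apply/funext => y; rewrite fct_sumE.
have := is_derive_comp1 HS (is_derive_pcut (csum n x)).
congr (is_derive _ _ _ _); rewrite mulr_sumr; apply: eq_bigr => l _.
by rewrite /layer; ring.
Qed.

Definition cts_at (b : 'rV[R]_m -> R) (x : 'rV[R]_m) : Prop :=
  forall v, ccvg v x -> b (v n) @[n --> \oo] --> b x.

Lemma cts_atP b x : {for x, continuous b} -> cts_at b x.
Proof. by move=> cb v /ccvgP vx; exact: (cvg_comp _ _ vx cb). Qed.

Lemma within_of (b : 'rV[R]_m -> R) : (forall x, D x -> {for x, continuous b}) -> {within D, continuous b}.
Proof. by move=> h; apply: continuous_in_subspaceT => x /set_mem; exact: h. Qed.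

(** Outside D some L_l is negative, hence negative nearby, so the product vanishes near such a point
    whatever [b] does there. *)
Lemma zext_scont a b : scont a -> (forall x, ~ D x -> a x = 0) ->
  (forall x, D x -> cts_at b x) -> scont (fun x => a x * b x).
Proof.
move=> sa a0 cb v x vx; have [Dx|Dx] := pselect (D x).
  by apply: cvgM; [exact: sa|exact: cb].
rewrite a0// mul0r; apply: cvg_near_cst.
have [l Ll] := outP Dx.
have Lv : L l (v n) @[n --> \oo] --> L l x by exact: aff_scont.
have : \forall n \near \oo, L l (v n) < 0 by exact: (cvgr_lt _ Lv).
apply: filterS => n Ln; rewrite a0 ?mul0r//.
by move=> /(_ l); rewrite leNgt Ln.
Qed.

Lemma zext_bdd a b A B M : (forall x, `|a x| <= A) -> (forall x, ~ D x -> a x = 0) ->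
  (forall x, D x -> `|b x| <= B) -> (forall x, D x -> `|x| <= M) -> 0 <= B -> 0 <= M ->
  bdd_supp (A * B + M) (fun x => a x * b x).
Proof.
move=> hA a0 hB hM B0 M0 x; have A0 : 0 <= A := le_trans (normr_ge0 _) (hA 0).
have [Dx|Dx] := pselect (D x); last by rewrite a0// mul0r normr0 addr_ge0 ?mulr_ge0.
split.
  rewrite normrM; apply: (@le_trans _ _ (A * B)); last by rewrite lerDl.
  by apply: ler_pM => //; exact: hB.
move=> h; exfalso; move: (hM x Dx); rewrite leNgt; move/negP; apply.
by apply: le_lt_trans h; rewrite lerDr mulr_ge0.
Qed.

(** At distance of order 1/n from a point of D, a facet not containing the point drops out, and one
    containing it contributes the profile at its rescaled distance [r l]. *)
Lemma csum_cvg0 x (v : nat -> 'rV[R]_m) (r : 'I_d -> R) : D x ->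
  (forall n l, n.+1%:R * L l (v n) = n.+1%:R * L l x + r l) ->
  csum n (v n) @[n --> \oo] --> \sum_l (if L l x == 0 then pcut (r l) else 0).
Proof.
move=> Dx E; rewrite /csum.
apply: cvg_big => //; [exact: add_continuous|move=> l _].
under eq_fun do rewrite E.
case: eqP => [->|/eqP L0].
  by under eq_fun do rewrite mulr0 add0r; exact: cvg_cst.
have Lp : 0 < L l x by rewrite lt_neqAle eq_sym L0; exact: Dx.
apply: cvg_near_cst; near=> n; apply: pcut_0.
rewrite -lerBlDr -ler_pdivrMr//.
rewrite (@le_trans _ _ n%:R) ?ler_nat//.
by near: n; exact: nbhs_infty_ger.
Unshelve. all: by end_near. Qed.

Lemma near_out x (v : nat -> 'rV[R]_m) (r : 'I_d -> R) : ~ D x ->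
  (forall n l, n.+1%:R * L l (v n) = n.+1%:R * L l x + r l) ->
  \forall n \near \oo, exists l, L l (v n) <= 0.
Proof.
move=> /outP[l Ll] E; near=> n; exists l.
rewrite -(pmulr_rle0 _ (ltr0Sn R n)) E -lerBrDr sub0r.
rewrite -ler_ndivrMr//.
rewrite (@le_trans _ _ n%:R) ?ler_nat//.
by near: n; exact: nbhs_infty_ger.
Unshelve. all: by end_near. Qed.

Lemma hproj_aff (a : 'rV[R]_m) b k y : a 0 k != 0 -> aff a b (hproj a b k y) = 0.
Proof. by move=> ak; rewrite /hproj -scaleNr affDu mulNr divfK// subrr. Qed.

Lemma hproj_ccvg (a : 'rV[R]_m) b k v y : ccvg v y ->
  ccvg (fun n => hproj a b k (v n)) (hproj a b k y).
Proof.
move=> vy i; rewrite /hproj -scaleNr addv_coord; under eq_fun do rewrite -scaleNr addv_coord.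
apply: cvgD; first exact: vy.
apply: cvgM; last exact: cvg_cst.
by apply: cvgN; apply: cvgM; [exact: aff_scont|exact: cvg_cst].
Qed.

Lemma hproj_coord (a : 'rV[R]_m) b k y i : i != k -> (hproj a b k y) 0 i = y 0 i.
Proof. by move=> /negPf ik; rewrite /hproj -scaleNr addv_coord ik mulr0 addr0. Qed.

Lemma norm_from_hproj (a : 'rV[R]_m) b k y (B C : R) : 0 <= B -> 0 <= C ->
  `|hproj a b k y| <= B -> `|y 0 k| <= C -> `|y| <= B + C.
Proof.
move=> B0 C0 hB hC; apply: norm_leP; first exact: addr_ge0.
move=> i; have [->|ik] := eqVneq i k; first by rewrite (le_trans hC)// lerDr.
rewrite -(hproj_coord a b y ik) (le_trans (coord_le_norm _ _))// (le_trans hB)// lerDl//.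
Qed.

(** * The limit of a single boundary layer *)

Section ThinLayer.
Variables (j : 'I_d) (k : 'I_m).
Hypothesis ujk : u j 0 k != 0.
Let hp := hproj (u j) (c j) k.

Definition facet_fun (g : 'rV[R]_m -> R) y : R :=
  if `[< facet u c j (hp y) >] && (0 <= y 0 k <= 1) then g (hp y) else 0.

Lemma facet_hp y : facet u c j (hp y) <-> D (hp y).
Proof. by split=> [[]//|h]; split=> //; exact: hproj_aff. Qed.

Lemma good_facet (g : 'rV[R]_m -> R) : {within D, continuous g} -> good (facet_fun g).
Proof.
move=> cg; have [h [B [sh hg hB]]] := polytope_extension cD cg.
have [M M0 DM] := polytope_bounded cD.
have B0 : 0 <= B := le_trans (normr_ge0 _) (hB 0).
pose F n y := trap n (y 0 k) *
  (Num.max 0 (1 - n.+1%:R * pdefect u c (hp y)) * (bump M (hp y) * h (hp y))).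
apply: (@good_cvg _ _ (B + (M + 1 + 2)) F).
- move=> n v y vy; have vy' := @hproj_ccvg (u j) (c j) k _ _ vy.
  apply: cvgM; first exact: trap_cvg.
  apply: cvgM; last by apply: cvgM; [exact: bump_scont|exact: sh].
  apply: cvg_maxr; first exact: cvg_cst.
  apply: cvgB; first exact: cvg_cst.
  by apply: cvgM; [exact: cvg_cst|exact: pdefect_scont].
- move=> n y; have /andP[a0 a1] := outer_bound n (pdefect_ge0 u c (hp y)); split.
    rewrite /F !normrM ger0_norm ?trap_ge0// ger0_norm// ger0_norm ?bump_ge0//.
    apply: (@le_trans _ _ (1 * (1 * (1 * B)))); last by rewrite !mul1r lerDl !addr_ge0.
    apply: ler_pM; rewrite ?trap_ge0 ?trap_le1 ?mulr_ge0 ?bump_ge0//.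
    apply: ler_pM; rewrite ?mulr_ge0 ?bump_ge0//.
    by apply: ler_pM; rewrite ?bump_ge0 ?bump_le1.
  move=> hy; rewrite /F; have [h1|h1] := ltP 2 `|y 0 k|; first by rewrite (trap_bdd n _).2// mul0r.
  rewrite bump_0 ?mul0r ?mulr0//; rewrite leNgt; apply/negP => h2; move: hy; rewrite ltNge => /negP; apply.
  rewrite (@le_trans _ _ (M + 1 + 2)) ?lerDr//.
  by apply: norm_from_hproj (ltW h2) h1 => //; rewrite addr_ge0.
- move=> y; rewrite /F /facet_fun.
  have E : `[< facet u c j (hp y) >] = `[< D (hp y) >] by apply/asbool_equiv_eq; exact: facet_hp.
  have H : Num.max 0 (1 - n.+1%:R * pdefect u c (hp y)) * (bump M (hp y) * h (hp y)) @[n --> \oo]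
      --> (if `[< D (hp y) >] then g (hp y) else 0).
    have := @cvg_outer _ _ _ _ (pdefect_ge0 u c (hp y)) (@cvg_cst _ (bump M (hp y) * h (hp y)) nat \oo eventually_filter).
    case: asboolP => Dx.
      by rewrite pdefect0// eqxx bump_1 ?mul1r ?hg//; exact: DM.
    by rewrite gt_eqF ?pdefect_gt0.
  have := @cvg_trap _ (y 0 k) _ _ H.
  by rewrite E; case: (`[< _ >]) => //=; case: ifP.
Qed.

(** In the rescaled variable s = (n+1) L_j the layer has a limit profile. Where only the j-th facet
    is present, its integral is 1 by [integ1_profile]; any further facet increases the inner sum and
    so decreases the profile. With [b] nonnegative on the facet this leaves an inequality, uniform
    over the corners. *)
Lemma thin_layer (b : 'rV[R]_m -> R) :
  (forall x, D x -> {for x, continuous b}) -> (forall x, facet u c j x -> 0 <= b x) ->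
  exists2 l : R, iint (fun x => layer n j x * b x) @[n --> \oo] --> l &
    l <= iint (facet_fun b) / `|u j 0 k|.
Proof.
move=> cb b0.
have cw := within_of cb.
have cb' x : D x -> cts_at b x by move=> Dx; exact/cts_atP/cb.
have [B B0 hB] := within_bounded cD cw.
have [M M0 DM] := polytope_bounded cD.
pose uk := u j 0 k; have uk0 : uk != 0 := ujk.
rewrite -/uk.
pose Phi n x := layer n j x * b x.
have sPhi n : scont (Phi n).
  by apply: zext_scont => //; [exact: layer_scont|move=> x; exact: layer_outD].
have bPhi n : bdd_supp (n.+1%:R * 4 * B + M) (Phi n).
  apply: zext_bdd => //; [|by move=> x; exact: layer_outD|exact: ltW].
  by move=> x; have /andP[h1 h2] := layer_bound n j x; rewrite ger0_norm.
pose Psi n x := n.+1%:R^-1 * Phi n x.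
have sPsi n : scont (Psi n) by exact: scontZ.
have PsiB n x : `|Psi n x| <= 4 * B.
  rewrite /Psi /Phi; have [Dx|Dx] := pselect (D x); last first.
    by rewrite layer_outD// mul0r mulr0 normr0 mulr_ge0// ltW.
  rewrite mulrA normrM; apply: ler_pM => //; last exact: hB.
  have /andP[h1 h2] := layer_bound n j x.
  rewrite ger0_norm; last by rewrite mulr_ge0// invr_ge0.
  by rewrite ler_pdivrMl.
have PsiD n x : ~ D x -> Psi n x = 0 by move=> Dx; rewrite /Psi /Phi layer_outD// mul0r mulr0.
(* The point on the line through [y] parallel to the k-th axis at which [n.+1%:R * L j] takes the
   value [s]. *)
pose p n y (s : R) := hp y + (s / (n.+1%:R * uk)) *: unit_vec R k.
have pL n y s l : n.+1%:R * L l (p n y s) = n.+1%:R * L l (hp y) + s * u l 0 k / uk.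
  rewrite /p affDu mulrDr; congr (_ + _).
  have N0 : (n.+1%:R : R) != 0 by rewrite pnatr_eq0.
  by move: (n.+1%:R : R) N0 => N N0; field; rewrite uk0 N0.
have pLj n y s : n.+1%:R * L j (p n y s) = s.
  by rewrite pL hproj_aff// mulr0 add0r mulfK.
have pc n (v : nat -> 'rV[R]_m) y (w : nat -> R) s : ccvg v y -> w r @[r --> \oo] --> s ->
    ccvg (fun r => p n (v r) (w r)) (p n y s).
  move=> vy ws; apply: ccvgD; first exact: hproj_ccvg.
  by apply: ccvgZ; [apply: cvgM => //; exact: cvg_cst|exact: ccvg_cst].
have PsiE n y s : Psi n (p n y s) = dpcut (csum n (p n y s)) * dpcut s * b (p n y s).
  by rewrite /Psi /Phi /layer pLj !mulrA mulVf ?mul1r// pnatr_eq0.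
have PsiS n y s : 1 < `|s| -> Psi n (p n y s) = 0.
  move=> s1; have [s0|s0] := leP s 0.
    rewrite /Psi /Phi (@layer_out _ j j) ?mul0r ?mulr0//.
    by rewrite -(pmulr_rle0 _ (ltr0Sn R n)) pLj.
  by rewrite PsiE [dpcut s]dpcut_0 ?mulr0 ?mul0r//; move: s1; rewrite gtr0_norm// => /ltW.
pose K := Num.max (4 * B) 1.
have K0 : 0 <= K by rewrite le_max ler01 orbT.
have bk n y : bdd_supp K (fun s => Psi n (p n y s)).
  move=> s; split; first by rewrite le_max PsiB.
  by rewrite gt_max => /andP[_]; exact: PsiS.
have mk n y : measurable_fun setT (fun s : R => Psi n (p n y s)).
  by apply: measurable_scont1 => w s ws; apply: sPsi; apply: pc => //; exact: ccvg_cst.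
pose J n y := integ1 (fun s => Psi n (p n y s)).
pose G n y := trap n (y 0 k) * J n y.
(* Substituting [s] for the line parameter produces the Jacobian 1/((n+1)|u_jk|), whose factor
   1/(n+1) is the one built into [Psi]. *)
have JE n y : integ1 (fun t => Phi n (y + (t - y 0 k) *: unit_vec R k)) = `|uk|^-1 * J n y.
  have mf : measurable_fun setT (fun t : R => Phi n (y + (t - y 0 k) *: unit_vec R k)).
    apply: measurable_scont1 => w s ws; apply: sPhi; apply: ccvgD; first exact: ccvg_cst.
    by apply: ccvgZ; [apply: cvgB => //; exact: cvg_cst|exact: ccvg_cst].
  have bf : bdd_supp (n.+1%:R * 4 * B + M + `|y 0 k|) (fun t : R => Phi n (y + (t - y 0 k) *: unit_vec R k)).
    move=> t; split; first by rewrite (le_trans (bPhi _ _).1)// lerDl.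
    move=> h; apply: (bPhi n _).2.
    have := coord_le_norm (y + (t - y 0 k) *: unit_vec R k) k; rewrite addv_coord eqxx mulr1 addrC subrK.
    by apply: lt_le_trans; apply: le_lt_trans h; rewrite lerDl.
  have bn0 : (n.+1%:R * uk)^-1 != 0 by rewrite invr_eq0 mulf_neq0// pnatr_eq0.
  rewrite -(integ1_affine (y 0 k - L j y / uk) bn0 mf bf).
  rewrite normfV normrM ger0_norm// invfM -mulrA mulrCA; congr (_ * _).
  rewrite /J /Psi (@integ1Z _ _ (fun s => Phi n (p n y s)) (n.+1%:R * K))//.
  - congr (_ * integ1 _); apply/funext => s; congr (Phi n _).
    apply/rowP => i; apply: etrans (addv_coord _ _ _ _) _; apply/esym.
    apply: etrans (addv_coord _ _ _ _) _; rewrite /hp /hproj -scaleNr addv_coord -/uk.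
    by rewrite [s / _]mulrC; ring.
  - by apply: measurable_scont1 => w s ws; apply: sPhi; apply: pc => //; exact: ccvg_cst.
  - move=> s; have [h1 h2] := bk n y s; rewrite /Psi in h1 h2.
    have E : Phi n (p n y s) = n.+1%:R * (n.+1%:R^-1 * Phi n (p n y s)) by rewrite mulVKf// pnatr_eq0.
    split; first by rewrite E normrM ger0_norm// ler_pM2l.
    by move=> h; rewrite E h2 ?mulr0//; apply: le_lt_trans h; rewrite ler_peMl// ler1n.
have sG n : scont (G n).
  move=> v y vy; apply: cvgM; first by apply: trap_cvg; exact: vy.
  apply: (@integ1_dct _ (fun r s => Psi n (p n (v r) s)) _ K) => [r|r|s].
  - exact: mk.
  - exact: bk.
  - by apply: sPsi; apply: pc => //; exact: cvg_cst.
have J0 n y : (forall s, Psi n (p n y s) = 0) -> J n y = 0.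
  by move=> h; rewrite /J -[RHS](integ1_0 R); congr integ1; apply/funext.
have bG n : bdd_supp (2 * K ^+ 2 + (M + `|uk|^-1 + 2)) (G n).
  have C0 : 0 <= M + `|uk|^-1 by rewrite addr_ge0// invr_ge0.
  move=> y; split.
    rewrite normrM ger0_norm ?trap_ge0//.
    apply: (@le_trans _ _ (1 * (2 * K ^+ 2))); last by rewrite mul1r lerDl addr_ge0.
    by apply: ler_pM => //; [exact: trap_ge0|exact: trap_le1|exact: integ1_bound].
  move=> hy; rewrite /G; have [h1|h1] := ltP 2 `|y 0 k|; first by rewrite (trap_bdd n _).2// mul0r.
  rewrite J0 ?mulr0// => s.
  have [s1|s1] := ltP 1 `|s|; first exact: PsiS.
  have [Dp|Dp] := pselect (D (p n y s)); last exact: PsiD.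
  exfalso; move: hy; rewrite ltNge => /negP; apply.
  rewrite (@le_trans _ _ (M + `|uk|^-1 + 2)) ?lerDr ?mulr_ge0 ?exprn_ge0//.
  apply: norm_from_hproj h1 => //; rewrite -/(hp y).
  have := ler_normB (p n y s) ((s / (n.+1%:R * uk)) *: unit_vec R k).
  rewrite /p addrK => /le_trans; apply; apply: lerD; first exact: DM.
  rewrite normrZ norm_unit_vec mulr1 normrM normfV normrM [`|n.+1%:R|]ger0_norm// invfM mulrA.
  rewrite ler_piMl ?invr_ge0// ler_pdivrMr// mul1r (le_trans s1)// ler1n//.
(* [iint_coord] with weight [trap n]; dividing by the integral of the weight is harmless since it
   tends to 1, and the weight itself tends to the indicator of [0,1] used by [int_facet]. *)
have IG n : iint (fun x => layer n j x * b x) = (`|uk|^-1 * (integ1 (trap n))^-1) * iint (G n).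
  have := iint_coord k (sPhi n) (bPhi n) (@trap_cvg R n) (@trap_bdd R n).
  rewrite (_ : (fun y => _) = fun y => `|uk|^-1 * G n y); last first.
    by apply/funext => y; rewrite JE /G mulrCA.
  rewrite (iintZ _ (good_scont (sG n) (bG n))) => E.
  rewrite mulrAC E; rewrite [integ1 _ * _]mulrC mulfK// gt_eqF// integ1_trap_gt0//.
(* The limit of the rescaled integrand: only the facets through the projected point survive in the
   inner sum. *)
pose kap y s := if `[< D (hp y) >] then
  dpcut (\sum_l (if L l (hp y) == 0 then pcut (s * u l 0 k / uk) else 0)) * dpcut s * b (hp y) else 0.
have kc y s : Psi n (p n y s) @[n --> \oo] --> kap y s.
  rewrite /kap; case: asboolP => Dz.
    apply: (cvg_eqf (fun n => PsiE n y s)); apply: cvgM.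
      apply: cvgM; last exact: cvg_cst.
      by apply: dpcut_cvg; exact: (csum_cvg0 Dz (fun n l => pL n y s l)).
    apply: cb' => //.
    have -> : hp y = hp y + (0 : R) *: unit_vec R k by rewrite scale0r addr0.
    apply: ccvgD; first exact: ccvg_cst.
    apply: ccvgZ; last exact: ccvg_cst.
    have -> : (fun n => s / (n.+1%:R * uk)) = (fun n => s / uk * n.+1%:R^-1).
      by apply/funext => n; rewrite invfM mulrA [s / _]mulrC; ring.
    by rewrite -[X in _ --> X](mulr0 (s / uk)); apply: cvgM; [exact: cvg_cst|exact: cvg_natinv].
  apply: cvg_near_cst; apply: filterS (near_out Dz (fun n l => pL n y s l)) => n [l Ll].
  by rewrite /Psi /Phi (layer_out _ _ Ll) mul0r mulr0.
pose Jl y := integ1 (kap y).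
have Jc y : J n y @[n --> \oo] --> Jl y.
  by apply: (@integ1_dct _ (fun n s => Psi n (p n y s)) _ K) => [n|n|s]; [exact: mk|exact: bk|exact: kc].
pose Gl y := if 0 <= y 0 k <= 1 then Jl y else 0.
have Gc y : G n y @[n --> \oo] --> Gl y by exact: cvg_trap.
exists (`|uk|^-1 * 1^-1 * iint Gl).
  apply: (cvg_eqf IG); apply: cvgM; last exact: iint_dct Gc.
  apply: cvgM; first exact: cvg_cst.
  by apply: cvgV; [rewrite oner_eq0|exact: integ1_trap_cvg].
rewrite invr1 mulr1 mulrC ler_pM2r ?invr_gt0 ?normr_gt0//.
apply: iint_le => [||y]; [exact: good_cvg Gc|exact: good_facet|].
rewrite /Gl /facet_fun.
have -> : `[< facet u c j (hp y) >] = `[< D (hp y) >] by apply/asbool_equiv_eq; exact: facet_hp.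
case: ifP; last by rewrite andbF.
rewrite andbT => _; rewrite /Jl; have mka : measurable_fun setT (kap y).
  by apply: (@measurable_realfun.measurable_fun_cvg _ _ _ _ (fun n s => Psi n (p n y s))) => // s _; exact: kc.
have bka : bdd_supp K (kap y) := bdd_supp_cvg (fun n => bk n y) (kc y).
case: asboolP => Dz; last first.
  rewrite le_eqVlt; apply/orP; left; apply/eqP.
  rewrite -[RHS](integ1_0 R); congr integ1; apply/funext => s; rewrite /kap.
  by case: asboolP.
have bz : 0 <= b (hp y) by apply: b0; apply/facet_hp.
pose prof (s : R) := dpcut (pcut s) * dpcut s.
have mprof : measurable_fun setT prof.
  apply: measurable_scont1 => w s ws; apply: cvgM; last exact: dpcut_cvg.
  by apply: dpcut_cvg; exact: pcut_cvg.
have bprof : bdd_supp 4 prof.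
  move=> s; rewrite /prof; have [s0|s0] := leP s 0.
    by rewrite dpcut_0 ?pcut_ge1// mul0r normr0.
  split; last first.
    by rewrite gtr0_norm// => s4; rewrite [dpcut s]dpcut_0 ?mulr0//; lra.
  have := dpcut_ge (ltW s0); have := dpcut_ge (pcut_ge0 s).
  have := dpcut_le0 s; have := dpcut_le0 (pcut s).
  by move=> h1 h2 h3 h4; rewrite ger0_norm ?mulr_le0//; nra.
have <- : integ1 (fun s => b (hp y) * prof s) = b (hp y).
  by rewrite (integ1Z _ mprof bprof) integ1_profile mulr1.
have mbp : measurable_fun setT (fun s => b (hp y) * prof s).
  by apply: measurable_funM.
apply: (integ1_le mka bka mbp (bdd_suppZ _ bprof)) => s.
(* Keeping only the j-th summand lowers the argument of the increasing function [dpcut]; the other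
   factor [dpcut s] is nonpositive, so the product increases to the single-facet profile. *)
rewrite /kap; case: asboolP => // _; rewrite mulrC ler_wpM2l// /prof.
rewrite ler_wnM2r ?dpcut_le0//; apply: dpcut_homo.
rewrite (bigD1 j)//= hproj_aff// eqxx mulfK// lerDl sumr_ge0// => l _.
by case: ifP => // _; exact: pcut_ge0.
Qed.

End ThinLayer.

Lemma int_facetP j : u j != 0 -> exists k (ujk : u j 0 k != 0),
  forall g, int_facet u c j g = iint (facet_fun j k g) / `|u j 0 k|.
Proof.
move=> uj; rewrite /int_facet; case: pickP => [k ujk|h]; first by exists k, ujk.
exfalso; move/eqP: uj; apply; apply/rowP => i; rewrite mxE.
by apply/eqP; move: (h i) => /negbFE.
Qed.

Lemma polytope_closed : closed D.
Proof. by apply: compact_closed => //; exact: norm_hausdorff. Qed.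

(** Off D, where nothing is known about [Y], the cutoff vanishes on a neighbourhood because the
    complement of D is open. *)
Lemma is_derive_zext n i (Y : 'rV[R]_m -> R) (dY : R) x :
  (D x -> is_derive x (unit_vec R i) Y dY) ->
  is_derive x (unit_vec R i) (fun y => cutoff n y * Y y)
    (cutoff n x * dY + (\sum_j layer n j x * u j 0 i) * Y x).
Proof.
have [Dx|Dx] := pselect (D x) => dh.
  have := @is_deriveM _ _ _ _ _ _ _ _ (is_derive_cutoff n x i) (dh Dx).
  by congr (is_derive _ _ _ _); rewrite /GRing.scale /= [Y x * _]mulrC.
rewrite cutoff_outD// mul0r big1 ?mul0r ?addr0; last by move=> j _; rewrite layer_outD// mul0r.
apply: (@near_eq_is_derive _ _ _ (cst (0 : R))).
have := closed_openC polytope_closed; rewrite openE => /(_ x Dx).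
by apply: filterS => y Dy; rewrite cutoff_outD// mul0r.
Qed.

(** The cutoffs converge to the indicator of the open polytope, whereas [int_on] uses the closed
    one; the discrepancy is carried by the null hyperplanes L_j = 0. *)
Lemma iint_interior (g : 'rV[R]_m -> R) : (forall j, u j != 0) -> {within D, continuous g} ->
  good (fun x => if `[< forall j, 0 < L j x >] then g x else 0) ->
  iint (fun x => if `[< forall j, 0 < L j x >] then g x else 0) = int_on D g.
Proof.
move=> u0 cg gi.
have [B B0 hB] := within_bounded cD cg.
have [M M0 DM] := polytope_bounded cD.
have sb : scont (fun x => B * bump M x) by apply: scontZ; exact: bump_scont.
have bb : bdd_supp ((M + 1) * (1 + `|B|)) (fun x : 'rV[R]_m => B * bump M x).
  by apply: bdd_suppZ; exact: bump_bdd.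
pose q j x := if L j x == 0 then B * bump M x else 0.
have gq j : good (q j) by exact: good_hyperplane sb bb.
have q0 j x : 0 <= q j x.
  by rewrite /q; case: ifP => // _; rewrite mulr_ge0 ?bump_ge0// ltW.
have Iq : iint (fun x => \sum_j q j x) = 0.
  rewrite iint_sum// big1// => j _; exact: iint_hyperplane sb bb.
have gD := good_polytope cD cg.
have key x : `|(if `[< D x >] then g x else 0) - (if `[< forall j, 0 < L j x >] then g x else 0)|
    <= \sum_j q j x.
  case: asboolP => Dx; case: asboolP => Ix.
  - by rewrite subrr normr0 sumr_ge0.
  - have [j Lj] : exists j, L j x == 0.
      apply: contrapT => /forallNP h; apply: Ix => j.
      by rewrite lt_neqAle eq_sym Dx andbT; apply/negP; exact: h.
    have qj : q j x = B by rewrite /q Lj bump_1 ?mulr1//; exact: DM.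
    by rewrite subr0 (bigD1 j)//= qj -[leLHS]addr0 lerD ?hB// sumr_ge0// => l _; exact: q0.
  - by exfalso; apply: Dx => j; exact/ltW.
  - by rewrite subrr normr0 sumr_ge0.
apply/eqP; rewrite eq_le; apply/andP; split; rewrite /int_on.
  rewrite -[leRHS]addr0 -[X in _ <= _ + X]Iq -iintD//; last exact: good_sum.
  apply: iint_le => // [|x]; first by apply: goodD => //; exact: good_sum.
  by have := key x; rewrite ler_norml => /andP[h _]; rewrite -lerBlDl -lerN2 opprB.
rewrite -[leRHS]addr0 -[X in _ <= _ + X]Iq -iintD//; last exact: good_sum.
apply: iint_le => // [|x]; first by apply: goodD => //; exact: good_sum.
by have := key x; rewrite ler_norml => /andP[_ h]; rewrite -lerBlDl.
Qed.

(** The divergence of [cutoff n] times the field integrates to 0, which equates the integral of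
    [cutoff n] times the divergence with the layer integrals of the outward fluxes. The normals
    point inwards, so the sign hypothesis makes these fluxes nonnegative, as [thin_layer]
    requires. *)
Lemma divergence_le (Y dY : 'I_m -> 'rV[R]_m -> R) : (forall j, u j != 0) ->
  (forall i x, D x -> is_derive x (unit_vec R i) (Y i) (dY i x)) ->
  (forall i x, D x -> {for x, continuous (Y i)}) ->
  (forall i x, D x -> {for x, continuous (dY i)}) ->
  (forall j x, facet u c j x -> \sum_i u j 0 i * Y i x <= 0) ->
  int_on D (fun x => \sum_i dY i x) <=
  \sum_j int_facet u c j (fun x => - \sum_i u j 0 i * Y i x).
Proof.
move=> u0 hY cY cdY bY.
have [M M0 DM] := polytope_bounded cD.
have csumb (F : 'I_m -> 'rV[R]_m -> R) x : (forall i, {for x, continuous (F i)}) ->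
    {for x, continuous (fun z => \sum_i F i z)}.
  by move=> cF; exact: continuous_at_sum.
pose div x := \sum_i dY i x.
pose flux j x := - \sum_i u j 0 i * Y i x.
have cdiv x : D x -> {for x, continuous div} by move=> Dx; apply: csumb => i; exact: cdY.
have cflux j x : D x -> {for x, continuous (flux j)}.
  move=> Dx; have cs : {for x, continuous (fun z => \sum_i u j 0 i * Y i z)}.
    by apply: csumb => i; apply: cont_M; [exact: cont_cst|exact: cY].
  exact: cont_N.
have bounded (F : 'rV[R]_m -> R) : (forall x, D x -> {for x, continuous F}) ->
    exists2 B : R, 0 <= B & forall x, D x -> `|F x| <= B.
  by move=> cF0; have cF := within_of cF0; have [B B0 hB] := within_bounded cD cF; exists B => //; exact: ltW.
have cut1 n x : `|cutoff n x| <= 1 by have /andP[h1 h2] := cutoff_01 n x; rewrite ger0_norm.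
have lay1 n j x : `|layer n j x| <= n.+1%:R * 4.
  by have /andP[h1 h2] := layer_bound n j x; rewrite ger0_norm.
have reg1 n (F : 'rV[R]_m -> R) : (forall x, D x -> {for x, continuous F}) ->
    scont (fun x => cutoff n x * F x) /\ exists K, bdd_supp K (fun x => cutoff n x * F x).
  move=> cF; split.
    apply: zext_scont; [exact: cutoff_scont|by move=> x; exact: cutoff_outD|].
    by move=> x Dx; exact/cts_atP/cF.
  have [B B0 hB] := bounded _ cF.
  by exists (1 * B + M); apply: zext_bdd => // x; exact: cutoff_outD.
have reg2 n j (F : 'rV[R]_m -> R) : (forall x, D x -> {for x, continuous F}) ->
    scont (fun x => layer n j x * F x) /\ exists K, bdd_supp K (fun x => layer n j x * F x).
  move=> cF; split.
    apply: zext_scont; [exact: layer_scont|by move=> x; exact: layer_outD|].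
    by move=> x Dx; exact/cts_atP/cF.
  have [B B0 hB] := bounded _ cF.
  by exists (n.+1%:R * 4 * B + M); apply: zext_bdd => // x; exact: layer_outD.
have good1 n (F : 'rV[R]_m -> R) : (forall x, D x -> {for x, continuous F}) -> good (fun x => cutoff n x * F x).
  by move=> /(reg1 n)[sF [K bF]]; exact: good_scont sF bF.
have good2 n j (F : 'rV[R]_m -> R) : (forall x, D x -> {for x, continuous F}) -> good (fun x => layer n j x * F x).
  by move=> /(reg2 n j)[sF [K bF]]; exact: good_scont sF bF.
have I0 n i : iint (fun x => cutoff n x * dY i x + \sum_j layer n j x * (u j 0 i * Y i x)) = 0.
  have [sY [K1 bY1]] := reg1 n _ (cY i).
  have [sdY [K2 bdY]] := reg1 n _ (cdY i).
  pose g' x := cutoff n x * dY i x + \sum_j layer n j x * (u j 0 i * Y i x).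
  have [K3 bK3] : exists K3, forall x, `|\sum_j layer n j x * (u j 0 i * Y i x)| <= K3.
    have hj j : exists K, bdd_supp K (fun x => layer n j x * (u j 0 i * Y i x)).
      apply: (reg2 n j (fun x => u j 0 i * Y i x) _).2 => x Dx.
      by apply: cont_M; [exact: cont_cst|exact: cY].
    have [K hK] := choice hj.
    exists (\sum_j K j) => x; apply: le_trans (ler_norm_sum _ _ _) _.
    by apply: ler_sum => j _; exact: (hK j x).1.
  have bY1' : bdd_supp (K1 + (K2 + K3)) (fun x => cutoff n x * Y i x).
    apply: bdd_suppW bY1; rewrite lerDl addr_ge0 ?(bdd_supp_ge0 bdY)//.
    exact: le_trans (bK3 0).
  apply: (iint_derive0 (k := i) sY bY1') => x.
    apply: le_trans (ler_normD _ _) _.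
    have := (bdY x).1; have := bK3 x; have := bdd_supp_ge0 bY1; lra.
  have := is_derive_zext n (hY i x).
  congr (is_derive _ _ _ _); congr (_ + _); rewrite mulr_suml.
  by apply: eq_bigr => j _; rewrite mulrA.
have gY n i j : good (fun x => layer n j x * (u j 0 i * Y i x)).
  by apply: good2 => x Dx; apply: cont_M; [exact: cont_cst|exact: cY].
have IE n : iint (fun x => cutoff n x * div x) = \sum_j iint (fun x => layer n j x * flux j x).
  have Z : iint (fun x => \sum_(i < m) (cutoff n x * dY i x + \sum_j layer n j x * (u j 0 i * Y i x))) = 0.
    rewrite iint_sum; first by apply: big1 => i _; exact: I0.
    by move=> i; apply: goodD; [exact: (good1 _ _ (cdY i))|exact: good_sum].
  rewrite -iint_sum; last by move=> j; exact: (good2 _ _ _ (cflux j)).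
  rewrite -[RHS]add0r -[X in _ = X + _]Z -iintD.
  - congr iint; apply/funext => x; rewrite big_split /= /div mulr_sumr -addrA -[LHS]addr0; congr (_ + _).
    rewrite exchange_big /= -big_split /= big1// => j _.
    by rewrite -mulr_sumr /flux mulrN subrr.
  - by apply: good_sum => i; apply: goodD; [exact: (good1 _ _ (cdY i))|exact: good_sum].
  - by apply: good_sum => j; exact: (good2 _ _ _ (cflux j)).
have cvi : forall x, cutoff n x * div x @[n --> \oo] --> (if `[< forall j, 0 < L j x >] then div x else 0).
  move=> x; case: asboolP => [Lp|/existsNP[j /negP]]; last first.
    rewrite -leNgt => Lj; apply: cvg_near_cst; apply: nearW => n.
    by rewrite (cutoff_out _ Lj) mul0r.
  have Dx : D x by move=> j; exact/ltW.
  rewrite -[X in _ --> X]mul1r; apply: cvgM; last exact: cvg_cst.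
  have := @csum_cvg0 x (fun=> x) (fun=> 0) Dx (fun n l => esym (addr0 _)).
  rewrite big1; last by move=> l _; rewrite gt_eqF.
  by move=> /pcut_cvg; rewrite pcut_0'.
have [Bd Bd0 hBd] := bounded _ cdiv.
have sn n := (reg1 n _ cdiv).1.
have bn n : bdd_supp (1 * Bd + M) (fun x => cutoff n x * div x).
  by apply: zext_bdd => // x; exact: cutoff_outD.
have gi : good (fun x => if `[< forall j, 0 < L j x >] then div x else 0) by exact: good_cvg sn bn cvi.
have lim1 := iint_dct sn bn cvi.
rewrite (iint_interior u0 (within_of cdiv) gi) in lim1.
have hl j : exists l : R, iint (fun x => layer n j x * flux j x) @[n --> \oo] --> l /\
    l <= int_facet u c j (flux j).
  have [k [ujk E]] := int_facetP (u0 j).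
  have [] := @thin_layer j k ujk (flux j) (cflux j).
    by move=> x fx; rewrite oppr_ge0; exact: bY.
  by move=> l h1 h2; exists l; rewrite E.
have [l hl'] := choice hl.
have lim2 : iint (fun x => cutoff n x * div x) @[n --> \oo] --> \sum_j l j.
  apply: (cvg_eqf IE); apply: cvg_big => //; first exact: add_continuous.
  by move=> j _; exact: (hl' j).1.
have -> : int_on D div = \sum_j l j by apply: (cvg_unique _ lim1 lim2).
by apply: ler_sum => j _; exact: (hl' j).2.
Qed.

End Layer.

(** * Differential calculus in several variables *)

Section Calculus.
Variables (R : realType) (m : nat).
Implicit Types (U : set 'rV[R]_m) (f g : 'rV[R]_m -> R) (x y v : 'rV[R]_m).

(** Regularity through iterated coordinate partials, in the style of [smooth_on] but of finite
    order; derivatives in other directions are recovered by [chain_rule]. *)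
Fixpoint Cn (n : nat) U g : Prop :=
  (forall x, U x -> {for x, continuous g}) /\
  if n is n'.+1 then forall i, (forall x, U x -> derivable g x (unit_vec R i)) /\ Cn n' U (pd i g)
  else True.

Lemma Cn_cont n U g x : Cn n U g -> U x -> {for x, continuous g}.
Proof. by case: n => [|n] [h _]; exact: h. Qed.

Lemma Cn_W n U g : Cn n.+1 U g -> Cn n U g.
Proof.
elim: n g => [|n IH] g /= [cg h]; first by [].
by split=> // i; have [h1 h2] := h i; split=> //; exact: IH.
Qed.

Lemma Cn_pd n U g i : Cn n.+1 U g -> Cn n U (pd i g).
Proof. by move=> [_ h]; exact: (h i).2. Qed.

Lemma Cn_is_derive n U g i x : Cn n.+1 U g -> U x -> is_derive x (unit_vec R i) g (pd i g x).
Proof. by move=> [_ h] Ux; apply: derivableP; exact: (h i).1. Qed.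

Lemma dpart_rcons s i g : dpart (rcons s i) g = dpart s (pd i g).
Proof. by elim: s => //= j s ->. Qed.

Lemma smooth_pd U g i : smooth_on U g -> smooth_on U (pd i g).
Proof. by move=> sg s; have := sg (rcons s i); rewrite dpart_rcons. Qed.

Lemma smooth_Cn n U g : smooth_on U g -> Cn n U g.
Proof.
elim: n g => [|n IH] g sg; (split; first exact: (sg [::]).1) => // i.
split; last by apply: IH; exact: smooth_pd.
by move=> x Ux; exact: (sg [::]).2.
Qed.

Lemma pd_eq U f g i x : open U -> U x -> (forall y, U y -> f y = g y) -> pd i f x = pd i g x.
Proof.
move=> oU Ux fg; apply: near_eq_derive.
by move: oU; rewrite openE => /(_ x Ux); apply: filterS => y; exact: fg.
Qed.

Lemma derivable_eq U f g x v : open U -> U x -> (forall y, U y -> f y = g y) ->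
  derivable f x v -> derivable g x v.
Proof.
move=> oU Ux fg; apply: near_eq_derivable.
by move: oU; rewrite openE => /(_ x Ux); apply: filterS => y; exact: fg.
Qed.

Lemma cont_eq U f g x : open U -> U x -> (forall y, U y -> f y = g y) ->
  {for x, continuous f} -> {for x, continuous g}.
Proof.
move=> oU Ux fg; rewrite /prop_for /continuous_at -(fg x Ux).
move=> cf A hA; have h := cf A hA.
have H : \near x, U x by move: oU; rewrite openE => /(_ x Ux).
by apply: filterS2 H h => y Uy; rewrite /= fg.
Qed.

Lemma Cn_eq n U f g : open U -> (forall y, U y -> f y = g y) -> Cn n U f -> Cn n U g.
Proof.
move=> oU; elim: n f g => [|n IH] f g fg [cf hf].
  by split=> // x Ux; apply: (cont_eq oU Ux fg); exact: cf.
split=> [x Ux|i]; first by apply: (cont_eq oU Ux fg); exact: cf.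
have [h1 h2] := hf i; split=> [x Ux|]; first by apply: (derivable_eq oU Ux fg); exact: h1.
by apply: IH h2 => y Uy; exact: (pd_eq i oU Uy fg).
Qed.

Lemma Cn_sub n U U' g : U' `<=` U -> Cn n U g -> Cn n U' g.
Proof.
move=> sU; elim: n g => [|n IH] g [cg hg]; first by split=> // x /sU; exact: cg.
split=> [x /sU|i]; first exact: cg.
by have [h1 h2] := hg i; split=> [x /sU|]; [exact: h1|exact: IH].
Qed.

Lemma Cn_cst n U (a : R) : open U -> Cn n U (fun=> a).
Proof.
move=> oU; elim: n a => [|n IH] a; (split; first by move=> x _; exact: cont_cst) => // i.
split=> [x _|]; first exact: derivable_cst.
by apply: Cn_eq (IH 0) => // y _; rewrite /pd derive_cst.
Qed.

Lemma Cn_D n U f g : open U -> Cn n U f -> Cn n U g -> Cn n U (fun x => f x + g x).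
Proof.
move=> oU; elim: n f g => [|n IH] f g [cf hf] [cg hg].
  by split=> // x Ux; apply: cont_D; [exact: cf|exact: cg].
split=> [x Ux|i]; first by apply: cont_D; [exact: cf|exact: cg].
have [f1 f2] := hf i; have [g1 g2] := hg i; split=> [x Ux|].
  by apply: derivableD; [exact: f1|exact: g1].
apply: Cn_eq (IH _ _ f2 g2) => // x Ux.
by rewrite /pd -deriveD//; [exact: f1|exact: g1].
Qed.

Lemma Cn_M n U f g : open U -> Cn n U f -> Cn n U g -> Cn n U (fun x => f x * g x).
Proof.
move=> oU; elim: n f g => [|n IH] f g hf0 hg0.
  by have [cf _] := hf0; have [cg _] := hg0; split=> // x Ux; apply: cont_M; [exact: cf|exact: cg].
have [cf hf] := hf0; have [cg hg] := hg0.
split=> [x Ux|i]; first by apply: cont_M; [exact: cf|exact: cg].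
have [f1 f2] := hf i; have [g1 g2] := hg i; split=> [x Ux|].
  by apply: derivableM; [exact: f1|exact: g1].
have H := Cn_D oU (IH _ _ (Cn_W hf0) g2) (IH _ _ (Cn_W hg0) f2).
apply: Cn_eq H => // x Ux.
by rewrite /pd (@deriveM _ _ f g)//; [exact: f1|exact: g1].
Qed.

Lemma Cn_V n U f : open U -> (forall x, U x -> f x != 0) -> Cn n U f -> Cn n U (fun x => (f x)^-1).
Proof.
move=> oU f0; elim: n => [|n IH] hf0.
  have [cf _] := hf0; split=> // x Ux.
  by apply: continuousV; [exact: f0|exact: cf].
have [cf hf] := hf0; split=> [x Ux|i].
  by apply: continuousV; [exact: f0|exact: cf].
have [f1 f2] := hf i; split=> [x Ux|].
  by apply: derivableV; [exact: f0|exact: f1].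
have IHn := IH (Cn_W hf0).
have H := Cn_M oU (Cn_M oU (Cn_cst n (-1) oU) (Cn_M oU IHn IHn)) f2.
apply: Cn_eq H => // x Ux.
rewrite /pd (@deriveV _ _ f)//; [|exact: f0|exact: f1].
by rewrite /GRing.scale /= -expr2 exprVn mulN1r.
Qed.

Lemma cont_aff (a : 'rV[R]_m) b x : {for x, continuous (aff a b)}.
Proof.
apply: cont_D; last exact: cont_cst.
apply: continuous_at_sum => i; apply: cont_M; first exact: cont_cst.
exact: coord_continuous.
Qed.

Lemma Cn_aff n U (a : 'rV[R]_m) b : open U -> Cn n U (aff a b).
Proof.
move=> oU; case: n => [|n]; first by split=> // x _; exact: cont_aff.
split=> [x _|i]; first exact: cont_aff.
have H x := @is_derive_aff R m a b x i.
split=> [x _|]; first by have [] := H x.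
apply: Cn_eq (Cn_cst n (a 0 i) oU) => // x _.
by rewrite /pd; have [_ ->] := H x.
Qed.

Lemma Cn_X n k U f : open U -> Cn n U f -> Cn n U (fun x => f x ^+ k).
Proof.
move=> oU hf; elim: k => [|k IH].
  by apply: Cn_eq (Cn_cst n 1 oU) => // y _; rewrite expr0.
by apply: Cn_eq (Cn_M oU hf IH) => // y _; rewrite exprS.
Qed.

Lemma Cn_sum n (I : Type) (r : seq I) U (f : I -> 'rV[R]_m -> R) : open U ->
  (forall i, Cn n U (f i)) -> Cn n U (fun x => \sum_(i <- r) f i x).
Proof.
move=> oU hf; elim: r => [|i r IH].
  by apply: Cn_eq (Cn_cst n 0 oU) => // y _; rewrite big_nil.
by apply: Cn_eq (Cn_D oU (hf i) IH) => // y _; rewrite big_cons.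
Qed.

Lemma MVT_line2 x v f (df : 'rV[R]_m -> R) (a : R) :
  (forall t : R, `|t| <= `|a| -> is_derive (x + t *: v) v f (df (x + t *: v))) ->
  exists2 t : R, `|t| <= `|a| & f (x + a *: v) - f x = a * df (x + t *: v).
Proof.
move=> h; have [a0|a0] := leP 0 a.
  have h' (t : R) : 0 <= t <= a -> is_derive (x + t *: v) v f (df (x + t *: v)).
    by move=> /andP[t0 ta]; apply: h; rewrite !ger0_norm.
  have [t /andP[t0 ta] E] := MVT_line a0 h'.
  by exists t => //; rewrite !ger0_norm.
have na0 : 0 <= - a by rewrite oppr_ge0 ltW.
pose z := x + a *: v.
have zE t : z + t *: v = x + (a + t) *: v by rewrite /z -addrA -scalerDl.
have h' (t : R) : 0 <= t <= - a -> is_derive (z + t *: v) v f (df (z + t *: v)).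
  by move=> /andP[t0 ta]; rewrite zE; apply: h; rewrite [`|a|]ltr0_norm// ler_norml; apply/andP; split; lra.
have [t /andP[t0 ta] E] := MVT_line na0 h'.
exists (a + t); first by rewrite [`|a|]ltr0_norm// ler_norml; apply/andP; split; lra.
move: E; rewrite !zE subrr scale0r addr0 => E.
by rewrite /z in E *; rewrite -opprB E mulNr opprK.
Qed.

Lemma nbhs_norm_ex (V : normedModType R) (x : V) (P : set V) : nbhs x P ->
  exists2 r : R, 0 < r & forall y : V, `|y - x| < r -> P y.
Proof.
move=> /nbhs_normP[r /= r0 h]; exists r => // y yx; apply: h => /=.
by rewrite distrC.
Qed.

Lemma open_ball U x : open U -> U x -> exists2 r : R, 0 < r & forall y, `|y - x| < r -> U y.
Proof. by rewrite openE => oU Ux; apply: nbhs_norm_ex; exact: oU. Qed.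

Lemma cont_ball f x (e : R) : {for x, continuous f} -> 0 < e ->
  exists2 r : R, 0 < r & forall y, `|y - x| < r -> `|f y - f x| <= e.
Proof.
move=> cf e0; have : \forall y \near x, `|f x - f y| <= e.
  by have /cvgrPdist_le := cf; apply.
move=> /nbhs_norm_ex[r r0 h]; exists r => // y yx; rewrite distrC; exact: h.
Qed.

(** The increment along [v + c0 *: e] splits into one along [v] and one along [e] from the displaced
    point. The mean value theorem and continuity of [ge] at [x] give the limit of the second. *)
Lemma chain_step U x v e (c0 a : R) g (ge : 'rV[R]_m -> R) : open U -> U x ->
  is_derive x v g a -> (forall y, U y -> is_derive y e g (ge y)) ->
  {for x, continuous ge} -> is_derive x (v + c0 *: e) g (a + c0 * ge x).
Proof.
move=> oU Ux /is_deriveP hv he cge; apply/is_deriveP.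
have H : (fun h : R => h^-1 * (g (h *: (v + c0 *: e) + x) - g (h *: v + x))) @ 0^' --> c0 * ge x.
  apply/cvgrPdist_le => eps eps0.
  pose e' := eps / (1 + `|c0|).
  have c1 : 0 < 1 + `|c0| by rewrite ltr_pwDl.
  have e'0 : 0 < e' by rewrite divr_gt0.
  have [r1 r10 hU] := open_ball oU Ux.
  have [r2 r20 hg] := cont_ball cge e'0.
  pose K := `|v| + `|c0| * `|e| + 1.
  have K0 : 0 < K by rewrite ltr_pwDr// addr_ge0// mulr_ge0.
  have rK : 0 < Num.min r1 r2 / K by rewrite divr_gt0// lt_min r10.
  near=> h.
  have h0 : h != 0 by near: h; exact: nbhs_dnbhs_neq.
  have hs : `|h| < Num.min r1 r2 / K by near: h; exact: dnbhs0_lt.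
  have hb (t : R) : `|t| <= `|h * c0| -> `|h *: v + x + t *: e - x| < Num.min r1 r2.
    move=> ht; rewrite addrAC addrK; apply: le_lt_trans (ler_normD _ _) _.
    rewrite !normrZ; apply: (@le_lt_trans _ _ (`|h| * K)); last by rewrite -ltr_pdivlMr.
    rewrite /K mulrDr mulr1 mulrDr mulrA -normrM -addrA lerD2l.
    rewrite -[leLHS]addr0; apply: lerD => //; by apply: ler_wpM2r.
  have hd (t : R) : `|t| <= `|h * c0| -> is_derive (h *: v + x + t *: e) e g (ge (h *: v + x + t *: e)).
    by move=> /hb ht; apply: he; apply: hU; apply: lt_le_trans ht _; rewrite ge_min lexx.
  have [t ht E] := MVT_line2 hd.
  rewrite scalerDr scalerA [h *: v + _ + x]addrAC E mulrA mulKf//.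
  rewrite -mulrBr normrM; apply: (@le_trans _ _ (`|c0| * e')).
    rewrite ler_wpM2l// distrC; apply: hg; apply: lt_le_trans (hb t ht) _.
    by rewrite ge_min lexx orbT.
  rewrite /e' mulrA ler_pdivrMr// mulrC; apply: ler_wpM2l; first exact: ltW.
  by rewrite lerDr.
apply: cvg_trans (cvgD hv H); apply: near_eq_cvg; near=> h => /=.
by rewrite -mulrDr addrC addrA subrK.
Unshelve. all: by end_near. Qed.

Lemma row_sum_unit v : v = \sum_i v 0 i *: unit_vec R i.
Proof. exact: row_sum_delta. Qed.

Lemma chain_rule U g x v : open U -> Cn 1 U g -> U x ->
  is_derive x v g (\sum_i v 0 i * pd i g x).
Proof.
move=> oU hg Ux; rewrite {1}(row_sum_unit v).
elim: (index_enum _) => [|i r IH]; first by rewrite !big_nil; exact: is_derive0.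
rewrite !big_cons addrC [X in is_derive _ _ _ X]addrC.
have := @chain_step U x _ (unit_vec R i) (v 0 i) _ g (pd i g) oU Ux IH.
apply; first by move=> y Uy; exact: (Cn_is_derive _ hg Uy).
exact: (Cn_cont (Cn_pd i hg) Ux).
Qed.

Lemma cvg_sandwich (a : nat -> R) (l K : R) :
  (forall e, 0 < e -> \forall n \near \oo, `|a n - l| <= K * e) -> a n @[n --> \oo] --> l.
Proof.
move=> h; apply/cvgrPdist_le => e e0.
have K1 : 0 < 1 + `|K| by rewrite ltr_pwDl.
apply: filterS (h (e / (1 + `|K|)) (divr_gt0 e0 K1)) => n; rewrite distrC => /le_trans; apply.
rewrite mulrCA ger_pMr// ler_pdivrMr// mul1r; apply: le_trans (ler_norm _) _.
by rewrite lerDr.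
Qed.

Lemma is_derive_shift g x v a (l : R) : is_derive (x + a) v g l -> is_derive x v (fun y => g (y + a)) l.
Proof.
move=> /is_deriveP h; apply/is_deriveP; apply: cvg_trans h; apply: near_eq_cvg; apply: nearW => t /=.
by rewrite addrA.
Qed.

(** Two applications of the mean value theorem turn the quotient into a mixed partial at a nearby
    point. Symmetry of the quotient in [i] and [j] then yields [schwarz]. *)
Lemma mixed_difference U g x i j : open U -> Cn 2 U g -> U x ->
  n.+1%:R * (n.+1%:R * (g (x + n.+1%:R^-1 *: unit_vec R i + n.+1%:R^-1 *: unit_vec R j)
    - g (x + n.+1%:R^-1 *: unit_vec R i) - g (x + n.+1%:R^-1 *: unit_vec R j) + g x))
  @[n --> \oo] --> pd j (pd i g) x.
Proof.
move=> oU hg Ux; apply: (@cvg_sandwich _ _ 1) => eps eps0.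
have cji : {for x, continuous (pd j (pd i g))} := Cn_cont (Cn_pd j (Cn_pd i hg)) Ux.
have [r1 r10 hU] := open_ball oU Ux.
have [r2 r20 hc] := cont_ball cji eps0.
have rr : 0 < Num.min r1 r2 / 2 by rewrite divr_gt0// lt_min r10.
near=> n.
have hr : n.+1%:R^-1 < Num.min r1 r2 / 2 by near: n; exact: (near_infty_natSinv_lt (PosNum rr)).
have h0 : 0 < n.+1%:R^-1 :> R by rewrite invr_gt0.
set h := n.+1%:R^-1 in hr h0 *.
have hb (s t : R) : `|s| <= h -> `|t| <= h ->
    `|x + s *: unit_vec R i + t *: unit_vec R j - x| < Num.min r1 r2.
  move=> hs ht; rewrite addrAC (addrAC x) subrr add0r.
  apply: le_lt_trans (ler_normD _ _) _; rewrite !normrZ !norm_unit_vec !mulr1.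
  have := lerD hs ht; lra.
have hbU (s t : R) : `|s| <= h -> `|t| <= h -> U (x + s *: unit_vec R i + t *: unit_vec R j).
  by move=> hs ht; apply: hU; apply: lt_le_trans (hb s t hs ht) _; rewrite ge_min lexx.
have hbU0 (s : R) : `|s| <= h -> U (x + s *: unit_vec R i).
  by move=> hs; have := hbU s 0 hs; rewrite scale0r addr0 normr0; apply; exact: ltW.
pose F y := g (y + h *: unit_vec R j) - g y.
pose dF y := pd i g (y + h *: unit_vec R j) - pd i g y.
have hh : `|h| <= h by rewrite ger0_norm// ltW.
have dFP (t : R) : `|t| <= `|h| -> is_derive (x + t *: unit_vec R i) (unit_vec R i) F (dF (x + t *: unit_vec R i)).
  rewrite (ger0_norm (ltW h0)) => ht; apply: is_deriveB.
    have := Cn_is_derive i hg (hbU t h ht hh).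
    exact: is_derive_shift.
  exact: (Cn_is_derive _ hg (hbU0 t ht)).
have [s hs E1] := MVT_line2 dFP.
rewrite (ger0_norm (ltW h0)) in hs.
have dGP (t : R) : `|t| <= `|h| -> is_derive (x + s *: unit_vec R i + t *: unit_vec R j) (unit_vec R j)
    (pd i g) (pd j (pd i g) (x + s *: unit_vec R i + t *: unit_vec R j)).
  rewrite (ger0_norm (ltW h0)) => ht.
  exact: (Cn_is_derive _ (Cn_pd i hg) (hbU s t hs ht)).
have [t ht E2] := MVT_line2 dGP.
rewrite (ger0_norm (ltW h0)) in ht.
have E : g (x + h *: unit_vec R i + h *: unit_vec R j) - g (x + h *: unit_vec R i)
    - g (x + h *: unit_vec R j) + g x = h * (h * pd j (pd i g) (x + s *: unit_vec R i + t *: unit_vec R j)).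
  by rewrite -E2 -E1 /F; ring.
rewrite E mul1r -[X in X * (X * _)]invrK -/h.
rewrite mulKf ?gt_eqF// mulKf ?gt_eqF//.
by apply: hc; apply: lt_le_trans (hb s t hs ht) _; rewrite ge_min lexx orbT.
Unshelve. all: by end_near. Qed.

Lemma schwarz U g x i j : open U -> Cn 2 U g -> U x -> pd j (pd i g) x = pd i (pd j g) x.
Proof.
move=> oU hg Ux; apply: (cvg_unique _ (mixed_difference (i := i) (j := j) oU hg Ux)) => //.
have := mixed_difference (i := j) (j := i) oU hg Ux.
apply: cvg_trans; apply: near_eq_cvg; apply: nearW => n /=.
have -> : x + n.+1%:R^-1 *: unit_vec R i + n.+1%:R^-1 *: unit_vec R j =
  x + n.+1%:R^-1 *: unit_vec R j + n.+1%:R^-1 *: unit_vec R i by rewrite addrAC.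
by congr (_ * (_ * _)); ring.
Qed.

Definition hess_form g x v : R := \sum_i \sum_j v 0 i * v 0 j * pd i (pd j g) x.

Lemma second_derive U g x v : open U -> Cn 2 U g -> U x ->
  is_derive x v (fun y => \sum_i v 0 i * pd i g y) (hess_form g x v).
Proof.
move=> oU hg Ux.
have H : Cn 1 U (fun y => \sum_i v 0 i * pd i g y).
  by apply: Cn_sum => // i; apply: Cn_M => //; [exact: Cn_cst|exact: Cn_pd].
have := chain_rule v oU H Ux; congr (is_derive _ _ _ _).
apply: eq_bigr => i _.
have hi j : is_derive x (unit_vec R i) (fun y => v 0 j * pd j g y) (v 0 j * pd i (pd j g) x).
  by have := @is_deriveZ _ _ _ _ (v 0 j) _ _ _ (Cn_is_derive i (Cn_pd j hg) Ux).
have := @is_derive_sum _ _ _ m (fun j y => v 0 j * pd j g y) x (unit_vec R i) _ hi.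
rewrite /pd => hs.
have -> : (fun y => \sum_i0 v 0 i0 * pd i0 g y) = \sum_(j < m) (fun y => v 0 j * pd j g y).
  by apply/funext => y; rewrite fct_sumE.
have [_ ->] := hs; rewrite mulr_sumr; apply: eq_bigr => j _.
by rewrite mulrA.
Qed.

Lemma MVT_seg (f df : R -> R) (a b : R) : a <= b ->
  (forall t : R, a <= t <= b -> is_derive t (1 : R) f (df t)) ->
  exists2 t : R, a <= t <= b & f b - f a = df t * (b - a).
Proof.
move=> ab h.
have h' (t : R) : t \in `[a, b]%R -> is_derive t (1:R) f (df t).
  by rewrite in_itv; exact: h.
have h1 (t : R) : t \in `]a, b[%R -> is_derive t (1:R) f (df t).
  by move=> ht; apply: h'; exact: subset_itv_oo_cc.
have hc : {within `[a, b], continuous f}.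
  by apply: derivable_within_continuous => t /h' [].
have [t ht E] := MVT_segment ab h1 hc.
by exists t => //; move: ht; rewrite in_itv.
Qed.

(** The mean value theorem is applied to the even combination [mu'] on [0,h], and then to the first
    directional derivative, corrected by its linear part, on [-t,t]. *)
Lemma second_difference_le U g x v (h A B : R) : open U -> Cn 2 U g -> 0 <= h ->
  (forall t : R, `|t| <= h -> U (x + t *: v)) ->
  (forall t : R, `|t| <= h -> `|hess_form g (x + t *: v) v - A| <= B) ->
  `|g (x + h *: v) + g (x - h *: v) - 2 * g x - h ^+ 2 * A| <= 2 * h ^+ 2 * B.
Proof.
move=> oU hg h0 hU hB.
have B0 : 0 <= B.
  apply: le_trans (normr_ge0 _) (hB 0 _); by rewrite normr0.
pose g1 y := \sum_i v 0 i * pd i g y.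
pose mu (t : R) := g (x + t *: v) + g (x + (- t) *: v) - t ^+ 2 * A.
pose dmu (t : R) := g1 (x + t *: v) - g1 (x + (- t) *: v) - 2 * t * A.
have lineD (t : R) : `|t| <= h -> is_derive t (1:R) (fun s : R => g (x + s *: v)) (g1 (x + t *: v)).
  by move=> /hU Ut; apply: (proj1 (is_derive_line x v g t _)); exact: (chain_rule v oU (Cn_W hg) Ut).
have lineD2 (t : R) : `|t| <= h -> is_derive t (1:R) (fun s : R => g1 (x + s *: v)) (hess_form g (x + t *: v) v).
  by move=> /hU Ut; apply: (proj1 (is_derive_line x v g1 t _)); exact: (second_derive v oU hg Ut).
have dN (t : R) : is_derive t (1 : R) (fun s : R => - s) (-1) by exact: is_deriveNid.
have dsq (t : R) : is_derive t (1 : R) (fun s : R => A * (s * s)) (A * (t + t)).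
  have H := @is_deriveM _ _ (fun s : R => s) (fun s : R => s) t 1 1 1 (is_derive_id _ _) (is_derive_id _ _).
  have := @is_deriveZ _ _ _ _ A _ _ _ H.
  by congr (is_derive _ _ _ _); rewrite /GRing.scale /= mulr1.
have hN (t : R) : `|t| <= h -> `|- t| <= h by rewrite normrN.
pose mu' (t : R) := g (x + t *: v) + g (x + (- t) *: v) - A * (t * t).
have dmuP (t : R) : `|t| <= h -> is_derive t (1 : R) mu'
    (g1 (x + t *: v) + g1 (x + (- t) *: v) * -1 - A * (t + t)).
  move=> ht; apply: is_deriveB; apply: is_deriveD; first exact: lineD.
  exact: (is_derive_comp1 (dN t) (lineD _ (hN t ht))).
have dmuP' (t : R) : 0 <= t <= h -> is_derive t (1 : R) mu'
    (g1 (x + t *: v) + g1 (x + (- t) *: v) * -1 - A * (t + t)).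
  by move=> /andP[t0 th]; apply: dmuP; rewrite ger0_norm.
have [t ht E1] := MVT_seg h0 dmuP'.
move: ht => /andP[t0 th].
have tt : - t <= t by lra.
pose k (s : R) := g1 (x + s *: v) - A * s.
have dk (s : R) : - t <= s <= t -> is_derive s (1 : R) k (hess_form g (x + s *: v) v - A).
  move=> hs; apply: is_deriveB.
    apply: lineD2; rewrite ler_norml; move: hs => /andP[h1 h2]; apply/andP; split; lra.
  have := @is_deriveZ _ _ _ _ A _ _ _ (is_derive_id s (1 : R)).
  by congr (is_derive _ _ _ _); rewrite /GRing.scale /= mulr1.
have [s hs E2] := MVT_seg tt dk.
have hB' : `|hess_form g (x + s *: v) v - A| <= B.
  apply: hB; rewrite ler_norml; move: hs => /andP[h1 h2]; apply/andP; split; lra.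
have -> : g (x + h *: v) + g (x - h *: v) - 2 * g x - h ^+ 2 * A = mu' h - mu' 0.
  by rewrite /mu' !scaleNr scale0r subr0 addr0 expr2; ring.
rewrite E1.
have -> : g1 (x + t *: v) + g1 (x + - t *: v) * -1 - A * (t + t) = k t - k (- t).
  by rewrite /k; ring.
rewrite E2 subr0 normrM normrM (ger0_norm h0) [`|t - - t|]ger0_norm; last lra.
have -> : 2 * h ^+ 2 * B = B * (2 * h) * h by ring.
by apply: ler_wpM2r => //; apply: ler_pM => //; lra.
Qed.

Lemma cvg_half : (2 ^- n : R) @[n --> \oo] --> (0 : R).
Proof.
have h : `|2^-1 : R| < 1 by rewrite ger0_norm ?invr_ge0// invf_lt1// ltr1n.
apply: (cvg_eqf (v := geometric 1 2^-1)); last exact: cvg_geometric.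
by move=> n; rewrite /geometric /= mul1r exprVn.
Qed.

Lemma exp4_half n : 4 ^+ n * (2 ^- n) ^+ 2 = 1 :> R.
Proof.
have -> : (4 : R) = 2 ^+ 2 by rewrite expr2; ring.
by rewrite -exprM mulnC exprM -exprMn divff ?expr1n// expf_neq0// pnatr_eq0.
Qed.

(** The dyadic steps and the factor [4 ^+ n] match the repeated halving of [doubling]. *)
Lemma second_difference_cvg U g x v : open U -> Cn 2 U g -> U x ->
  (4 ^+ n) * (g (x + (2 ^- n) *: v) + g (x - (2 ^- n) *: v) - 2 * g x) @[n --> \oo]
    --> hess_form g x v.
Proof.
move=> oU hg Ux; apply: (@cvg_sandwich _ _ 2) => e e0.
have ch : {for x, continuous (hess_form g ^~ v)}.
  apply: continuous_at_sum => i; apply: continuous_at_sum => j; apply: cont_M; first exact: cont_cst.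
  exact: (Cn_cont (Cn_pd i (Cn_pd j hg)) Ux).
have [r1 r10 hU] := open_ball oU Ux.
have [r2 r20 hc] := cont_ball ch e0.
have v1 : 0 < `|v| + 1 by rewrite ltr_wpDl.
have rr : 0 < Num.min r1 r2 / (`|v| + 1) by rewrite divr_gt0// lt_min r10.
have lim2 : (2 ^- n : R) @[n --> \oo] --> (0 : R) by exact: cvg_half.
near=> n.
have hr : 2 ^- n < Num.min r1 r2 / (`|v| + 1).
  by near: n; exact: (cvgr_lt _ lim2).
have h0 : 0 <= 2 ^- n :> R by rewrite invr_ge0 exprn_ge0.
have hb (t : R) : `|t| <= 2 ^- n -> `|x + t *: v - x| < Num.min r1 r2.
  move=> ht; rewrite addrC addKr normrZ.
  apply: (@le_lt_trans _ _ (2 ^- n * (`|v| + 1))); last by rewrite -ltr_pdivlMr.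
  by apply: ler_pM => //; rewrite lerDl.
have := @second_difference_le U g x v (2 ^- n) (hess_form g x v) e oU hg h0.
have q4 := exp4_half n.
set S := g _ + _ - _.
have -> : 4 ^+ n * S - hess_form g x v = 4 ^+ n * (S - (2 ^- n) ^+ 2 * hess_form g x v).
  by rewrite [RHS]mulrBr [4 ^+ n * (_ * _)]mulrA q4 mul1r.
move=> H; rewrite normrM [`|4 ^+ n|]ger0_norm ?exprn_ge0//.
have {}H : `|S - (2 ^- n) ^+ 2 * hess_form g x v| <= 2 * (2 ^- n) ^+ 2 * e.
  apply: H => t ht; first by apply: hU; apply: lt_le_trans (hb t ht) _; rewrite ge_min lexx.
  by apply: hc; apply: lt_le_trans (hb t ht) _; rewrite ge_min lexx orbT.
have -> : 2 * e = 4 ^+ n * (2 * (2 ^- n) ^+ 2 * e).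
  set a := 4 ^+ n in q4 *; set b := (2 ^- n) ^+ 2 in q4 *.
  have -> : a * (2 * b * e) = a * b * (2 * e) by ring.
  by rewrite q4 mul1r.
by rewrite ler_wpM2l// exprn_ge0.
Unshelve. all: by end_near. Qed.

Lemma hess_form_ge0 U D g x v : open U -> Cn 2 U g -> U x -> U `<=` D -> convex_on D g ->
  0 <= hess_form g x v.
Proof.
move=> oU hg Ux UD cg.
have [r r0 hU] := open_ball oU Ux.
have v1 : 0 < `|v| + 1 by rewrite ltr_wpDl.
apply: (ler_cvg_to (@cvg_cst _ (0 : R) _ \oo eventually_filter) (second_difference_cvg (v := v) oU hg Ux)).
have lim2 : (2 ^- n : R) @[n --> \oo] --> (0 : R) by exact: cvg_half.
near=> n.
have hr : 2 ^- n < r / (`|v| + 1) by near: n; apply: (cvgr_lt _ lim2); exact: divr_gt0.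
have hb (t : R) : `|t| <= 2 ^- n -> D (x + t *: v).
  move=> ht; apply: UD; apply: hU; rewrite addrC addKr normrZ.
  apply: (@le_lt_trans _ _ (2 ^- n * (`|v| + 1))); last by rewrite -ltr_pdivlMr.
  by apply: ler_pM => //; rewrite lerDl.
have q0 : 0 <= 2 ^- n :> R by rewrite invr_ge0 exprn_ge0.
rewrite mulr_ge0 ?exprn_ge0// subr_ge0.
have h1 : D (x + 2 ^- n *: v) by apply: hb; rewrite ger0_norm.
have h2 : D (x - 2 ^- n *: v) by rewrite -scaleNr; apply: hb; rewrite normrN ger0_norm.
have half01 : 0 <= (2^-1 : R) <= 1 by rewrite invr_ge0 ler0n /= invf_le1// ler1n.
have := cg _ _ _ h1 h2 half01.
have -> : 2^-1 *: (x + 2 ^- n *: v) + (1 - 2^-1) *: (x - 2 ^- n *: v) = x.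
  have -> : 1 - 2^-1 = 2^-1 :> R by field.
  apply/rowP => i; rewrite !mxE; generalize ((2 ^- n : R) * v 0 i) => w; set z := x 0 i; lra.
set p := g _; set q := g _; set z := g x.
have -> : 1 - 2^-1 = 2^-1 :> R by field.
by lra.
Unshelve. all: by end_near. Qed.

End Calculus.

(** * Quadratic forms, geometry of the polytope *)

Section Trace.
Variables (R : realFieldType) (m : nat).
Implicit Types (G W : 'M[R]_m) (v w e z : 'rV[R]_m).

Definition qform G v w : R := (v *m G *m w^T) 0 0.

Lemma qformE G v w : qform G v w = \sum_i \sum_j v 0 i * w 0 j * G i j.
Proof.
rewrite /qform mxE exchange_big /=; apply: eq_bigr => j _; rewrite !mxE mulr_suml.
by apply: eq_bigr => i _; ring.
Qed.

Lemma qformDl G v v' w : qform G (v + v') w = qform G v w + qform G v' w.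
Proof. by rewrite /qform !mulmxDl mxE. Qed.

Lemma qformZl G (a : R) v w : qform G (a *: v) w = a * qform G v w.
Proof. by rewrite /qform -!scalemxAl mxE. Qed.

Lemma qform_sym G v w : G^T = G -> qform G v w = qform G w v.
Proof.
move=> sG; rewrite /qform -[LHS](mxE trmx_key (fun i j => (v *m G *m w^T) j i)).
by rewrite -/(trmx _) !trmx_mul trmxK sG mulmxA.
Qed.

Definition psd G := forall v, 0 <= qform G v v.

(** For positive [b] the minimum at [t = - s / b] is the claim; for [b = 0] a nonzero [s] would
    allow the value -1. *)
Lemma quadratic_disc (a s b : R) : 0 <= b -> (forall t, 0 <= a + 2 * t * s + t ^+ 2 * b) -> s ^+ 2 <= a * b.
Proof.
rewrite le_eqVlt => /predU1P[<-|b0] h.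
  have [->|s0] := eqVneq s 0; first by rewrite expr0n mulr0.
  have := h (- (a + 1) / (2 * s)); rewrite !mulr0 addr0.
  have -> : 2 * (- (a + 1) / (2 * s)) * s = - (a + 1) by field.
  by move=> ?; exfalso; lra.
have := h (- s / b).
have -> : a + 2 * (- s / b) * s + (- s / b) ^+ 2 * b = a - s ^+ 2 / b by field; rewrite gt_eqF.
by rewrite subr_ge0 ler_pdivrMr.
Qed.

Lemma qform_CS G v z : G^T = G -> psd G -> qform G v z ^+ 2 <= qform G v v * qform G z z.
Proof.
move=> sG pG; apply: quadratic_disc => // t.
have := pG (v + t *: z).
rewrite qformDl qformZl ![qform G _ (_ + _)]qform_sym// !qformDl !qformZl (qform_sym z v sG).
by congr (0 <= _); ring.
Qed.

Lemma tr_outer G e : \tr (G *m (e^T *m e)) = qform G e e.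
Proof. by rewrite mulmxA mxtrace_mulC mulmxA trace_mx11. Qed.

Lemma qform_outer e v : qform (e^T *m e) v v = (v *m e^T) 0 0 ^+ 2.
Proof.
rewrite /qform !mulmxA -mulmxA mxE big_ord1 expr2; congr (_ * _).
by rewrite -[LHS](mxE trmx_key (fun i j => (e *m v^T) j i)) -/(trmx _) trmx_mul trmxK.
Qed.

Lemma qformB G W v w : qform (G - W) v w = qform G v w - qform W v w.
Proof. by rewrite /qform mulmxBr mulmxBl !mxE. Qed.

Lemma qformZ (a : R) G v w : qform (a *: G) v w = a * qform G v w.
Proof. by rewrite /qform -scalemxAr -scalemxAl mxE. Qed.

Lemma qform_delta W i : qform W (delta_mx 0 i) (delta_mx 0 i) = W i i.
Proof.
by rewrite /qform -rowE trmx_delta -colE !mxE.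
Qed.

Lemma qform_deltar W v i : W^T = W -> qform W v (delta_mx 0 i) = (v *m (row i W)^T) 0 0.
Proof.
by move=> sW; rewrite /qform -mulmxA tr_row sW trmx_delta -colE.
Qed.

(* Gaussian elimination of W: each step subtracts a rank-one psd matrix. *)
Lemma tr_psd_ge0 G W : psd G -> W^T = W -> psd W -> 0 <= \tr (G *m W).
Proof.
move=> pG.
suff H k : forall W, (k <= m)%N -> (forall i j : 'I_m, (i < m - k)%N -> W i j = 0) ->
    W^T = W -> psd W -> 0 <= \tr (G *m W).
  by apply: (H m) => // i j; rewrite subnn.
elim: k => [|k IH] {}W km W0 sW pW.
  have -> : W = 0 by apply/matrixP => i j; rewrite W0 ?mxE// subn0.
  by rewrite mulmx0 mxtrace0.
have km' : (m - k.+1 < m)%N by rewrite ltn_subrL /= (leq_trans _ km).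
(* The rows above [i0] already vanish, so [i0] is the next pivot. *)
pose i0 := Ordinal km'; pose r := row i0 W; pose b := W i0 i0.
have b0 : 0 <= b by have := pW (delta_mx 0 i0); rewrite qform_delta.
have cs v : (v *m r^T) 0 0 ^+ 2 <= qform W v v * b.
  by rewrite -qform_deltar// -[b]qform_delta; exact: qform_CS.
pose W' := W - b^-1 *: (r^T *m r).
have W'E i j : W' i j = W i j - b^-1 * (W i0 i * W i0 j).
  by rewrite !mxE big_ord1 !mxE.
have sWE i j : W i j = W j i by rewrite -{1}sW mxE.
have -> : \tr (G *m W) = \tr (G *m W') + b^-1 * qform G r r.
  by rewrite /W' mulmxBr -scalemxAr raddfB /= mxtraceZ tr_outer subrK.
apply: addr_ge0; last by rewrite mulr_ge0 ?invr_ge0.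
apply: IH; first exact: ltnW.
- move=> i j hi; rewrite W'E.
  have [lti|] := ltnP i (m - k.+1).
    by rewrite W0// (sWE i0 i) W0// mul0r mulr0 subr0.
  move=> gei; have {gei hi}-> : i = i0.
    by apply: val_inj => /=; apply/eqP; rewrite eqn_leq gei andbT -ltnS -subSn.
  (* A zero pivot of a positive semidefinite matrix has a zero row, by Cauchy-Schwarz; with
     [b^-1 = 0] nothing is subtracted and nothing needs to be. *)
  rewrite -/b; have [bz|bn] := eqVneq b 0; last by rewrite mulKf ?subrr.
  rewrite bz invr0 mul0r subr0.
  have := cs (delta_mx 0 j); rewrite bz mulr0 => h.
  have : ((delta_mx 0 j : 'rV[R]_m) *m r^T) 0 0 ^+ 2 == 0 by rewrite eq_le h sqr_ge0.
  by rewrite sqrf_eq0 -rowE !mxE => /eqP.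
- by rewrite /W' linearB linearZ /= sW trmx_mul trmxK.
- move=> v; rewrite /W' qformB qformZ qform_outer subr_ge0.
  have := cs v; have [bz|bn] := eqVneq b 0.
    by rewrite bz invr0 mul0r => _; exact: pW.
  have bp : 0 < b by rewrite lt_neqAle eq_sym bn.
  by rewrite [b^-1 * _]mulrC ler_pdivrMr.
Qed.

(** The matrix [G - K^-1 *: (e^T *m e)] is still positive semidefinite: since e = zG, Cauchy-Schwarz
    for G bounds the square of v e^T by G(v,v) G(z,z), and G(z,z) = e z^T is at most K. *)
Lemma tr_ge_direction G W e z (K : R) : G^T = G -> psd G -> W^T = W -> psd W ->
  z *m G = e -> 0 < K -> (e *m z^T) 0 0 <= K -> K^-1 * qform W e e <= \tr (G *m W).
Proof.
move=> sG pG sW pW zG K0 hK.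
pose G' := G - K^-1 *: (e^T *m e).
have -> : \tr (G *m W) = \tr (G' *m W) + K^-1 * qform W e e.
  by rewrite /G' mulmxBl -scalemxAl raddfB /= mxtraceZ [\tr (_ *m _ *m W)]mxtrace_mulC tr_outer subrK.
rewrite lerDr; apply: tr_psd_ge0 => // v.
rewrite /G' qformB qformZ qform_outer subr_ge0 mulrC ler_pdivrMr//.
have -> : v *m e^T = v *m G *m z^T by rewrite -zG trmx_mul sG mulmxA.
apply: le_trans (qform_CS v z sG pG) _; apply: ler_wpM2l => //.
by rewrite /qform zG.
Qed.

End Trace.

(** * Linearity and monotonicity of integrals over the polytope and its facets *)

Section IntegralAlgebra.
Variables (R : realType) (m d : nat) (u : 'I_d -> 'rV[R]_m) (c : 'I_d -> R).
Local Notation L j := (aff (u j) (c j)).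
Local Notation D := (polytope u c).
Hypothesis cD : compact D.
Implicit Types (g h : 'rV[R]_m -> R).

Lemma int_on_eq g h : (forall x, D x -> g x = h x) -> int_on D g = int_on D h.
Proof. by move=> gh; congr iint; apply/funext => x; case: asboolP => // /gh. Qed.

Lemma int_onD g h : {within D, continuous g} -> {within D, continuous h} ->
  int_on D (fun x => g x + h x) = int_on D g + int_on D h.
Proof.
move=> cg ch; rewrite /int_on -iintD; [|exact: good_polytope..].
by congr iint; apply/funext => x; case: ifP; rewrite ?addr0.
Qed.

Lemma int_onZ (a : R) g : {within D, continuous g} ->
  int_on D (fun x => a * g x) = a * int_on D g.
Proof.
move=> cg; rewrite /int_on -iintZ; last exact: good_polytope.
by congr iint; apply/funext => x; case: ifP; rewrite ?mulr0.
Qed.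

Lemma int_on_le g h : {within D, continuous g} -> {within D, continuous h} ->
  (forall x, D x -> g x <= h x) -> int_on D g <= int_on D h.
Proof.
move=> cg ch gh; apply: iint_le; [exact: good_polytope..|] => x.
by case: asboolP => // /gh.
Qed.

Lemma int_facet_eq j g h : (forall x, facet u c j x -> g x = h x) -> int_facet u c j g = int_facet u c j h.
Proof.
move=> gh; rewrite /int_facet; case: pickP => // k _; congr (_ / _); congr iint; apply/funext => x.
by case: asboolP => //= /gh ->.
Qed.

Hypothesis u0 : forall j, u j != 0.

Lemma int_facetZ j (a : R) g : {within D, continuous g} ->
  int_facet u c j (fun x => a * g x) = a * int_facet u c j g.
Proof.
move=> cg; have [k [ujk E]] := int_facetP c (u0 j); rewrite !E mulrA -iintZ; last exact: good_facet.
by congr (iint _ / _); apply/funext => x; rewrite /facet_fun; case: ifP; rewrite ?mulr0.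
Qed.

Lemma int_facet_le j g h : {within D, continuous g} -> {within D, continuous h} ->
  (forall x, facet u c j x -> g x <= h x) -> int_facet u c j g <= int_facet u c j h.
Proof.
move=> cg ch gh; have [k [ujk E]] := int_facetP c (u0 j); rewrite !E.
apply: ler_wpM2r; first by rewrite invr_ge0.
apply: iint_le; [exact: good_facet..|] => x; rewrite /facet_fun.
by case: asboolP => //= /gh fx; case: ifP.
Qed.

End IntegralAlgebra.

Lemma row_neq0 (R : realType) m (a : 'rV[R]_m) : a != 0 -> exists i, a 0 i != 0.
Proof.
move=> /eqP an; apply: contrapT => /forallNP h; apply: an; apply/rowP => i; rewrite mxE.
by apply/eqP; move: (h i) => /negP; rewrite negbK.
Qed.

(** * Interior points, segments and density of the interior *)

Section PolytopeGeometry.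
Variables (R : realType) (m d : nat) (u : 'I_d -> 'rV[R]_m) (c : 'I_d -> R).
Local Notation L j := (aff (u j) (c j)).
Local Notation D := (polytope u c).
Hypothesis u0 : forall j, u j != 0.
Implicit Types (x y : 'rV[R]_m) (g h : 'rV[R]_m -> R).

Lemma affDZ (a : 'rV[R]_m) (b t : R) x y :
  aff a b (x + t *: y) = aff a b x + t * \sum_i a 0 i * y 0 i.
Proof.
by rewrite affD mulr_sumr; congr (_ + _); apply: eq_bigr => i _; rewrite mxE mulrCA.
Qed.

Lemma aff_sub (a : 'rV[R]_m) (b : R) x y : \sum_i a 0 i * (y - x) 0 i = aff a b y - aff a b x.
Proof. by rewrite -[y in RHS](subrKC x) affD [RHS]addrAC subrr add0r. Qed.

Lemma aff_seg (a : 'rV[R]_m) (b t : R) x y :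
  aff a b (x + t *: (y - x)) = (1 - t) * aff a b x + t * aff a b y.
Proof. by rewrite affDZ (aff_sub a b); ring. Qed.

Lemma interior_polytope x : interior D x <-> forall j, 0 < L j x.
Proof.
split=> [/nbhs_norm_ex[r r0 hr] j|h].
  have [i ui] := row_neq0 (u0 j).
  (* A step of half the radius against the sign of the i-th coordinate of [u j] strictly lowers L_j
     without leaving D. *)
  have Dy : D (x + (- (r / 2) * Num.sg (u j 0 i)) *: unit_vec R i).
    apply: hr; rewrite addrC addKr normrZ norm_unit_vec mulr1 normrM normrN normr_sg ui mulr1.
    rewrite ger0_norm; lra.
  have := Dy j; rewrite affDu -mulrA -normrEsg.
  have : 0 < r / 2 * `|u j 0 i| by rewrite mulr_gt0 ?normr_gt0// divr_gt0.
  lra.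
have H j : \forall y \near x, 0 < L j y.
  by have := cont_aff (a := u j) (b := c j) (x := x); move=> /cvgr_gt; apply.
have := @filter_forall _ _ _ (nbhs x) (nbhs_filter x) H.
by apply: filterS => y hy j; exact/ltW.
Qed.

Lemma polytope_convex x y (t : R) : D x -> D y -> 0 <= t <= 1 -> D (x + t *: (y - x)).
Proof.
by move=> Dx Dy /andP[t0 t1] j; rewrite aff_seg addr_ge0// mulr_ge0 ?subr_ge0//.
Qed.

Variable x0 : 'rV[R]_m.
Hypothesis ix0 : interior D x0.

Lemma interior_seg x (t : R) : D x -> 0 <= t < 1 -> interior D (x0 + t *: (x - x0)).
Proof.
move=> Dx /andP[t0 t1]; apply/interior_polytope => j; rewrite aff_seg.
rewrite ltr_wpDr ?mulr_ge0//.
by rewrite mulr_gt0 ?subr_gt0//; move/interior_polytope: ix0; exact.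
Qed.

Lemma cvg_seg x : x0 + (1 - n.+1%:R^-1) *: (x - x0) @[n --> \oo] --> x.
Proof.
apply/ccvgP; rewrite -[X in ccvg _ X](subrKC x0) -[x - x0 in X in ccvg _ X]scale1r.
apply: ccvgD; first exact: ccvg_cst.
apply: ccvgZ; last exact: ccvg_cst.
rewrite -[X in _ --> X]subr0; apply: cvgB; [exact: cvg_cst|exact: cvg_natinv].
Qed.

(** Each point of D is the limit of interior points on its segment to [x0]. This carries identities
    for the inverse Hessian from the interior to the boundary. *)
Lemma le_interior_closure g h : (forall x, D x -> {for x, continuous g}) ->
  (forall x, D x -> {for x, continuous h}) -> (forall x, interior D x -> g x <= h x) ->
  forall x, D x -> g x <= h x.
Proof.
move=> cg ch gh x Dx.
apply: (ler_cvg_to (cvg_comp _ _ (cvg_seg (x := x)) (cg x Dx)) (cvg_comp _ _ (cvg_seg (x := x)) (ch x Dx))).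
apply: nearW => n /=; apply: gh; apply: interior_seg => //.
by rewrite subr_ge0 invf_le1// ler1n/= ltrBlDr ltrDl invr_gt0.
Qed.

Lemma eq_interior_closure g h : (forall x, D x -> {for x, continuous g}) ->
  (forall x, D x -> {for x, continuous h}) -> (forall x, interior D x -> g x = h x) ->
  forall x, D x -> g x = h x.
Proof.
move=> cg ch gh x Dx; apply/eqP; rewrite eq_le.
by rewrite !le_interior_closure// => y iy; rewrite gh.
Qed.

End PolytopeGeometry.

(** * Rules for partial derivatives *)

Section PdAlgebra.
Variables (R : realType) (m : nat) (U : set 'rV[R]_m).
Implicit Types (f g : 'rV[R]_m -> R) (x : 'rV[R]_m).

Lemma pd_val f (l : R) x i : is_derive x (unit_vec R i) f l -> pd i f x = l.
Proof. by case. Qed.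

Lemma pdM f g x i : Cn 1 U f -> Cn 1 U g -> U x ->
  pd i (fun y => f y * g y) x = pd i f x * g x + f x * pd i g x.
Proof.
move=> hf hg Ux; apply: pd_val.
have := is_deriveM (Cn_is_derive i hf Ux) (Cn_is_derive i hg Ux).
by congr (is_derive _ _ _ _); rewrite /GRing.scale /= addrC mulrC.
Qed.

Lemma pdB f g x i : Cn 1 U f -> Cn 1 U g -> U x ->
  pd i (fun y => f y - g y) x = pd i f x - pd i g x.
Proof.
by move=> hf hg Ux; apply: pd_val; exact: is_deriveB (Cn_is_derive i hf Ux) (Cn_is_derive i hg Ux).
Qed.

Lemma pd_sum n (f : 'I_n -> 'rV[R]_m -> R) x i : (forall j, Cn 1 U (f j)) -> U x ->
  pd i (fun y => \sum_j f j y) x = \sum_j pd i (f j) x.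
Proof.
move=> hf Ux; apply: pd_val.
have := is_derive_sum (fun j => Cn_is_derive i (hf j) Ux).
by congr (is_derive _ _ _ _); apply/funext => y; rewrite fct_sumE.
Qed.

Lemma pdZ (a : R) f x i : open U -> Cn 1 U f -> U x -> pd i (fun y => a * f y) x = a * pd i f x.
Proof.
move=> oU hf Ux; rewrite pdM//; last exact: Cn_cst.
by rewrite /pd derive_cst mul0r add0r.
Qed.

Lemma Cn_B n f g : open U -> Cn n U f -> Cn n U g -> Cn n U (fun x => f x - g x).
Proof.
move=> oU hf hg; apply: Cn_eq (Cn_D oU hf (Cn_M oU (Cn_cst n (-1) oU) hg)) => // y _.
by rewrite mulN1r.
Qed.

End PdAlgebra.

(** * The energy inequality from the Abreu equation *)

Lemma cont_X (R : realType) (T : topologicalType) (g : T -> R) n x :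
  {for x, continuous g} -> {for x, continuous (fun y => g y ^+ n)}.
Proof.
move=> cg; elim: n => [|n IH]; first exact: (@cont_cst R T 1 x).
rewrite (_ : (fun y => _) = fun y => g y * g y ^+ n); first exact: cont_M.
by apply/funext => y; rewrite exprS.
Qed.

Section Controls.
Variables (R : realType) (m d : nat) (u : 'I_d -> 'rV[R]_m) (c : 'I_d -> R) (x0 : 'rV[R]_m).
Local Notation D := (polytope u c).

(** The class on which the energy estimate can be run: the divergence inequality needs regularity up
    to the boundary, which the dilations of a general test function possess. *)
Definition admissible (w : 'rV[R]_m -> R) : Prop := exists U, [/\ open U, D `<=` U, Cn 2 U w,
  convex_on D w & w x0 = 0 /\ forall x, D x -> 0 <= w x].

(** The only property of the Futaki functional that the interior estimates use. The constant depends
    on the depth [a] and the length bound [r], but not on the cutoff, the direction or the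
    function. *)
Definition controls_hessian (F : ('rV[R]_m -> R) -> R) : Prop :=
  forall a r : R, 0 < a -> 0 <= r -> exists2 K : R, 0 < K &
  forall (kappa w : 'rV[R]_m -> R) (e : 'rV[R]_m), continuous kappa -> (forall x, 0 <= kappa x <= 1) ->
  (forall x, (exists j, aff (u j) (c j) x < a) -> kappa x = 0) -> `|e| <= r -> admissible w ->
  int_on D (fun x => kappa x * hess_form w x e) <= K * F w.

End Controls.

(** * The weighted inverse Hessian and its boundary behaviour *)

Section AbreuData.
Variables (R : realType) (m d : nat) (u : 'I_d -> 'rV[R]_m) (c : 'I_d -> R) (f s v : 'rV[R]_m -> R).
Variables (W : set 'rV[R]_m) (Hb : 'rV[R]_m -> 'M[R]_m) (x0 : 'rV[R]_m).
Local Notation L j := (aff (u j) (c j)).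
Local Notation D := (polytope u c).
Hypotheses (cD : compact D) (u0 : forall j, u j != 0).
Hypothesis genuine : forall j, exists x, D x /\ L j x = 0 /\ forall k, k != j -> 0 < L k x.
Hypotheses (af : affine_fun f) (fpos : forall x, D x -> 0 < f x) (asf : affine_fun s).
Hypotheses (ix0 : interior D x0) (smv : smooth_on (interior D) v).
Hypothesis Hunit : forall x, interior D x -> hessian v x \in unitmx.
Hypotheses (oW : open W) (DW : D `<=` W).
Hypothesis smH : forall i j, smooth_on W (fun x => Hb x i j).
Hypothesis HbE : forall x, interior D x -> Hb x = Hinv v x.
Hypothesis bdryH : forall j xi, facet u c j xi -> u j *m Hb xi = 0 /\
  forall i, 'D_(unit_vec R i) (fun x => (u j *m Hb x *m (u j)^T) 0 0) xi = 2 * u j 0 i.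
Hypothesis posH : forall (J : {set 'I_d}) xi, face_of u c J !=set0 -> face_rel_interior u c J xi ->
  forall w : 'rV[R]_m, ~~ (w <= tF u c J)%MS -> 0 < (w *m Hb xi *m w^T) 0 0.
Hypothesis abreu : forall x, interior D x -> - (f x ^+ (2 * m + 1)) *
  (\sum_(i < m) \sum_(j < m) dpart [:: i; j] (fun y => f y ^- (2 * m - 1) * Hinv v y i j) x) = s x.
Implicit Types (x y e z : 'rV[R]_m).

(** [weight] is f^(1-2m), so [mom] is the matrix G, with [Hb] replacing the inverse Hessian so that
    it extends past the boundary; [wdom] is a neighbourhood of the polytope on which everything is
    smooth. *)
Definition weight x : R := f x ^- (2 * m - 1).
Definition mom i j x : R := weight x * Hb x i j.
Definition dmom i x : R := \sum_j pd j (mom i j) x.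
Definition wdom : set 'rV[R]_m := W `&` [set x | 0 < f x].

Lemma affine_fun_cont g x : affine_fun g -> {for x, continuous (g : 'rV[R]_m -> R)}.
Proof. by move=> [a [b /funext ->]]; exact: cont_aff. Qed.

Lemma open_wdom : open wdom.
Proof.
apply: openI => //; apply: (open_comp (f := f) (D := [set t | 0 < t])); last exact: open_gt.
by move=> x _; exact: affine_fun_cont.
Qed.

Lemma sub_wdom : D `<=` wdom.
Proof. by move=> x Dx; split; [exact: DW|exact: fpos]. Qed.

Lemma Cn_fV n k : Cn n wdom (fun x => f x ^- k).
Proof.
apply: Cn_V; first exact: open_wdom.
  by move=> x [_ fx]; rewrite expf_neq0// gt_eqF.
apply: Cn_X; first exact: open_wdom.
by have [a [b /funext ->]] := af; apply: Cn_aff; exact: open_wdom.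
Qed.

Lemma Cn_Hb n i j : Cn n W (fun x => Hb x i j).
Proof. exact: smooth_Cn. Qed.

Lemma Cn_mom n i j : Cn n wdom (mom i j).
Proof.
apply: Cn_M; [exact: open_wdom|exact: Cn_fV|].
by apply: Cn_sub (Cn_Hb n i j) => x [].
Qed.

Lemma Cn_dmom n i : Cn n wdom (dmom i).
Proof.
by apply: Cn_sum; [exact: open_wdom|move=> j; exact: (Cn_pd j (Cn_mom n.+1 i j))].
Qed.

Lemma wdom_cont g x : Cn 0 wdom g -> D x -> {for x, continuous g}.
Proof. by move=> hg /sub_wdom Dx; exact: Cn_cont hg Dx. Qed.

Lemma Hb_cont i j x : D x -> {for x, continuous (fun y => Hb y i j)}.
Proof. by move=> /DW Wx; exact: (Cn_cont (Cn_Hb 0 i j) Wx). Qed.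

Lemma hessian_sym (U : set 'rV[R]_m) g x : open U -> Cn 2 U g -> U x -> (hessian g x)^T = hessian g x.
Proof. by move=> oU hg Ux; apply/matrixP => i j; rewrite !mxE /=; exact: schwarz hg Ux. Qed.

(** In the interior this is the inverse of a Hessian, symmetric by [schwarz]; continuity extends the
    symmetry to the facets. *)
Lemma Hb_sym x : D x -> (Hb x)^T = Hb x.
Proof.
move=> Dx; apply/matrixP => i j; rewrite mxE.
apply: (eq_interior_closure u0 ix0 (g := fun y => Hb y j i) (h := fun y => Hb y i j)) => //.
- by move=> y; exact: Hb_cont.
- by move=> y; exact: Hb_cont.
move=> y iy; rewrite -[LHS](mxE trmx_key (fun i j => Hb y j i)) -/(trmx _).
by rewrite HbE// /Hinv trmx_inv (hessian_sym (@open_interior _ _) (smooth_Cn 2 smv) iy).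
Qed.

Lemma Hb_psd x : D x -> psd (Hb x).
Proof.
move=> Dx w.
apply: (le_interior_closure u0 ix0 (g := fun=> 0) (h := fun y => qform (Hb y) w w)) => //.
- by move=> y _; exact: cont_cst.
- move=> y Dy; rewrite (_ : (fun y => _) = fun y => \sum_i \sum_j w 0 i * w 0 j * Hb y i j).
    apply: continuous_at_sum => i; apply: continuous_at_sum => j.
    by apply: cont_M; [exact: cont_cst|exact: Hb_cont].
  by apply/funext => z; rewrite qformE.
move=> y iy; have [->|w0] := eqVneq w 0; first by rewrite /qform !mul0mx mxE.
(* The empty index set designates the whole polytope as a face. No facet contains an interior point,
   so the span of normals to be avoided is zero. *)
apply/ltW/(posH (J := finset.set0)).
- by exists y; split; [exact: interior_subset|move=> j; rewrite inE].
- split; first by split; [exact: interior_subset|move=> j; rewrite inE].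
  by move=> k _; move/(interior_polytope _ u0): iy; exact.
- have tz : tF u c finset.set0 = 0; last first.
    by rewrite tz; apply/negP => /submx0null; apply/eqP.
  apply/matrixP => k i; rewrite !mxE /face_in_facet; case: asboolP => [h|_]; last by rewrite mxE.
  have [] := h y; first by split; [exact: interior_subset|move=> j; rewrite inE].
  by move=> _ E; move/(interior_polytope _ u0): iy => /(_ k); rewrite E ltxx.
Qed.

Lemma mom_sym i j x : D x -> mom i j x = mom j i x.
Proof. by move=> Dx; rewrite /mom -{1}(Hb_sym Dx) mxE. Qed.

Lemma mom_null k x j : facet u c k x -> \sum_i u k 0 i * mom j i x = 0.
Proof.
move=> fx; have [/rowP h _] := bdryH fx; have := h j; rewrite !mxE => {}h.
transitivity (weight x * \sum_i u k 0 i * Hb x i j); last by rewrite h mulr0.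
rewrite mulr_sumr; apply: eq_bigr => i _; rewrite /mom.
by rewrite -{1}(Hb_sym fx.1) mxE mulrCA.
Qed.

(* g vanishes on the segments joining x to the points of the facet near its relative interior point q,
   and these span the hyperplane of the facet. *)
Lemma facet_gradient k (U : set 'rV[R]_m) (g : 'rV[R]_m -> R) x :
  open U -> D `<=` U -> Cn 1 U g -> (forall y, facet u c k y -> g y = 0) -> facet u c k x ->
  exists a : R, forall i, pd i g x = a * u k 0 i.
Proof.
move=> oU DU hg g0 fx; have [q [Dq [Lq hq]]] := genuine k.
have dir0 y : facet u c k y -> \sum_i (y - x) 0 i * pd i g x = 0.
  move=> fy.
  have hd := chain_rule (y - x) oU hg (DU _ fx.1).
  have n0 (n : nat) : n.+1%:R^-1 != 0 :> R by rewrite invr_eq0 pnatr_eq0.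
  have h := is_derive_seq n0 (@cvg_natinv R) hd.
  have z : (fun n : nat => (n.+1%:R^-1)^-1 * (g (x + n.+1%:R^-1 *: (y - x)) - g x)) @ \oo --> (0 : R).
    apply: cvg_near_cst; apply: nearW => n.
    rewrite !g0 ?subrr ?mulr0//; split; last first.
      by rewrite aff_seg fx.2 fy.2 !mulr0 addr0.
    apply: polytope_convex; [exact: fx.1|exact: fy.1|].
    by rewrite invr_ge0 ler0n invf_le1// ler1n.
  exact: (cvg_unique _ h z).
have tan0 (tau : 'rV[R]_m) : \sum_i u k 0 i * tau 0 i = 0 -> \sum_i tau 0 i * pd i g x = 0.
  move=> ht.
  (* Only L_k vanishes at [q], so a short tangential step stays on the facet. The difference of the
     two segment directions is a multiple of [tau]. *)
  have [t t0 Dt] : exists2 t : R, 0 < t & D (q + t *: tau).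
    have H l : \forall t \near (0 : R), l != k -> 0 < L l (q + t *: tau).
      have [->|lk] := eqVneq l k; first by apply/nbhs_normP; exists 1 => //= t _; rewrite eqxx.
      have ct : {for (0 : R), continuous (fun t : R => L l (q + t *: tau))}.
        rewrite (_ : (fun t => _) = fun t : R => L l q + t * \sum_i u l 0 i * tau 0 i).
          apply: cont_D; first exact: cont_cst.
          by apply: cont_M; [exact: cvg_id|exact: cont_cst].
        by apply/funext => t; rewrite affDZ.
      have := ct; move=> /cvgr_gt /(_ 0); rewrite scale0r addr0 => /(_ (hq _ lk)).
      by apply: filterS => t ht' _.
    have := @filter_forall _ _ _ (nbhs (0 : R)) (nbhs_filter _) H.
    move=> /nbhs_norm_ex[r r0 hr]; exists (r / 2); first by rewrite divr_gt0.
    move=> l; have [->|lk] := eqVneq l k; first by rewrite affDZ ht mulr0 addr0 Lq.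
    by apply/ltW/(hr (r / 2)) => //; rewrite subr0 gtr0_norm ?divr_gt0//; lra.
  have f1 : facet u c k q by [].
  have f2 : facet u c k (q + t *: tau) by split=> //; rewrite affDZ ht mulr0 addr0.
  have := dir0 _ f2; rewrite (_ : \sum_i _ = \sum_i (q - x) 0 i * pd i g x + t * \sum_i tau 0 i * pd i g x).
    by rewrite dir0// add0r => /eqP; rewrite mulf_eq0 gt_eqF//= => /eqP.
  by rewrite mulr_sumr -big_split; apply: eq_bigr => i _ /=; rewrite !mxE; ring.
have [i0 ui] := row_neq0 (u0 k).
exists (pd i0 g x / u k 0 i0) => i.
have [->|ii] := eqVneq i i0; first by rewrite divfK.
(* Annihilated by [u k]; vanishing of the derivative along it compares the i-th and i0-th partials
   and gives proportionality to [u k]. *)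
pose tau := u k 0 i0 *: unit_vec R i - u k 0 i *: unit_vec R i0.
have tauE l : tau 0 l = u k 0 i0 * (l == i)%:R - u k 0 i * (l == i0)%:R.
  by rewrite /tau mxE [X in X + _]mxE [X in _ + X]mxE [X in _ - X]mxE !unit_vecE.
have sumD (F : 'I_m -> R) : \sum_l tau 0 l * F l = u k 0 i0 * F i - u k 0 i * F i0.
  rewrite (bigD1 i)//= (bigD1 i0)//= 1?eq_sym// big1.
    by rewrite addr0 !tauE !eqxx [i0 == i]eq_sym (negbTE ii) /= mulr1n mulr0n; ring.
  by move=> l /andP[li li0]; rewrite tauE (negbTE li) (negbTE li0) /= !mulr0 subrr mul0r.
have := tan0 tau.
under [in X in X -> _]eq_bigr => l _ do rewrite mulrC.
rewrite !sumD => /(_ _)/eqP; rewrite subr_eq0 => h.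
have {}h := eqP (h _).
by apply: (mulfI ui); rewrite h; field.
Qed.

(** The components [n j] of u_k H vanish on the facet, so their gradients there are multiples [a j]
    of u_k. The normalization of d(H(u_k,u_k)) says that the sum of the [a j] weighted by u_k is 2,
    and this sum is the divergence sought; the derivative of the weight multiplies [n j], which is
    zero. *)
Lemma facet_flux k x : facet u c k x -> \sum_i u k 0 i * dmom i x = 2 * weight x.
Proof.
move=> fx; have Dx := fx.1; have Wx := DW Dx.
pose n j y := \sum_i u k 0 i * Hb y i j.
have nE y j : n j y = (u k *m Hb y) 0 j by rewrite /n mxE.
have Cn_n j : Cn 1 W (n j).
  by apply: Cn_sum => // i; apply: Cn_M => //; [exact: Cn_cst|exact: Cn_Hb].
have n0 j y : facet u c k y -> n j y = 0.
  by move=> fy; rewrite nE (bdryH fy).1 mxE.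
have [a ha] := choice (fun j => facet_gradient oW DW (Cn_n j) (n0 j) fx).
have [i0 ui] := row_neq0 (u0 k).
have aE : \sum_j a j * u k 0 j = 2.
  have h := (bdryH fx).2 i0; apply: (mulIf ui); rewrite -h mulr_suml.
  rewrite -/(pd i0 _ x) (_ : (fun y => _) = fun y => \sum_j u k 0 j * n j y).
    rewrite (pd_sum (U := W))//; last by move=> j; apply: Cn_M => //; exact: Cn_cst.
    by apply: eq_bigr => j _; rewrite (pdZ (U := W))// ha; ring.
  by apply/funext => y; rewrite mxE; apply: eq_bigr => j _; rewrite nE mulrC; congr (_ * _); rewrite mxE.
have wC : Cn 1 wdom weight := Cn_fV 1 _.
have HC i j : Cn 1 wdom (fun y => Hb y i j) by apply: Cn_sub (Cn_Hb 1 i j) => y [].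
rewrite -aE mulrC mulr_sumr /dmom.
under eq_bigr => i _ do rewrite mulr_sumr.
rewrite exchange_big /=; apply: eq_bigr => j _.
transitivity (pd j weight x * n j x + weight x * pd j (n j) x); last first.
  by rewrite n0// mulr0 add0r ha.
rewrite (pd_sum (U := W))//; last by move=> i; apply: Cn_M => //; [exact: Cn_cst|exact: Cn_Hb].
rewrite /n !mulr_sumr -big_split; apply: eq_bigr => i _ /=.
rewrite [pd j (mom i j) x](pdM (U := wdom))//; last exact: sub_wdom.
by rewrite (pdZ (U := W))//; [ring|exact: Cn_Hb].
Qed.

(** The Abreu equation, carried to the boundary by continuity. *)
Lemma div_mom x : D x -> \sum_i pd i (dmom i) x = - (s x * f x ^- (2 * m + 1)).
Proof.
move: x; apply: (eq_interior_closure u0 ix0).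
- move=> x Dx; apply: continuous_at_sum => i.
  exact: wdom_cont (Cn_pd i (Cn_dmom 1 i)) Dx.
- move=> x Dx; apply: cont_N; apply: cont_M; first exact: affine_fun_cont.
  exact: wdom_cont (Cn_fV 0 _) Dx.
move=> x ix; rewrite -abreu//.
have fx : f x != 0 by rewrite gt_eqF// fpos//; exact: interior_subset.
rewrite !mulNr opprK mulrAC mulfV ?expf_neq0// mul1r.
apply: eq_bigr => i _; rewrite /dmom (pd_sum (U := wdom)).
- apply: eq_bigr => j _ /=; apply: (pd_eq _ (@open_interior _ D) ix) => y iy.
  apply: (pd_eq _ (@open_interior _ D) iy) => z iz; by rewrite /mom HbE.
- by move=> j; exact: Cn_pd (Cn_mom 2 i j).
- by apply: sub_wdom; exact: interior_subset.
Qed.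

Lemma energy_le (U : set 'rV[R]_m) w : open U -> D `<=` U -> Cn 2 U w -> (forall x, D x -> 0 <= w x) ->
  int_on D (fun x => \sum_i \sum_j mom j i x * pd i (pd j w) x) <= futaki u c f s w.
Proof.
move=> oU DU hw w0.
pose V := U `&` wdom.
have oV : open V by apply: openI => //; exact: open_wdom.
have DV : D `<=` V by move=> x Dx; split; [exact: DU|exact: sub_wdom].
have hw2 : Cn 2 V w by apply: Cn_sub hw => x [].
have hm n i j : Cn n V (mom i j) by apply: Cn_sub (Cn_mom n i j) => x [].
have hd n i : Cn n V (dmom i) by apply: Cn_sub (Cn_dmom n i) => x [].
(* With the index order [mom j i], the sum over i of [pd i (mom j i)] is literally [dmom j], so the
   first-order terms of the divergence cancel. *)
pose Y i x := \sum_j mom j i x * pd j w x - w x * dmom i x.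
have hY1 i : Cn 1 V (fun x => \sum_j mom j i x * pd j w x).
  by apply: Cn_sum => // j; apply: Cn_M => //; exact: Cn_pd.
have hY2 i : Cn 1 V (fun x => w x * dmom i x) by apply: Cn_M => //; exact: Cn_W.
have hY i : Cn 1 V (Y i) by exact: Cn_B.
have := divergence_le cD (Y := Y) (dY := fun i => pd i (Y i)) u0.
have -> : int_on D (fun x => \sum_i pd i (Y i) x) =
    int_on D (fun x => \sum_i \sum_j mom j i x * pd i (pd j w) x + s x * w x * f x ^- (2 * m + 1)).
  apply: int_on_eq => x Dx; have Vx := DV _ Dx.
  transitivity (\sum_i (\sum_j (pd i (mom j i) x * pd j w x + mom j i x * pd i (pd j w) x)
      - (pd i w x * dmom i x + w x * pd i (dmom i) x))).
    apply: eq_bigr => i _; rewrite (pdB (U := V))// (pd_sum (U := V))//.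
      rewrite (pdM (U := V) (f := w))//; last exact: Cn_W.
      congr (_ - _); apply: eq_bigr => j _; rewrite (pdM (U := V))//; exact: Cn_pd.
    by move=> j; apply: Cn_M => //; exact: Cn_pd.
  rewrite sumrB [X in _ - X]big_split /= -mulr_sumr div_mom//.
  under eq_bigr => i _ do rewrite big_split /=.
  rewrite big_split /= exchange_big /=.
  have -> : \sum_j \sum_i pd i (mom j i) x * pd j w x = \sum_i pd i w x * dmom i x.
    by apply: eq_bigr => j _; rewrite /dmom mulr_sumr; apply: eq_bigr => i _; rewrite mulrC.
  by ring.
have cw x : D x -> {for x, continuous w} by move=> /DV; exact: Cn_cont hw2.
have cH x : D x -> {for x, continuous (fun x => \sum_i \sum_j mom j i x * pd i (pd j w) x)}.
  move=> /DV Vx; apply: continuous_at_sum => i; apply: continuous_at_sum => j.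
  apply: cont_M; [exact: (Cn_cont (hm 0%N j i) Vx)|exact: (Cn_cont (Cn_pd i (Cn_pd j hw2)) Vx)].
have cs x : D x -> {for x, continuous (fun x => s x * w x * f x ^- (2 * m + 1))}.
  move=> Dx; apply: cont_M; last exact: wdom_cont (Cn_fV 0 _) Dx.
  by apply: cont_M; [exact: affine_fun_cont|exact: cw].
have cwt x : D x -> {for x, continuous (fun x => w x * weight x)}.
  by move=> Dx; apply: cont_M; [exact: cw|exact: wdom_cont (Cn_fV 0 _) Dx].
rewrite int_onD//; [|exact: within_of..].
(* The gradient part is killed by [mom_null] and [facet_flux] evaluates the rest. The result is
   nonpositive, as [divergence_le] demands. *)
have flux k x : facet u c k x -> \sum_i u k 0 i * Y i x = - (2 * (w x * weight x)).
  move=> fx; under eq_bigr => i _ do rewrite mulrBr mulrCA mulr_sumr.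
  rewrite sumrB -mulr_sumr facet_flux// exchange_big /=.
  rewrite big1 ?sub0r; first by congr (- _); ring.
  move=> j _; under eq_bigr => i _ do rewrite mulrA.
  rewrite -mulr_suml.
  rewrite (_ : \sum_i _ = 0) ?mul0r// -[RHS](mom_null j fx).
  by apply: eq_bigr => i _; rewrite (mom_sym j i fx.1).
have -> : \sum_k int_facet u c k (fun x => - \sum_i u k 0 i * Y i x) =
    2 * int_bdry u c (fun x => w x * weight x).
  rewrite /int_bdry mulr_sumr; apply: eq_bigr => k _.
  rewrite -int_facetZ//; last exact: within_of.
  by apply: int_facet_eq => x fx; rewrite flux// opprK.
rewrite /futaki lerBrDr; apply.
- by move=> i x /DV Vx; exact: Cn_is_derive (hY i) Vx.
- by move=> i x /DV Vx; exact: Cn_cont (hY i) Vx.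
- by move=> i x /DV Vx; exact: Cn_cont (Cn_pd i (hY i)) Vx.
move=> k x fx; rewrite flux// oppr_le0 mulr_ge0// mulr_ge0//; first by apply: w0; exact: fx.1.
by rewrite invr_ge0 exprn_ge0// ltW// fpos//; exact: fx.1.
Qed.

Lemma Hb_inv x : interior D x -> hessian v x *m Hb x = 1%:M.
Proof. by move=> ix; rewrite HbE// mulmxV// Hunit. Qed.

Lemma weight_gt0 x : D x -> 0 < weight x.
Proof. by move=> Dx; rewrite invr_gt0 exprn_gt0// fpos. Qed.

(** * Ellipticity away from the boundary *)

Lemma inner_polytope a x : polytope u (fun j => c j - a) x <-> forall j, a <= L j x.
Proof. by split=> h j; have := h j; rewrite /aff addrA subr_ge0. Qed.

Lemma inner_compact a : 0 <= a -> compact (polytope u (fun j => c j - a)).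
Proof.
move=> a0; apply: (subclosed_compact _ cD).
  have cl j : closed [set x | a <= L j x].
    apply: (closed_comp (f := L j) (D := [set t | a <= t])); last exact: closed_ge.
    by move=> x _; exact: cont_aff.
  rewrite (_ : polytope _ _ = \bigcap_(j in setT) [set x | a <= L j x]); first exact: closed_bigI.
  by apply/seteqP; split=> x; [move=> /inner_polytope h j _; exact: h|move=> h; apply/inner_polytope => j; exact: h].
by move=> x /inner_polytope h j; exact: le_trans (h j).
Qed.

(** Lower ellipticity in dual form, ready for [tr_ge_direction]: the solution of zG = e is e times
    the Hessian of [v], divided by the weight, and its pairing with e is bounded because the Hessian
    is continuous on the compact set where all L_j are at least [a]. *)
Lemma inner_elliptic a r : 0 < a -> 0 <= r -> exists2 K : R, 0 < K & forall x e,
  (forall j, a <= L j x) -> `|e| <= r -> exists2 z, z *m (weight x *: Hb x) = e & (e *m z^T) 0 0 <= K.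
Proof.
move=> a0 r0.
pose h x := f x ^+ (2 * m - 1) * (\sum_i \sum_j r * r * `|pd i (pd j v) x|).
have inI x : polytope u (fun j => c j - a) x -> interior D x.
  by move=> /inner_polytope hx; apply/(interior_polytope _ u0) => j; exact: lt_le_trans (hx j).
have ch x : polytope u (fun j => c j - a) x -> {for x, continuous h}.
  move=> /inI ix; apply: cont_M.
    by apply: cont_X; exact: affine_fun_cont.
  apply: continuous_at_sum => i; apply: continuous_at_sum => j; apply: cont_M; first exact: cont_cst.
  exact: (cvg_norm (Cn_cont (Cn_pd i (Cn_pd j (smooth_Cn 2 smv))) ix)).
have [K K0 hK] := within_bounded (inner_compact (ltW a0)) (within_of ch).
exists K => // x e hx he.
have ix : interior D x by apply/inI/inner_polytope.
have wx := weight_gt0 (interior_subset ix).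
exists ((weight x)^-1 *: (e *m hessian v x)).
  by rewrite -scalemxAr -scalemxAl scalerA mulfV ?gt_eqF// scale1r -mulmxA Hb_inv// mulmx1.
have := hK x; rewrite inner_polytope => /(_ hx); apply: le_trans; apply: le_trans (ler_norm _).
rewrite linearZ /= -scalemxAr mxE /h /weight invrK.
apply: ler_wpM2l; first by rewrite exprn_ge0// ltW// fpos//; exact: interior_subset.
rewrite trmx_mul (hessian_sym (@open_interior _ _) (smooth_Cn 2 smv) ix) mulmxA.
have := qformE (hessian v x) e e; rewrite /qform => ->.
apply: ler_sum => i _; apply: ler_sum => j _; rewrite mxE /=.
apply: le_trans (ler_norm _) _; rewrite normrM normrM.
apply: ler_wpM2r => //; apply: ler_pM => //; exact: le_trans (coord_le_norm _ _) he.
Qed.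

Lemma hess_form_qform g x e : hess_form g x e = qform (hessian g x) e e.
Proof.
by rewrite qformE; apply: eq_bigr => i _; apply: eq_bigr => j _; rewrite mxE.
Qed.

Lemma hess_form_cont (U : set 'rV[R]_m) w e x : Cn 2 U w -> U x -> {for x, continuous (hess_form w ^~ e)}.
Proof.
move=> hw Ux; apply: continuous_at_sum => i; apply: continuous_at_sum => j.
by apply: cont_M; [exact: cont_cst|exact: (Cn_cont (Cn_pd i (Cn_pd j hw)) Ux)].
Qed.

Lemma admissible_hess_ge0 (U : set 'rV[R]_m) w e x : open U -> D `<=` U -> Cn 2 U w -> convex_on D w ->
  D x -> 0 <= hess_form w x e.
Proof.
move=> oU DU hw cw; apply: (le_interior_closure u0 ix0 (g := fun=> 0) (h := fun y => hess_form w y e)).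
- by move=> y _; exact: cont_cst.
- by move=> y /DU; exact: hess_form_cont.
move=> y iy; have hi : Cn 2 (interior D) w by apply: Cn_sub hw => z /interior_subset /DU.
exact: (hess_form_ge0 e (@open_interior _ D) hi iy (@interior_subset _ D) cw).
Qed.

(** A pointwise comparison integrated with [energy_le]: at depth below [a] the cutoff is zero and
    the trace of G with the Hessian of w is nonnegative, elsewhere [tr_ge_direction] applies. *)
Lemma energy_direction : controls_hessian u c x0 (futaki u c f s).
Proof.
move=> a r a0 r0; have [K K0 hK] := inner_elliptic a0 r0; exists K => // kappa w e ck k01 ka he.
move=> [U [oU DU hw cw [_ w0]]].
have h0 x : D x -> 0 <= hess_form w x e by exact: admissible_hess_ge0 hw cw.
have chf x : D x -> {for x, continuous (hess_form w ^~ e)} by move=> /DU; exact: hess_form_cont.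
have cH x : D x -> {for x, continuous (fun x => \sum_i \sum_j mom j i x * pd i (pd j w) x)}.
  move=> Dx; apply: continuous_at_sum => i; apply: continuous_at_sum => j.
  apply: cont_M; first exact: wdom_cont (Cn_mom 0 j i) Dx.
  exact: (Cn_cont (Cn_pd i (Cn_pd j hw)) (DU _ Dx)).
apply: (@le_trans _ _ (K * int_on D (fun x => \sum_i \sum_j mom j i x * pd i (pd j w) x))); last first.
  by apply: ler_wpM2l; [exact: ltW|exact: energy_le hw w0].
rewrite -int_onZ//; last exact: within_of.
apply: int_on_le => //.
- by apply: within_of => x Dx; apply: cont_M; [exact: ck|exact: chf].
- by apply: within_of => x Dx; apply: cont_M; [exact: cont_cst|exact: cH].
move=> x Dx; set G := weight x *: Hb x.
have -> : \sum_i \sum_j mom j i x * pd i (pd j w) x = \tr (G *m hessian w x).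
  rewrite exchange_big; apply: eq_bigr => i _; rewrite mxE; apply: eq_bigr => j _.
  by rewrite !mxE.
have sG : G^T = G by rewrite linearZ /= Hb_sym.
have pG : psd G by move=> z; rewrite qformZ mulr_ge0 ?Hb_psd// ltW// weight_gt0.
have sW := hessian_sym oU hw (DU _ Dx).
have pW : psd (hessian w x) by move=> z; rewrite -hess_form_qform; exact: admissible_hess_ge0 hw cw Dx.
have [[j Lj]|hx] := pselect (exists j, L j x < a).
  by rewrite ka ?mul0r; [apply: mulr_ge0; [exact: ltW|exact: tr_psd_ge0]|exists j].
have [|z zG hz] := hK x e _ he.
  by move=> j; rewrite leNgt; apply/negP => Lj; apply: hx; exists j.
have /andP[k0 k1] := k01 x.
apply: (@le_trans _ _ (hess_form w x e)); first by rewrite ler_piMl// h0.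
rewrite hess_form_qform -ler_pdivrMl//.
exact: tr_ge_direction sG pG sW pW zG K0 hz.
Qed.

End AbreuData.

(** * Interior estimates *)

Section Mollifier.
Variable R : realType.

Lemma iint_opp m M (g : 'rV[R]_m -> R) : scont g -> bdd_supp M g -> iint (fun x => g (- x)) = iint g.
Proof.
elim: m M g => [|m IH] M g sg bg.
  by congr iint; apply/funext => x; congr g; apply/rowP => -[].
rewrite !iintS; have [mg bg'] := iint_slice_reg sg bg.
rewrite -(integ1_opp mg bg'); congr integ1; apply/funext => t.
rewrite -(IH M (slice g (- t))); [|exact: slice_scont sg|exact: slice_bdd bg].
congr iint; apply/funext => y; rewrite /slice; congr g.
apply/rowP => i; case: (unliftP ord0 i) => [j|] ->.
  by rewrite mxE !row_consS !mxE.
by rewrite mxE !row_cons0.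
Qed.

(** Symmetrized so that the product kernel [moll] is even: a convex function averaged against an
    even kernel dominates its value at the centre. *)
Definition tent (h t : R) : R := 2^-1 * (trap 0 (h^-1 * t) + trap 0 (h^-1 * - t)).

Lemma tent_cvg h (v : nat -> R) x : v k @[k --> \oo] --> x -> tent h (v k) @[k --> \oo] --> tent h x.
Proof.
move=> vx; apply: cvgM; first exact: cvg_cst.
apply: cvgD; apply: trap_cvg; apply: cvgM; try exact: cvg_cst; first exact: vx.
exact: cvgN.
Qed.

Lemma tentN h t : tent h (- t) = tent h t.
Proof. by rewrite /tent opprK addrC. Qed.

Lemma tent_ge0 h t : 0 <= tent h t.
Proof. by rewrite /tent mulr_ge0// ?invr_ge0// addr_ge0// trap_ge0. Qed.

Lemma tent_le1 h t : tent h t <= 1.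
Proof.
rewrite /tent; have := trap_le1 0 (h^-1 * t); have := trap_le1 0 (h^-1 * - t); lra.
Qed.

Lemma tent_out h t : 0 < h -> 2 * h < `|t| -> tent h t = 0.
Proof.
move=> h0 ht.
have H (z : R) : 2 * h < `|z| -> trap 0 (h^-1 * z) = 0.
  move=> hz; apply: (trap_bdd 0 _).2.
  by rewrite normrM ger0_norm ?invr_ge0 ?ltW// mulrC ltr_pdivlMr.
by rewrite /tent !H ?normrN// addr0 mulr0.
Qed.

Lemma tent_measurable h : measurable_fun setT (tent h).
Proof. by apply: measurable_scont1 => v x; exact: tent_cvg. Qed.

Lemma tent_bdd h : 0 < h -> bdd_supp (1 + 2 * h) (tent h).
Proof.
move=> h0 t; split; last by move=> ht; apply: tent_out => //; apply: le_lt_trans ht; rewrite lerDr.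
by rewrite ger0_norm ?tent_ge0//; have := tent_le1 h t; lra.
Qed.

Lemma integ1_tent_gt0 h : 0 < h -> 0 < integ1 (tent h).
Proof.
move=> h0; have hV : 0 < h^-1 by rewrite invr_gt0.
have mt : measurable_fun setT (fun t : R => 2^-1 * trap 0 (h^-1 * t)).
  apply: measurable_scont1 => v x vx; apply: cvgM; first exact: cvg_cst.
  by apply: trap_cvg; apply: cvgM => //; exact: cvg_cst.
have bt : bdd_supp (1 + 2 * h) (fun t : R => 2^-1 * trap 0 (h^-1 * t)).
  move=> t; split.
    rewrite ger0_norm; last by rewrite mulr_ge0 ?invr_ge0 ?trap_ge0.
    by have := trap_le1 0 (h^-1 * t); have := trap_ge0 0 (h^-1 * t); lra.
  move=> ht; rewrite (trap_bdd 0 _).2 ?mulr0// normrM ger0_norm ?ltW// mulrC ltr_pdivlMr//.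
  by apply: le_lt_trans ht; rewrite lerDr.
have mt' := @trap_measurable R 0; have bt' := @trap_bdd R 0.
apply: (@lt_le_trans _ _ (integ1 (fun t : R => 2^-1 * trap 0 (h^-1 * t)))); last first.
  apply: (integ1_le mt bt (@tent_measurable h) (tent_bdd h0)) => t.
  by apply: ler_wpM2l; rewrite ?invr_ge0// lerDl trap_ge0.
have E := integ1_scale hV mt' bt'.
have E2 : 2 * integ1 (fun t : R => 2^-1 * trap 0 (h^-1 * t)) = integ1 (fun t : R => trap 0 (h^-1 * t)).
  by rewrite -(integ1Z 2 mt bt); congr integ1; apply/funext => t; rewrite mulVKf.
have : 0 < 2 * integ1 (fun t : R => 2^-1 * trap 0 (h^-1 * t)).
  by rewrite E2 -(pmulr_rgt0 _ hV) E integ1_trap_gt0.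
by rewrite pmulr_rgt0.
Qed.

Definition moll m (h : R) (x : 'rV[R]_m) : R := \prod_i tent h (x 0 i).

Lemma moll_scont m h : scont (@moll m h).
Proof.
move=> v x vx; apply: cvg_big => //; first exact: mul_continuous.
by move=> i _; apply: tent_cvg; exact: vx.
Qed.

Lemma mollN m h (x : 'rV[R]_m) : moll h (- x) = moll h x.
Proof. by apply: eq_bigr => i _; rewrite mxE tentN. Qed.

Lemma moll_ge0 m h (x : 'rV[R]_m) : 0 <= moll h x.
Proof. by apply: prodr_ge0 => i _; exact: tent_ge0. Qed.

Lemma moll_le1 m h (x : 'rV[R]_m) : moll h x <= 1.
Proof. by apply: prodr_ile1 => i _; rewrite tent_ge0 tent_le1. Qed.

Lemma moll_out m h (x : 'rV[R]_m) : 0 < h -> 2 * h < `|x| -> moll h x = 0.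
Proof.
move=> h0 hx.
have [i hi] : exists i, 2 * h < `|x 0 i|.
  apply: contrapT => /forallNP H; move: hx; rewrite ltNge => /negP; apply.
  by apply: norm_leP => [|i]; [rewrite mulr_ge0// ltW|rewrite leNgt; exact/negP/H].
by rewrite /moll (bigD1 i)//= tent_out// mul0r.
Qed.

Lemma moll_bdd m h : 0 < h -> bdd_supp (1 + 2 * h) (@moll m h).
Proof.
move=> h0 x; split; last by move=> hx; apply: moll_out => //; apply: le_lt_trans hx; rewrite lerDr.
by rewrite ger0_norm ?moll_ge0//; have := moll_le1 h x; lra.
Qed.

Lemma iint_moll m h : 0 < h -> iint (@moll m h) = integ1 (tent h) ^+ m.
Proof.
move=> h0; elim: m => [|m IH]; first by rewrite /= /moll big_ord0.
rewrite iintS exprS mulrC -(integ1Z _ (@tent_measurable h) (tent_bdd h0)); congr integ1.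
apply/funext => t; rewrite mulrC -IH -iintZ; last exact: good_scont (@moll_scont m h) (moll_bdd h0).
congr iint; apply/funext => y; rewrite /slice /moll big_ord_recl row_cons0; congr (_ * _).
by apply: eq_bigr => i _; rewrite row_consS.
Qed.

Lemma iint_moll_gt0 m h : 0 < h -> 0 < iint (@moll m h).
Proof. by move=> h0; rewrite iint_moll// exprn_gt0// integ1_tent_gt0. Qed.

(** The second difference at s with step 2h is the sum of those with step h at s+h, at s (twice) and
    at s-h, so each halving of the step costs a factor 4. *)
Lemma doubling (g : R -> R) n (B : R) :
  (forall s, `|s| + 2 ^- n <= 1 -> g (s + 2 ^- n) + g (s - 2 ^- n) - 2 * g s <= B) ->
  g 1 + g (- 1) - 2 * g 0 <= 4 ^+ n * B.
Proof.
elim: n B => [|n IH] B hB.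
  by have := hB 0; rewrite expr0 invr1 normr0 !add0r mul1r; apply.
rewrite exprSr -mulrA; apply: IH => s hs.
pose h : R := 2 ^- n.+1.
have h0 : 0 < h by rewrite invr_gt0 exprn_gt0.
have E : 2 ^- n = h + h.
  rewrite /h exprS invfM -mulrDl (_ : 2^-1 + 2^-1 = 1 :> R) ?mul1r//; by field.
rewrite E in hs *.
have n1 : `|s + h| + h <= 1 by have := ler_normD s h; rewrite (gtr0_norm h0); lra.
have n2 : `|s - h| + h <= 1 by have := ler_normB s h; rewrite (gtr0_norm h0); lra.
have n3 : `|s| + h <= 1 by lra.
have := hB _ n1; have := hB _ n2; have := hB _ n3; rewrite -/h.
rewrite addrK subrK addrA opprD addrA.
set p := g (s + h); set q := g (s - h); lra.
Qed.

End Mollifier.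

Lemma continuous_at_prod (R : realType) (T : topologicalType) (I : Type) (r : seq I)
  (f : I -> T -> R) x : (forall i, {for x, continuous (f i)}) ->
  {for x, continuous (fun y => \prod_(i <- r) f i y)}.
Proof.
move=> cf; elim: r => [|i r IH].
  by rewrite (_ : (fun y => _) = fun=> 1); [exact: cont_cst|apply/funext => y; rewrite big_nil].
rewrite (_ : (fun y => _) = fun y => f i y * \prod_(i <- r) f i y); first exact: cont_M.
by apply/funext => y; rewrite big_cons.
Qed.

(** * From integrated second derivatives to interior suprema *)

Section Gap.
Variables (R : realType) (m d : nat) (u : 'I_d -> 'rV[R]_m) (c : 'I_d -> R) (x0 : 'rV[R]_m).
Local Notation L j := (aff (u j) (c j)).
Local Notation D := (polytope u c).
Local Notation adm := (admissible u c x0).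
Hypotheses (cD : compact D) (u0 : forall j, u j != 0) (ix0 : interior D x0).
Variable F : ('rV[R]_m -> R) -> R.
Hypothesis energy : controls_hessian u c x0 F.
Implicit Types (x y e q p : 'rV[R]_m) (w : 'rV[R]_m -> R).

(** The zero cutoff in the control hypothesis gives 0 on the left. *)
Lemma energy_ge0 w : adm w -> 0 <= F w.
Proof.
move=> aw; have [K K0 hK] := energy ltr01 ler01.
have := hK (fun=> 0) w 0 (fun x => @cst_continuous _ _ _ x).
rewrite (_ : (fun x => 0 * hess_form w x 0) = fun=> 0); last by apply/funext => x; rewrite mul0r.
rewrite (_ : int_on D (fun=> 0) = 0); last first.
  by rewrite /int_on -[RHS](iint0 R m); congr iint; apply/funext => x; case: ifP.
rewrite pmulr_rge0//; apply => //; [by rewrite lexx ler01|by rewrite normr0 ler01].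
Qed.

Definition clamp (t : R) : R := posX 1 t - posX 1 (t - 1).

Lemma clamp_01 t : 0 <= clamp t <= 1.
Proof.
rewrite /clamp /posX !expr1; have [h1|h1] := leP 0 t; have [h2|h2] := leP 0 (t - 1); apply/andP; split; lra.
Qed.

Lemma clamp0 t : t <= 0 -> clamp t = 0.
Proof.
move=> t0; rewrite /clamp /posX !expr1; have [h1|h1] := leP 0 t; have [h2|h2] := leP 0 (t - 1); lra.
Qed.

Lemma clamp1 t : 1 <= t -> clamp t = 1.
Proof.
move=> t0; rewrite /clamp /posX !expr1; have [h1|h1] := leP 0 t; have [h2|h2] := leP 0 (t - 1); lra.
Qed.

(** Vanishes at depth below [a], as the control hypothesis asks, and equals 1 from depth [2 * a] on,
    where the averaging kernels live. *)
Definition inner_cutoff (a : R) x : R := \prod_j clamp (a^-1 * L j x - 1).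

Lemma inner_cutoff_continuous a : continuous (inner_cutoff a).
Proof.
move=> x; apply: continuous_at_prod => j; have ca : {for x, continuous (fun y => a^-1 * L j y - 1)}.
  by apply: cont_D; [apply: cont_M; [exact: cont_cst|exact: cont_aff]|exact: cont_cst].
have cb : {for x, continuous (fun y => a^-1 * L j y - 1 - 1)} by apply: cont_D; [exact: ca|exact: cont_cst].
have pc (g : 'rV[R]_m -> R) : {for x, continuous g} -> {for x, continuous (fun y => posX 1 (g y))}.
  by move=> cg; exact: (cvg_comp _ _ cg (@posX_continuous R 1 (g x))).
by apply: cont_D; [exact: pc|apply: cont_N; exact: pc].
Qed.

Lemma inner_cutoff_01 a x : 0 <= inner_cutoff a x <= 1.
Proof.
apply/andP; split; first by apply: prodr_ge0 => j _; have /andP[] := clamp_01 (a^-1 * L j x - 1).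
by apply: prodr_ile1 => j _; exact: clamp_01.
Qed.

Lemma inner_cutoff0 a x : 0 < a -> (exists j, L j x < a) -> inner_cutoff a x = 0.
Proof.
move=> a0 [j Lj]; rewrite /inner_cutoff (bigD1 j)//= clamp0 ?mul0r//.
by rewrite subr_le0 mulrC ler_pdivrMr// mul1r ltW.
Qed.

Lemma inner_cutoff1 a x : 0 < a -> (forall j, 2 * a <= L j x) -> inner_cutoff a x = 1.
Proof.
move=> a0 h; rewrite /inner_cutoff big1// => j _; apply: clamp1.
rewrite lerBrDr mulrC ler_pdivlMr//; have := h j; lra.
Qed.

Definition sdiff w e x : R := w (x + e) + w (x - e) - 2 * w x.

Lemma sdiff_ge0 w e x : convex_on D w -> D (x + e) -> D (x - e) -> 0 <= sdiff w e x.
Proof.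
move=> cw h1 h2; have half01 : 0 <= (2^-1 : R) <= 1 by rewrite invr_ge0 ler0n /= invf_le1// ler1n.
have := cw _ _ _ h1 h2 half01; rewrite /sdiff.
have -> : 2^-1 *: (x + e) + (1 - 2^-1) *: (x - e) = x.
  by apply/rowP => i; rewrite !mxE; set z := x 0 i; set t := e 0 i; lra.
set p := w _; set q := w _; set z := w x.
have -> : 1 - 2^-1 = 2^-1 :> R by field.
lra.
Qed.

(** A common Lipschitz constant of all L_j along the line in direction [e]. *)
Definition dirlip e : R := \sum_j `|\sum_i u j 0 i * e 0 i|.

Lemma dirlipP j e : `|\sum_i u j 0 i * e 0 i| <= dirlip e.
Proof. by rewrite /dirlip (bigD1 j)//= lerDl sumr_ge0. Qed.

Lemma inner_move a x e t : (forall j, a <= L j x) -> `|t| * dirlip e <= a -> D (x + t *: e).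
Proof.
move=> hx ht j; rewrite affDZ.
have : `|t * \sum_i u j 0 i * e 0 i| <= a.
  by apply: le_trans ht; rewrite normrM; apply: ler_wpM2l => //; exact: dirlipP.
by rewrite ler_norml => /andP[h _]; have := hx j; lra.
Qed.

(** The offset [N] makes the steps so short that points of depth [a] stay in D when moved by them.
    Then all second differences are defined on the support of the cutoff, and dominated convergence
    applies. *)
Lemma cutoff_sdiff_cvg a w e : 0 < a -> adm w -> exists N : nat, [/\
  dirlip e * 2 ^- N <= a,
  forall n, good (fun x => inner_cutoff a x * sdiff w (2 ^- (n + N) *: e) x) &
  4 ^+ (n + N) * iint (fun x => inner_cutoff a x * sdiff w (2 ^- (n + N) *: e) x) @[n --> \oo] -->
  int_on D (fun x => inner_cutoff a x * hess_form w x e)].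
Proof.
move=> a0 [U [oU DU hw cw [_ w0]]].
have l0 : 0 <= dirlip e by exact: sumr_ge0.
have [N hN] : exists N : nat, dirlip e * 2 ^- N <= a.
  have : \forall n \near \oo, (2 ^- n : R) < a / (dirlip e + 1).
    by apply: (cvgr_lt _ (@cvg_half R)); rewrite divr_gt0// ltr_wpDl.
  move=> [N _ hN]; exists N; have := hN N (leqnn _); rewrite /= ltr_pdivlMr ?ltr_wpDl// => h.
  by apply: le_trans (ltW h); rewrite mulrC ler_wpM2l ?invr_ge0 ?exprn_ge0// lerDl.
exists N.
pose c' j := c j - a; pose D' := polytope u c'.
have D'P x : D' x <-> forall j, a <= L j x by exact: inner_polytope.
have D'D x : D' x -> D x by move=> /D'P h j; exact: le_trans (ltW a0) (h j).
have hh n : 0 <= 2 ^- (n + N) :> R by rewrite invr_ge0 exprn_ge0.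
have hle n : (2 ^- (n + N) : R) <= 2 ^- N.
  by rewrite lef_pV2 ?posrE ?exprn_gt0// ler_weXn2l ?ler1n// leq_addl.
have mv n x (t : R) : D' x -> `|t| <= 2 ^- (n + N) -> D (x + t *: e).
  move=> /D'P Dx ht; apply: (inner_move Dx); rewrite mulrC.
  by apply: le_trans hN; apply: ler_wpM2l => //; exact: le_trans ht (hle n).
have nh n : `|2 ^- (n + N)| <= 2 ^- (n + N) :> R by rewrite ger0_norm.
have [M M0 DM] := polytope_bounded cD.
have [B B0 hB] := within_bounded cD (within_of (fun x Dx => hess_form_cont (e := e) hw (DU x Dx))).
have k1 x : `|inner_cutoff a x| <= 1 by have /andP[h1 h2] := inner_cutoff_01 a x; rewrite ger0_norm.
have k0 x : ~ D' x -> inner_cutoff a x = 0.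
  move=> /D'P Dx; apply: inner_cutoff0 => //; apply: contrapT => /forallNP h; apply: Dx => j.
  by rewrite leNgt; apply/negP; exact: h.
have wc x : D x -> cts_at w x by move=> /DU Ux; apply: cts_atP; exact: Cn_cont hw Ux.
pose G n x := inner_cutoff a x * (4 ^+ (n + N) * sdiff w (2 ^- (n + N) *: e) x).
have ccD n x v : ccvg v x -> ccvg (fun k => v k + 2 ^- (n + N) *: e) (x + 2 ^- (n + N) *: e).
  by move=> vx; apply: ccvgD => //; exact: ccvg_cst.
have ccB n x v : ccvg v x -> ccvg (fun k => v k - 2 ^- (n + N) *: e) (x - 2 ^- (n + N) *: e).
  by move=> vx; apply: ccvgD => //; exact: ccvg_cst.
have ks : scont (inner_cutoff a) by apply: continuous_scont; exact: inner_cutoff_continuous.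
have sG n : scont (G n).
  apply: (zext_scont (u := u) (c := c') ks k0) => x Dx v vx.
  apply: cvgM; first exact: cvg_cst.
  apply: cvgB; last by apply: cvgM; [exact: cvg_cst|apply: wc => //; exact: D'D].
  apply: cvgD; first by apply: (wc _ (mv n x _ Dx (nh n))); exact: ccD.
  have := mv n x (- 2 ^- (n + N)) Dx; rewrite normrN scaleNr => /(_ (nh n)) h.
  by apply: (wc _ h); exact: ccB.
have bG n : bdd_supp (1 * (2 * B) + M) (G n).
  apply: (zext_bdd (u := u) (c := c')) => //.
  - move=> x Dx; rewrite normrM ger0_norm ?exprn_ge0//.
    (* Taken with [A = 0], the estimate bounds the scaled second differences uniformly in [n]. *)
    have := @second_difference_le R m U w x e (2 ^- (n + N)) 0 B oU hw (hh n).
    rewrite mulr0 subr0 -/(sdiff w (2 ^- (n + N) *: e) x) => H.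
    have -> : 2 * B = 4 ^+ (n + N) * (2 * (2 ^- (n + N)) ^+ 2 * B).
      have := exp4_half R (n + N); set b := 4 ^+ _; set b' := _ ^+ 2 => bb.
      have -> : b * (2 * b' * B) = b * b' * (2 * B) by ring.
      by rewrite bb mul1r.
    apply: ler_wpM2l; rewrite ?exprn_ge0//; apply: H => t ht.
      exact/DU/(mv n).
    by rewrite subr0; apply: hB; exact: (mv n).
  - by move=> x /D'D; exact: DM.
  - by rewrite mulr_ge0// ltW.
have GE n : (fun x => inner_cutoff a x * sdiff w (2 ^- (n + N) *: e) x) = fun x => 4 ^- (n + N) * G n x.
  by apply/funext => x; rewrite /G mulrCA mulKf// expf_neq0// pnatr_eq0.
have gG n : good (G n) := good_scont (sG n) (bG n).
split=> //; first by move=> n; rewrite GE; exact: goodZ.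
have -> : (fun n => 4 ^+ (n + N) * iint (fun x => inner_cutoff a x * sdiff w (2 ^- (n + N) *: e) x)) =
    (fun n => iint (G n)).
  apply/funext => n.
  by rewrite GE iintZ// mulVKf// expf_neq0// pnatr_eq0.
rewrite /int_on; apply: (iint_dct sG bG) => x.
case: asboolP => [Dx|nDx]; last first.
  apply: cvg_near_cst; apply: nearW => n; rewrite /G k0 ?mul0r//.
  by move=> /D'D.
apply: cvgM; first exact: cvg_cst.
have := second_difference_cvg (v := e) oU hw (DU _ Dx).
rewrite -(cvg_shiftn N); apply: cvg_trans; apply: near_eq_cvg; exact: nearW.
Qed.

(** The average [phi s] of w around q + se is compared at s = 1, 0, -1. Its small-step second
    differences integrate those of w against a kernel below the inner cutoff, and [doubling]
    propagates the bound to step 1 with exactly the scaling under which the right side tends to the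
    energy integral. Convexity bounds [phi 1] and [phi (-1)] below by values of w, and S bounds
    [phi 0] above. *)
Lemma gap a h r : 0 < a -> 0 < h -> 0 <= r -> exists2 C : R, 0 < C & forall w e q S, adm w -> `|e| <= r ->
  (forall (s : R) y, `|s| <= 1 -> `|y| <= 2 * h -> forall j, 2 * a <= L j (q + s *: e + y)) ->
  (forall y, `|y| <= 2 * h -> w (q + y) <= S) -> w (q + e) + w (q - e) <= 2 * S + C * F w.
Proof.
move=> a0 h0 r0; have [K K0 hK] := energy a0 r0.
pose mu : R := iint (@moll R m h); have mu0 : 0 < mu by exact: iint_moll_gt0.
exists (K / mu); first exact: divr_gt0.
move=> w e q S aw er hL hS; have [U [oU DU hw cw [_ w0]]] := aw.
have [M M0 DM] := polytope_bounded cD.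
have wc x : D x -> {for x, continuous w} by move=> /DU; exact: Cn_cont hw.
have [B B0 hB] := within_bounded cD (within_of wc).
pose okp p := forall y, `|y| <= 2 * h -> D (p + y).
have okq (s : R) : `|s| <= 1 -> okp (q + s *: e).
  by move=> hs y hy j; apply: le_trans (hL s y hs hy j); apply: mulr_ge0 => //; exact: ltW.
pose g p x := moll h (x - p) * w x.
have ms p : scont (fun x : 'rV[R]_m => moll h (x - p)).
  by move=> v x vx; apply: moll_scont; apply: ccvgD => //; exact: ccvg_cst.
have mout p x : okp p -> ~ D x -> moll h (x - p) = 0.
  move=> hp Dx; apply: moll_out => //; rewrite ltNge; apply/negP => hxp; apply: Dx.
  by rewrite -[x](subrKC p); exact: hp.
have m1 p x : `|moll h (x - p)| <= 1 by rewrite ger0_norm ?moll_ge0// moll_le1.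
have sg p : okp p -> scont (g p).
  move=> hp; apply: (zext_scont (u := u) (c := c) (ms p)); first by move=> x; exact: mout.
  by move=> x Dx; exact/cts_atP/wc.
have bg p : okp p -> bdd_supp (1 * B + M) (g p).
  move=> hp; apply: (zext_bdd (u := u) (c := c)) => //; last exact: ltW.
  by move=> x; exact: mout.
have gg p : okp p -> good (g p) by move=> hp; exact: good_scont (sg p hp) (bg p hp).
pose A p := iint (g p).
have Ash p z : okp p -> A p = iint (fun x => g p (z + x)) by move=> hp; rewrite iint_shift//; exact: gg.
pose phi (s : R) := A (q + s *: e).
have [N [hN goodN hlim]] := cutoff_sdiff_cvg e a0 aw.
(* After translating the outer averages all three share one kernel, applied to the second difference
   of w. That difference is nonnegative on the support, so the kernel may be replaced by the larger
   inner cutoff. *)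
have step n : phi 1 + phi (- 1) - 2 * phi 0 <=
    4 ^+ (n + N) * iint (fun x => inner_cutoff a x * sdiff w (2 ^- (n + N) *: e) x).
  apply: doubling => s hs; pose t : R := 2 ^- (n + N).
  have t0 : 0 <= t by rewrite invr_ge0 exprn_ge0.
  have s1 : `|s + t| <= 1 by apply: le_trans (ler_normD _ _) _; rewrite (ger0_norm t0).
  have s2 : `|s - t| <= 1 by apply: le_trans (ler_normB _ _) _; rewrite (ger0_norm t0).
  have s3 : `|s| <= 1 by apply: le_trans hs; rewrite lerDl.
  rewrite -/t /phi (Ash _ (t *: e) (okq _ s1)) (Ash _ (- t *: e) (okq _ s2)) /A.
  have g1 : good (fun x => g (q + (s + t) *: e) (t *: e + x)) by apply: good_shift; exact/gg/okq.
  have g2 : good (fun x => g (q + (s - t) *: e) (- t *: e + x)) by apply: good_shift; exact/gg/okq.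
  have g3 := gg _ (okq _ s3).
  rewrite -iintD// -mulNr -iintZ// -iintD//; [|exact: goodD|exact: goodZ].
  have E : (fun x => g (q + (s + t) *: e) (t *: e + x) + g (q + (s - t) *: e) (- t *: e + x) +
      -2 * g (q + s *: e) x) = fun x => moll h (x - (q + s *: e)) * sdiff w (t *: e) x.
    apply/funext => x; rewrite /g /sdiff.
    have -> : t *: e + x - (q + (s + t) *: e) = x - (q + s *: e).
      by apply/rowP => i; rewrite !mxE; ring.
    have -> : - t *: e + x - (q + (s - t) *: e) = x - (q + s *: e).
      by apply/rowP => i; rewrite !mxE; ring.
    by rewrite [t *: e + x]addrC scaleNr [- _ + x]addrC; ring.
  rewrite E; apply: iint_le; first by rewrite -E; apply: goodD; [exact: goodD|exact: goodZ].
    exact: goodN.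
  move=> x; have [/existsP[j Lj]|hj] := boolP [exists j, L j x < a].
    rewrite inner_cutoff0//; last by exists j.
    rewrite (_ : moll _ _ = 0) ?mul0r//; apply: moll_out => //; rewrite ltNge; apply/negP => hx.
    have := hL s _ s3 hx j; rewrite subrKC; lra.
  have {}hj j : a <= L j x by rewrite leNgt; move: hj; rewrite negb_exists => /forallP.
  have ht : `|t| * dirlip e <= a.
    rewrite ger0_norm// mulrC; apply: le_trans hN; apply: ler_wpM2l; first exact: sumr_ge0.
    by rewrite lef_pV2 ?posrE ?exprn_gt0// ler_weXn2l ?ler1n// leq_addl.
  apply: ler_wpM2r.
    apply: sdiff_ge0 => //; first exact: inner_move hj ht.
    by rewrite -scaleNr; apply: (inner_move hj); rewrite normrN.
  have [hx|hx] := leP `|x - (q + s *: e)| (2 * h); last first.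
    by rewrite moll_out//; have /andP[] := inner_cutoff_01 a x.
  rewrite inner_cutoff1 ?moll_le1// => j.
  by have := hL s _ s3 hx j; rewrite subrKC.
have phiK : phi 1 + phi (- 1) - 2 * phi 0 <= K * F w.
  apply: (@le_trans _ _ (int_on D (fun x => inner_cutoff a x * hess_form w x e))).
    by apply: (ler_cvg_to (@cvg_cst _ _ nat \oo eventually_filter) hlim); exact: nearW.
  apply: hK => //; [exact: inner_cutoff_continuous|exact: inner_cutoff_01|].
  by move=> x; exact: inner_cutoff0.
(* The integral is written both with y and with -y; evenness of the kernel and midpoint convexity at
   p bound their sum below by twice the value at p. *)
have lower (s : R) : `|s| <= 1 -> mu * w (q + s *: e) <= phi s.
  move=> hs; have hp := okq _ hs; set p := q + s *: e in hp *.
  pose k y := g p (p + y).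
  have kE y : k y = moll h y * w (p + y) by rewrite /k /g addrC addKr.
  have sk : scont k by exact: scont_shift (sg p hp).
  have bk := bdd_supp_shift p (bg p hp).
  have gk : good k := good_scont sk bk.
  have skN : scont (fun y => k (- y)).
    move=> v x vx; apply: sk => i; rewrite mxE; under eq_fun do rewrite mxE.
    by apply: cvgN; exact: vx.
  have bkN : bdd_supp (1 * B + M + `|p|) (fun y => k (- y)).
    by move=> y; split; [exact: (bk _).1|rewrite -[`|y|]normrN; exact: (bk (- y)).2].
  have gkN : good (fun y => k (- y)) := good_scont skN bkN.
  have E1 : phi s = iint k by rewrite /phi -/p (Ash p p hp).
  have E2 : phi s = iint (fun y => k (- y)) by rewrite (iint_opp sk bk).
  have gm : good (@moll R m h) := good_scont (@moll_scont R m h) (@moll_bdd R m h h0).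
  have : iint (fun y => (2 * w p) * moll h y) <= phi s + phi s.
    rewrite {1}E1 E2 -iintD//; apply: iint_le; [exact: goodZ|exact: goodD|] => y.
    rewrite !kE mollN -mulrDr mulrC.
    have [hy|hy] := leP `|y| (2 * h); last by rewrite moll_out// !mul0r.
    apply: ler_wpM2l; first exact: moll_ge0.
    have h1 : D (p + y) by exact: hp.
    have h2 : D (p - y) by apply: hp; rewrite normrN.
    by have := sdiff_ge0 cw h1 h2; rewrite /sdiff; lra.
  rewrite iintZ// -/mu; set z := w p; set f1 := phi s; lra.
have upper : phi 0 <= mu * S.
  have n0 : `|0 : R| <= 1 by rewrite normr0.
  have gm : good (@moll R m h) := good_scont (@moll_scont R m h) (@moll_bdd R m h h0).
  rewrite /phi scale0r addr0; have hq : okp q by have := okq 0 n0; rewrite scale0r addr0.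
  rewrite (Ash q q hq) mulrC /mu -iintZ//; apply: iint_le; [exact/good_shift/gg|exact: goodZ|] => y.
  rewrite /g addrC addKr mulrC.
  have [hy|hy] := leP `|y| (2 * h); last by rewrite moll_out// !mulr0.
  by apply: ler_wpM2r; [exact: moll_ge0|exact: hS].
have := lower 1; have := lower (- 1); rewrite normrN normr1 lexx scaleN1r scale1r => /(_ isT) h1 /(_ isT) h2.
rewrite -(ler_pM2l mu0) [X in _ <= X]mulrDr [X in _ <= _ + X]mulrA [mu * (K / mu)]mulrC divfK ?gt_eqF//.
rewrite mulrDr; move: phiK upper h1 h2.
set f1 := phi 1; set f2 := phi (-1); set f0 := phi 0; set w1 := w (q + e); set w2 := w _; set kf := K * _.
rewrite [mu * (2 * S)]mulrCA; lra.
Qed.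

(** Jensen's inequality with the missing weight placed at [x0], where w vanishes. The total stays
    below 1 so that the remaining weights can be rescaled by [1 - l i]. *)
Lemma convex_le_sum w (I : Type) (r : seq I) (l : I -> R) (z : I -> 'rV[R]_m) :
  convex_on D w -> w x0 = 0 -> (forall i, 0 <= l i) -> \sum_(i <- r) l i < 1 -> (forall i, D (x0 + z i)) ->
  D (x0 + \sum_(i <- r) l i *: z i) /\ w (x0 + \sum_(i <- r) l i *: z i) <= \sum_(i <- r) l i * w (x0 + z i).
Proof.
move=> cw wx0 l0; elim: r l l0 => [|i r IH] l l0 hl Dz.
  by rewrite !big_nil addr0 wx0; split=> //; exact: interior_subset.
rewrite !big_cons in hl *.
have r0 : 0 <= \sum_(j <- r) l j by apply: sumr_ge0.
have li1 : l i < 1 by lra.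
have p0 : 0 < 1 - l i by rewrite subr_gt0.
have [] := IH (fun j => l j / (1 - l i)) _ _ Dz.
- by move=> j; rewrite divr_ge0// ltW.
- by rewrite -mulr_suml ltr_pdivrMr//; lra.
have -> : \sum_(j <- r) (l j / (1 - l i)) *: z j = (1 - l i)^-1 *: \sum_(j <- r) l j *: z j.
  by rewrite scaler_sumr; apply: eq_bigr => j _; rewrite scalerA mulrC.
have -> : \sum_(j <- r) l j / (1 - l i) * w (x0 + z j) = (1 - l i)^-1 * \sum_(j <- r) l j * w (x0 + z j).
  by rewrite mulr_sumr; apply: eq_bigr => j _; rewrite mulrAC mulrC.
set y := \sum_(j <- r) l j *: z j => Dy hy.
have -> : x0 + (l i *: z i + y) = l i *: (x0 + z i) + (1 - l i) *: (x0 + (1 - l i)^-1 *: y).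
  have Ey : (1 - l i) *: ((1 - l i)^-1 *: y) = y by rewrite scalerA mulfV ?scale1r// gt_eqF.
  by rewrite [l i *: (_ + _)]scalerDr [(1 - l i) *: (_ + _)]scalerDr Ey addrACA -scalerDl subrKC scale1r.
have l01 : 0 <= l i <= 1 by rewrite l0 ltW.
split.
  have := polytope_convex Dy (Dz i) l01; congr D.
  by apply/rowP => k; rewrite !mxE; ring.
apply: le_trans (cw _ _ _ (Dz i) Dy l01) _; apply: lerD => //.
by rewrite -ler_pdivlMl.
Qed.

(** The reciprocal of a Lipschitz constant common to all L_j; the added 1 keeps it invertible. *)
Lemma exists_slope : exists2 b : R, 0 < b & forall y j, b * `|\sum_i u j 0 i * y 0 i| <= `|y|.
Proof.
pose B := 1 + \sum_j \sum_i `|u j 0 i|.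
have B0 : 0 < B by rewrite ltr_pwDl// sumr_ge0// => j _; exact: sumr_ge0.
exists B^-1; first by rewrite invr_gt0.
move=> y j; rewrite ler_pdivrMl//.
apply: le_trans (ler_norm_sum _ _ _) _.
apply: (@le_trans _ _ ((\sum_i `|u j 0 i|) * `|y|)).
  rewrite mulr_suml; apply: ler_sum => i _; rewrite normrM; apply: ler_wpM2l => //; exact: coord_le_norm.
apply: ler_wpM2r => //; rewrite /B (bigD1 j)//= addrCA lerDl addr_ge0//.
by apply: sumr_ge0 => k _; exact: sumr_ge0.
Qed.

Lemma exists_depth : exists2 a : R, 0 < a & forall j, a <= L j x0.
Proof.
have Lp j : 0 < L j x0 by move/(interior_polytope _ u0): ix0; exact.
pose S := \sum_j (L j x0)^-1.
have S0 : 0 <= S by apply: sumr_ge0 => j _; rewrite invr_ge0 ltW.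
have S1 : 0 < 1 + S by rewrite ltr_pwDl.
exists (1 + S)^-1; first by rewrite invr_gt0.
move=> j; rewrite -[leRHS]invrK lef_pV2 ?posrE ?invr_gt0//.
rewrite /S (bigD1 j)//= addrCA lerDl addr_ge0//.
by apply: sumr_ge0 => k _; rewrite invr_ge0 ltW.
Qed.

(* Near x0 the gap inequality can be absorbed: since w x0 = 0, convexity bounds the supremum of w on a small
   ball by half of itself plus a multiple of F w. *)
Lemma local_bound : exists r C : R, [/\ 0 < r, 0 < C & forall w y, adm w -> `|y| <= r ->
  D (x0 + y) /\ w (x0 + y) <= C * F w].
Proof.
have [b b0 hb] := exists_slope; have [a a0 ha] := exists_depth.
(* Displacements of norm up to [2 * rho] change each L_j by at most [a / 2], so such points keep
   depth [a / 2]. *)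
pose rho := a * b / 4; have rho0 : 0 < rho by rewrite divr_gt0// mulr_gt0.
(* A vector of norm at most [r] is a combination of the vertices at distance [rho] along the axes
   with weights of total at most 1/4; this beats the factor 2 of [gap]. *)
pose r := rho / (4 * (m%:R + 1)).
have m0 : 0 <= m%:R :> R by [].
have r0 : 0 < r by rewrite divr_gt0// mulr_gt0// ltr_wpDl.
have mr : m%:R * (r / rho) <= 4^-1.
  rewrite /r; have -> : m%:R * (rho / (4 * (m%:R + 1)) / rho) = m%:R / (m%:R + 1) * 4^-1.
    by field; rewrite (gt_eqF rho0) gt_eqF// ltr_wpDl.
  by rewrite ler_piMl ?invr_ge0// ler_pdivrMr ?ltr_wpDl// mul1r lerDl.
have rrho : r <= rho.
  by rewrite /r ler_pdivrMr ?mulr_gt0 ?ltr_wpDl// ler_peMr ?ltW//; lra.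
have a4 : 0 < a / 4 by rewrite divr_gt0.
have r2 : 0 < r / 2 by rewrite divr_gt0.
have [C C0 hC] := gap a4 r2 (ltW rho0).
have near j y : `|y| <= 2 * rho -> a / 2 <= L j (x0 + y).
  move=> hy; have h1 : b * `|\sum_i u j 0 i * y 0 i| <= a * b / 2.
    by apply: le_trans (hb y j) _; apply: le_trans hy _; rewrite /rho; lra.
  have : `|\sum_i u j 0 i * y 0 i| <= a / 2.
    by rewrite -(ler_pM2l b0); apply: le_trans h1 _; rewrite le_eqVlt; apply/orP; left; apply/eqP; field.
  by rewrite ler_norml affD => /andP[h _]; have := ha j; lra.
have inD y : `|y| <= 2 * rho -> D (x0 + y).
  by move=> hy j; apply: le_trans (near j y hy); rewrite divr_ge0// ltW.
exists r, C; split=> // w y aw hy; have [U [oU DU hw cw [wx0 w0]]] := aw.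
have F0 := energy_ge0 aw.
split; first by apply: inD; lra.
have wc x : D x -> {for x, continuous w} by move=> /DU; exact: Cn_cont hw.
have [B B0 hB] := within_bounded cD (within_of wc).
pose E := [set t | exists2 z, `|z| <= r & t = w (x0 + z)].
have sE : has_sup E.
  split; first by exists (w (x0 + 0)), 0; rewrite ?normr0 ?ltW.
  exists B => t [z hz ->]; apply: le_trans (ler_norm _) (hB _ _); apply: inD; lra.
pose S := sup E.
have hS z : `|z| <= r -> w (x0 + z) <= S by move=> hz; apply: sup_upper_bound => //; exists z.
have S0 : 0 <= S by rewrite -wx0 -[x0]addr0; apply: hS; rewrite normr0 ltW.
have vert i (sg : R) : `|sg| = 1 -> w (x0 + (sg * rho) *: unit_vec R i) <= 2 * S + C * F w.
  move=> hs; have ne : `|(sg * rho) *: unit_vec R i| = rho.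
    by rewrite normrZ norm_unit_vec mulr1 normrM hs mul1r gtr0_norm.
  have := hC w ((sg * rho) *: unit_vec R i) x0 S aw.
  rewrite ne lexx => /(_ isT) h; apply: le_trans (h _ _).
  - by rewrite lerDl; apply: w0; rewrite -scaleNr; apply: inD; rewrite scaleNr normrN ne; lra.
  - move=> s z hs' hz j; rewrite -addrA; apply: le_trans (near j _ _); first by lra.
    apply: le_trans (ler_normD _ _) _; rewrite normrZ ne.
    have : `|s| * rho <= 1 * rho by apply: ler_wpM2r => //; exact: ltW.
    lra.
  - by move=> z hz; apply: hS; lra.
(* The coordinates of z, divided by [rho], are the weights in [convex_le_sum]; their signs select
   the vertices. *)
have half z : `|z| <= r -> w (x0 + z) <= 4^-1 * (2 * S + C * F w).
  move=> hz.
  pose sg i : R := if 0 <= z 0 i then 1 else -1.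
  have sg1 i : `|sg i| = 1 by rewrite /sg; case: ifP; rewrite ?normrN normr1.
  pose l i := `|z 0 i| / rho.
  have l0 i : 0 <= l i by rewrite divr_ge0// ltW.
  have ls : \sum_i l i <= 4^-1.
    apply: le_trans mr; rewrite -mulr_suml mulrA; apply: ler_wpM2r; first by rewrite invr_ge0 ltW.
    rewrite mulr_natl -[X in _ *+ X](card_ord m) -sumr_const.
    by apply: ler_sum => i _; exact: le_trans (coord_le_norm _ _) hz.
  have l1 : \sum_i l i < 1 by apply: le_lt_trans ls _; rewrite invf_lt1// ltr1n.
  have Dz i : D (x0 + (sg i * rho) *: unit_vec R i).
    by apply: inD; rewrite normrZ norm_unit_vec mulr1 normrM sg1 mul1r gtr0_norm//; lra.
  have [_] := convex_le_sum cw wx0 l0 l1 Dz.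
  have -> : \sum_i l i *: ((sg i * rho) *: unit_vec R i) = z.
    rewrite [RHS]row_sum_unit; apply: eq_bigr => i _; rewrite scalerA; congr (_ *: _).
    rewrite /l mulrCA divfK ?gt_eqF// /sg; case: ifP => h; first by rewrite mul1r ger0_norm.
    by rewrite mulN1r ler0_norm ?opprK// ltW// ltNge h.
  move=> h; apply: le_trans h _.
  apply: (@le_trans _ _ ((\sum_i l i) * (2 * S + C * F w))).
    by rewrite mulr_suml; apply: ler_sum => i _; apply: ler_wpM2l => //; exact: vert.
  by apply: ler_wpM2r => //; rewrite addr_ge0// mulr_ge0// ltW.
(* The factor of S on the right is 1/2, so S is absorbed and at most half of [C * F w] remains. *)
have : S <= 4^-1 * (2 * S + C * F w).
  by apply: ge_sup; [exact: sE.1|move=> t [z hz ->]; exact: half].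
move=> h; apply: le_trans (hS y hy) _.
have : 0 <= C * F w by rewrite mulr_ge0// ltW.
set k := C * F w in h *; lra.
Qed.

(** Applying [gap] at the midpoint q of x0 and x0 + t(z - x0), with q - e = x0, bounds the far
    endpoint by a supremum near q. That neighbourhood lies in the dilate of D by 2t/3 > t/2, so
    finitely many steps from t to 2t/3 reduce to [local_bound]. *)
Lemma interior_bound t : 0 < t < 1 -> exists2 C : R, 0 < C & forall w z, adm w -> D z ->
  w (x0 + t *: (z - x0)) <= C * F w.
Proof.
have [r [C1 [r0 C10 hC1]]] := local_bound.
have [b b0 hb] := exists_slope; have [a a0 ha] := exists_depth.
have [M M0 DM] := polytope_bounded cD.
have MM0 : 0 < 2 * M + 1 by lra.
have diam z : D z -> `|z - x0| <= 2 * M + 1.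
  move=> Dz; apply: le_trans (ler_normB _ _) _.
  have := DM _ Dz; have := DM _ (interior_subset ix0); lra.
pose t0 := r / (2 * M + 1).
have t00 : 0 < t0 by rewrite divr_gt0.
(* [n] counts the reductions by 2/3 needed to bring [t] below [t0], at which the whole dilate lies
   in the ball of [local_bound]. *)
suff H n : forall t, 0 < t < 1 -> t * (2 / 3) ^+ n <= t0 -> exists2 C : R, 0 < C &
    forall w z, adm w -> D z -> w (x0 + t *: (z - x0)) <= C * F w.
  move=> ht; have [n hn] : exists n, t * (2 / 3) ^+ n <= t0.
    have l23 : (2 / 3 : R) ^+ n @[n --> \oo] --> (0 : R).
      apply: cvg_expr; rewrite ger0_norm; lra.
    have : \forall n \near \oo, (2 / 3 : R) ^+ n < t0 by exact: (cvgr_lt _ l23).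
    move=> [n _ hn]; exists n; apply: le_trans (ltW (hn n (leqnn _))).
    by rewrite ler_piMl ?exprn_ge0//; move: ht => /andP[_ /ltW].
  exact: H hn.
elim: n => [|n IH] {}t /andP[tp t1].
  rewrite expr0 mulr1 => ht; exists C1 => // w z aw Dz; apply: (hC1 _ _ aw _).2.
  rewrite normrZ gtr0_norm//; apply: (@le_trans _ _ (t0 * (2 * M + 1))).
    by apply: ler_pM => //; [exact: ltW|exact: diam].
  by rewrite divfK ?gt_eqF.
move=> ht.
have t'01 : 0 < 2 * t / 3 < 1 by apply/andP; split; lra.
have t'n : 2 * t / 3 * (2 / 3) ^+ n <= t0.
  apply: le_trans ht; rewrite exprS; set p := _ ^+ n.
  by rewrite (_ : 2 * t / 3 * p = t * (2 / 3 * p))//; field.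
have [C2 C20 hC2] := IH _ t'01 t'n.
(* Along the segment every L_j is at least [(1 - t) * a], that is [4 * a']; after a loss of at most
   [a'] more than the [2 * a'] asked by [gap] is left. *)
pose a' := (1 - t) * a / 4.
have a'0 : 0 < a' by rewrite divr_gt0// mulr_gt0// subr_gt0.
(* Displacements of norm [2 * h] change each L_j by at most [a'] and by at most [t * a / 6]; the
   second bound becomes [a / 4] after multiplication by [3 / (2 * t)]. *)
pose h := b * (Num.min a' (t * a / 6)) / 2.
have mn0 : 0 < Num.min a' (t * a / 6) by rewrite lt_min a'0 divr_gt0// mulr_gt0.
have h0 : 0 < h by rewrite divr_gt0// mulr_gt0.
have [C3 C30 hC3] := gap a'0 h0 (ltW MM0).
have small y j : `|y| <= 2 * h -> `|\sum_i u j 0 i * y 0 i| <= Num.min a' (t * a / 6).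
  move=> hy; rewrite -(ler_pM2l b0); apply: le_trans (hb y j) _; apply: le_trans hy _.
  by rewrite /h mulrC divfK.
exists (2 * C2 + C3); first by rewrite addr_gt0// mulr_gt0.
move=> w z aw Dz; have [U [oU DU hw cw [wx0 w0]]] := aw.
pose e := (t / 2) *: (z - x0).
have -> : x0 + t *: (z - x0) = x0 + e + e.
  by rewrite -addrA -scalerDl; congr (_ + _ *: _); field.
have he : `|e| <= 2 * M + 1.
  rewrite normrZ ger0_norm; last by rewrite divr_ge0// ltW.
  have := diam _ Dz; have : t / 2 <= 1 by lra.
  move=> h1 h2; rewrite -[leRHS]mul1r; apply: ler_pM => //; by rewrite divr_ge0// ltW.
have := hC3 w e (x0 + e) (C2 * F w) aw he.
have -> : w (x0 + e - e) = 0 by rewrite addrK.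
rewrite addr0 [(2 * C2 + C3) * _]mulrDl -[2 * C2 * _]mulrA; apply.
- move=> s y hs hy j.
  have -> : x0 + e + s *: e + y = x0 + ((1 + s) * (t / 2)) *: (z - x0) + y.
    by rewrite -[x0 + e + _]addrA -{1}[e]scale1r -scalerDl scalerA.
  have := small y j hy; rewrite affD aff_seg le_min => /andP[+ _].
  rewrite ler_norml => /andP[hy1 _].
  move: hs; rewrite ler_norml => /andP[s1 s2].
  have q0 : 0 <= (1 + s) * (t / 2) by apply: mulr_ge0; lra.
  have q1 : (1 + s) * (t / 2) <= t.
    have : (1 + s) * (t / 2) <= 2 * (t / 2) by apply: ler_wpM2r; lra.
    lra.
  have h1 : 0 <= (1 + s) * (t / 2) * L j z by apply: mulr_ge0 => //; exact: Dz.
  have h2 : (1 - t) * a <= (1 - (1 + s) * (t / 2)) * L j x0.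
    by apply: ler_pM => //; [lra|exact: ltW|lra].
  have h3 : (1 - t) * a = 4 * a' by rewrite /a'; field.
  rewrite h3 in h2; move: h1 h2 hy1 a'0.
  set p := _ * L j z; set p' := _ * L j x0; set p'' := \sum_i _; set b' := a'; lra.
- move=> y hy.
  (* Without y this is the point three quarters of the way from x0 to z, where each L_j is at least
     [a / 4]; the perturbation by y therefore stays in D. *)
  pose z' := x0 + (3 / (2 * t)) *: (e + y).
  have -> : x0 + e + y = x0 + (2 * t / 3) *: (z' - x0).
    have -> : z' - x0 = (3 / (2 * t)) *: (e + y) by rewrite /z' addrC addKr.
    rewrite scalerA (_ : 2 * t / 3 * _ = 1) ?scale1r ?addrA//.
    by field; rewrite gt_eqF.
  apply: hC2 => // j.
  rewrite /z' /e scalerDr scalerA addrA affDZ.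
  have -> : 3 / (2 * t) * (t / 2) = 3 / 4 by field; rewrite gt_eqF.
  rewrite aff_seg.
  have := small y j hy; rewrite le_min => /andP[_]; rewrite ler_norml => /andP[hy1 _].
  have h1 : 0 <= 3 / 4 * L j z by apply: mulr_ge0 => //; exact: Dz.
  have h2 := ha j.
  have h3 : - (a / 4) <= 3 / (2 * t) * (\sum_i u j 0 i * y 0 i).
    rewrite -lerNl -mulrN -ler_pdivlMl; last by rewrite divr_gt0// mulr_gt0.
    have -> : (3 / (2 * t))^-1 * (a / 4) = t * a / 6 by field; rewrite gt_eqF.
    by rewrite lerNl.
  by move: h1 h2 h3; set p := L j z; set q := L j x0; set k := 3 / (2 * t) * _; lra.
Qed.

End Gap.

(** * Boundary estimate and uniform stability *)

Lemma int_on0 (R : realType) m (A : set 'rV[R]_m) : int_on A (fun=> 0) = 0.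
Proof. by rewrite /int_on -[RHS](iint0 R m); congr iint; apply/funext => x; case: ifP. Qed.

Lemma within_contM (R : realType) (T : topologicalType) (A : set T) (g h : T -> R) :
  {within A, continuous g} -> {within A, continuous h} -> {within A, continuous (fun x => g x * h x)}.
Proof. by move=> cg ch x; apply: continuousM; [exact: cg|exact: ch]. Qed.

Section Stability.
Variables (R : realType) (m d : nat) (u : 'I_d -> 'rV[R]_m) (c : 'I_d -> R) (f s : 'rV[R]_m -> R).
Variable x0 : 'rV[R]_m.
Local Notation L j := (aff (u j) (c j)).
Local Notation D := (polytope u c).
Local Notation adm := (admissible u c x0).
Local Notation wt := (weight f).
Local Notation fut := (futaki u c f s).
Hypotheses (cD : compact D) (u0 : forall j, u j != 0) (ix0 : interior D x0).
Hypotheses (af : affine_fun f) (fpos : forall x, D x -> 0 < f x) (asf : affine_fun s).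
Hypothesis energy : controls_hessian u c x0 fut.
Implicit Types (x y : 'rV[R]_m) (w : 'rV[R]_m -> R).

Let Lx0 j : 0 < L j x0.
Proof. by move/(interior_polytope _ u0): ix0; exact. Qed.

(** Zero at [x0] and one on the j-th facet, so the region where all gauges are at most t is the
    dilate of D by t about [x0]. Written with [aff] so that the calculus of affine functions
    applies. *)
Definition gauge j x : R := aff (- (L j x0)^-1 *: u j) (1 - (L j x0)^-1 * c j) x.

Lemma gaugeE j x : gauge j x = 1 - L j x / L j x0.
Proof.
rewrite /gauge /aff; under eq_bigr => i _ do rewrite mxE -mulrA.
by rewrite -mulr_sumr; ring.
Qed.

Lemma gauge_le1 j x : D x -> gauge j x <= 1.
Proof. by move=> Dx; rewrite gaugeE lerBlDr lerDl; apply: divr_ge0; [exact: Dx|exact/ltW/Lx0]. Qed.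

Lemma gauge_inner x (t : R) : 0 < t -> (forall j, gauge j x <= t) -> exists2 z, D z & x = x0 + t *: (z - x0).
Proof.
move=> t0 h; exists (x0 + t^-1 *: (x - x0)); last first.
  have -> : x0 + t^-1 *: (x - x0) - x0 = t^-1 *: (x - x0) by rewrite addrC addKr.
  by rewrite scalerA mulfV ?gt_eqF// scale1r subrKC.
move=> j; rewrite aff_seg.
have := h j; rewrite gaugeE lerBlDr -lerBlDl ler_pdivlMr// => hj.
rewrite -(pmulr_rge0 _ t0) mulrDr mulrA mulrBr mulr1 mulrA mulfV ?gt_eqF// mul1r; lra.
Qed.

Definition rho n x : R := \sum_j posX n.+2 (gauge j x).
Definition drho n i x : R := \sum_j n.+2%:R * posX n.+1 (gauge j x) * (- (L j x0)^-1 * u j 0 i).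

Lemma is_derive_rho n i x : is_derive x (unit_vec R i) (rho n) (drho n i x).
Proof.
have H j : is_derive x (unit_vec R i) (fun y => posX n.+2 (gauge j y))
    (n.+2%:R * posX n.+1 (gauge j x) * (- (L j x0)^-1 * u j 0 i)).
  have := is_derive_comp1 (is_derive_aff (- (L j x0)^-1 *: u j) (1 - (L j x0)^-1 * c j) x i) (is_derive_posX n _).
  by rewrite mxE.
have := is_derive_sum H; congr (is_derive _ _ _ _).
by apply/funext => y; rewrite fct_sumE.
Qed.

Lemma posX_gauge_cont k j x : {for x, continuous (fun y => posX k (gauge j y))}.
Proof.
have ca : {for x, continuous (gauge j)} by exact: cont_aff.
exact: (cvg_comp _ _ ca (@posX_continuous R k (gauge j x))).
Qed.

Lemma rho_cont n x : {for x, continuous (rho n)}.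
Proof. by apply: continuous_at_sum => j; exact: posX_gauge_cont. Qed.

Lemma drho_cont n i x : {for x, continuous (drho n i)}.
Proof.
apply: continuous_at_sum => j; apply: cont_M; last exact: cont_cst.
by apply: cont_M; [exact: cont_cst|exact: posX_gauge_cont].
Qed.

Lemma rho_ge0 n x : 0 <= rho n x.
Proof. by apply: sumr_ge0 => j _; exact: posX_ge0. Qed.

Lemma rho_le n x : D x -> rho n x <= d%:R.
Proof.
move=> Dx; rewrite -[X in X%:R](card_ord d) -sumr_const.
apply: ler_sum => j _; rewrite /posX exprn_ile1//; first by rewrite le_max lexx.
by rewrite ge_max ler01 gauge_le1.
Qed.

(** Euler's identity: [rho n] is positively homogeneous of degree n+2 about [x0]. This degree is the
    large factor gained in the collar estimate. *)
Lemma euler_rho n x : \sum_i drho n i x * (x - x0) 0 i = n.+2%:R * rho n x.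
Proof.
rewrite /drho; under eq_bigr => i _ do rewrite mulr_suml.
rewrite exchange_big /rho mulr_sumr; apply: eq_bigr => j _ /=.
transitivity (n.+2%:R * posX n.+1 (gauge j x) * (\sum_i (- (L j x0)^-1 *: u j) 0 i * (x - x0) 0 i)).
  by rewrite mulr_sumr; apply: eq_bigr => i _; rewrite !mxE; ring.
rewrite (aff_sub _ (1 - (L j x0)^-1 * c j)) -!/(gauge j _) [gauge j x0]gaugeE divff ?gt_eqF// subrr subr0.
rewrite -mulrA; congr (_ * _); rewrite /posX.
have [h|h] := leP 0 (gauge j x); first by rewrite -exprSr.
by rewrite expr0n/= mul0r expr0n.
Qed.

(** Moving from x towards the minimum [x0] of a convex function does not increase it; the derivative
    is taken along negative increments. *)
Lemma radial_ge0 w x : adm w -> D x -> 0 <= \sum_i (x - x0) 0 i * pd i w x.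
Proof.
move=> [U [oU DU hw cw [wx0 w0]]] Dx.
have hd := chain_rule (x - x0) oU (Cn_W hw) (DU _ Dx).
have n0 (n : nat) : - n.+1%:R^-1 != 0 :> R by rewrite oppr_eq0 invr_eq0 pnatr_eq0.
have lim : - n.+1%:R^-1 @[n --> \oo] --> (0 : R) by rewrite -oppr0; apply: cvgN; exact: cvg_natinv.
apply: (ler_cvg_to (@cvg_cst _ (0 : R) nat \oo eventually_filter) (is_derive_seq n0 lim hd)).
apply: nearW => n; set q : R := n.+1%:R^-1.
have q0 : 0 < q by rewrite invr_gt0.
have q1 : 0 <= q <= 1 by rewrite ltW//= invf_le1// ler1n.
have h := cw x0 x q (interior_subset ix0) Dx q1.
have E : x + - q *: (x - x0) = q *: x0 + (1 - q) *: x.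
  by apply/rowP => i; rewrite !mxE; ring.
rewrite E invrN mulNr oppr_ge0 pmulr_rle0 ?invr_gt0// subr_le0; apply: le_trans h _.
by rewrite wx0 mulr0 add0r ler_piMl ?w0//; lra.
Qed.

Lemma powV_cont k x : D x -> {for x, continuous (fun y => f y ^- k)}.
Proof.
move=> Dx; apply: continuousV; first by rewrite expf_neq0// gt_eqF// fpos.
by apply: cont_X; exact: affine_fun_cont.
Qed.

Lemma adm_cont w x : adm w -> D x -> {for x, continuous w}.
Proof. by move=> [U [oU DU hw _ _]] /DU; exact: Cn_cont hw. Qed.

(** The divergence of w rho (x - x0) is (n+2+m) w rho plus rho times a nonnegative radial
    derivative, and its outward flux through the k-th facet is w rho L_k(x0). The constant does not
    depend on n because rho is bounded by the number of facets on D. *)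
Lemma boundary_dominates : exists2 C : R, 0 < C &
  forall n w, adm w -> n.+2%:R * int_on D (fun x => w x * rho n x) <= C * bnorm u c f w.
Proof.
have cfX x : D x -> {for x, continuous (fun y => f y ^+ (2 * m - 1))}.
  by move=> Dx; apply: cont_X; exact: affine_fun_cont.
have [B B0 hB] := within_bounded cD (within_of cfX).
pose S := 1 + \sum_j L j x0.
have S0 : 0 < S by rewrite ltr_pwDl// sumr_ge0// => j _; exact: ltW.
(* The factors bound [rho n], the values L_k(x0), and f^(2m-1), the last converting the plain
   boundary integral into the weighted one. *)
exists ((d%:R + 1) * S * B); first by rewrite !mulr_gt0// ltr_wpDl.
move=> n w aw; have [U [oU DU hw cw [wx0 w0]]] := aw.
pose X i := aff (unit_vec R i) (- x0 0 i).
have XE i x : X i x = (x - x0) 0 i.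
  rewrite /X /aff !mxE; congr (_ + _); rewrite (bigD1 i)//= unit_vecE eqxx mul1r big1 ?addr0//.
  by move=> j ji; rewrite unit_vecE (negbTE ji) mul0r.
pose Y i x := w x * rho n x * X i x.
pose dY i x := (w x * drho n i x + rho n x * pd i w x) * X i x + w x * rho n x.
have cw' x : D x -> {for x, continuous w} by exact: adm_cont.
have cpd i x : D x -> {for x, continuous (pd i w)} by move=> /DU; exact: Cn_cont (Cn_pd i hw).
have cX i x : {for x, continuous (X i)} by exact: cont_aff.
have cwr x : D x -> {for x, continuous (fun y => w y * rho n y)}.
  by move=> Dx; apply: cont_M; [exact: cw'|exact: rho_cont].
have := divergence_le cD (Y := Y) (dY := dY) u0.
have flux k x : facet u c k x -> - \sum_i u k 0 i * Y i x = w x * rho n x * L k x0.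
  move=> [Dx Lx]; rewrite (_ : \sum_i _ = w x * rho n x * \sum_i u k 0 i * (x - x0) 0 i).
    by rewrite (aff_sub _ (c k)) Lx; ring.
  by rewrite mulr_sumr; apply: eq_bigr => i _; rewrite /Y XE; ring.
move=> H; apply: le_trans (le_trans _ (H _ _ _ _)) _.
- rewrite -int_onZ//; last exact: within_of.
  apply: int_on_le => //.
  + by apply: within_of => x Dx; apply: cont_M; [exact: cont_cst|exact: cwr].
  + apply: within_of => x Dx; apply: continuous_at_sum => i; apply: cont_D; last exact: cwr.
    apply: cont_M; last exact: cX.
    apply: cont_D; apply: cont_M; [exact: cw'|exact: drho_cont|exact: rho_cont|exact: cpd].
  move=> x Dx; have -> : \sum_i dY i x = w x * (n.+2%:R * rho n x) +
      rho n x * (\sum_i (x - x0) 0 i * pd i w x) + m%:R * (w x * rho n x).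
    rewrite -euler_rho [w x * \sum_(i < m) _]mulr_sumr [rho n x * \sum_(i < m) _]mulr_sumr -big_split /= big_split /=; congr (_ + _).
      by apply: eq_bigr => i _; rewrite XE; ring.
    by rewrite sumr_const card_ord mulr_natl.
  rewrite -addrA mulrCA lerDl addr_ge0//; first by rewrite mulr_ge0 ?rho_ge0// radial_ge0.
  by rewrite !mulr_ge0// ?rho_ge0// w0.
- move=> i x Dx; have hw1 := Cn_is_derive i (Cn_W hw) (DU _ Dx).
  have h1 := is_deriveM hw1 (is_derive_rho n i x).
  have := is_deriveM h1 (is_derive_aff (unit_vec R i) (- x0 0 i) x i).
  congr (is_derive _ _ _ _); rewrite -[(w * rho n) x]/(w x * rho n x) /GRing.scale /= unit_vecE eqxx /dY /X /=; ring.
- by move=> i x Dx; apply: cont_M; [exact: cwr|exact: cX].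
- move=> i x Dx; apply: cont_D; last exact: cwr.
  apply: cont_M; last exact: cX.
  apply: cont_D; apply: cont_M; [exact: cw'|exact: drho_cont|exact: rho_cont|exact: cpd].
- move=> k x fx; rewrite -oppr_ge0 flux// mulr_ge0 ?(ltW (Lx0 _))// mulr_ge0 ?rho_ge0//.
  by apply: w0; exact: fx.1.
rewrite /bnorm /int_bdry mulr_sumr; apply: ler_sum => k _.
have cww x : D x -> {for x, continuous (fun y => w y * wt y)}.
  by move=> Dx; apply: cont_M; [exact: cw'|exact: powV_cont].
rewrite -int_facetZ//; last exact: within_of.
rewrite (int_facet_eq (h := fun x => w x * rho n x * L k x0)); last exact: flux.
apply: int_facet_le => //.
- by apply: within_of => x Dx; apply: cont_M; [exact: cwr|exact: cont_cst].
- by apply: within_of => x Dx; apply: cont_M; [exact: cont_cst|exact: cww].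
move=> x [Dx _]; have wx := w0 x Dx; have fx := fpos Dx.
have h1 : 1 <= B * f x ^- (2 * m - 1).
  by rewrite ler_pdivlMr ?exprn_gt0// mul1r; apply: le_trans (ler_norm _) (hB x Dx).
have h2 : rho n x * L k x0 <= (d%:R + 1) * S.
  apply: ler_pM; [exact: rho_ge0|exact: ltW|by apply: le_trans (rho_le n Dx) _; rewrite lerDl|].
  by rewrite /S (bigD1 k)//= addrCA lerDl addr_ge0// sumr_ge0// => l _; exact: ltW.
have -> : (d%:R + 1) * S * B * (w x * f x ^- (2 * m - 1)) = w x * ((d%:R + 1) * S * (B * f x ^- (2 * m - 1))).
  by ring.
rewrite -mulrA; apply: ler_wpM2l => //; rewrite -[leLHS]mulr1.
by apply: ler_pM => //; rewrite mulr_ge0 ?rho_ge0// ltW.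
Qed.

Lemma bernoulli_ineq (a : R) n : 0 <= a <= 1 -> 1 - n%:R * a <= (1 - a) ^+ n.
Proof.
move=> /andP[a0 a1]; elim: n => [|n IH]; first by rewrite mul0r subr0 expr0.
rewrite exprS; apply: (@le_trans _ _ ((1 - a) * (1 - n%:R * a))); last by apply: ler_wpM2l => //; lra.
have -> : (1 - a) * (1 - n%:R * a) = 1 - n.+1%:R * a + n%:R * a * a by rewrite -natr1; ring.
by rewrite lerDl !mulr_ge0.
Qed.

(** In 2|w|_b = F(w) + int s w f^(-2m-1), the last term is bounded by a collar part worth at most
    one copy of |w|_b and an inner part controlled by F(w); one copy of |w|_b survives on the
    left. *)
Lemma admissible_stable : exists lambda : R, [/\ 0 < lambda, lambda <= 1 &
  forall w, adm w -> lambda * bnorm u c f w <= fut w].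
Proof.
have [C0 C00 hC0] := boundary_dominates.
pose psi x := s x * f x ^- (2 * m + 1).
have cpsi x : D x -> {for x, continuous psi}.
  move=> Dx; apply: cont_M; first exact: affine_fun_cont.
  exact: powV_cont.
have [C1 C10 hC1] := within_bounded cD (within_of cpsi).
(* Chosen so that the collar contribution, [C1] times twice the integral of [w * rho n], is at most
   one copy of the boundary norm. *)
have [n hn] : exists n : nat, 2 * C1 * C0 <= n.+2%:R.
  have [n hn] := exists_natS_gt (2 * C1 * C0); exists n.
  by apply: le_trans (ltW hn) _; rewrite ler_nat.
pose N : R := n.+2%:R; have N0 : 0 < N by [].
(* By Bernoulli's inequality [t ^+ n.+2] is at least 1/2, so [rho n] is at least 1/2 outside the
   dilate of D by [t], while [interior_bound] covers the dilate itself. *)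
pose a : R := (2 * N)^-1; pose t := 1 - a.
have a0 : 0 < a by rewrite invr_gt0 mulr_gt0.
have N1 : 1 <= N by rewrite ler1n.
have a1 : a < 1 by rewrite invf_lt1 ?mulr_gt0//; lra.
have t01 : 0 < t < 1 by rewrite /t; apply/andP; split; lra.
have [C2 C20 hC2] := interior_bound cD u0 ix0 energy t01.
pose vol := int_on D (fun=> 1).
have c1 x : D x -> {for x, continuous (fun _ : 'rV[R]_m => 1 : R)} by move=> _; exact: cont_cst.
have vol0 : 0 <= vol.
  rewrite -(int_on0 D); apply: int_on_le => //; [by apply: within_of => x _; exact: cont_cst|exact: within_of].
pose Q := 1 + C1 * (C2 * vol).
have Q0 : 0 <= C1 * (C2 * vol) by rewrite !mulr_ge0// ltW.
have Q1 : 1 <= Q by rewrite /Q lerDl.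
(* The bound by 1 serves the passage to general test functions, where [2 - lambda] has to be
   nonnegative. *)
exists Q^-1; split; [by rewrite invr_gt0; lra|by rewrite invf_le1//; lra|].
move=> w aw; have [U [oU DU hw cw [wx0 w0]]] := aw.
rewrite ler_pdivrMl; last lra.
have F0 := energy_ge0 energy aw.
have cw' x : D x -> {for x, continuous w} by exact: adm_cont.
have cwr x : D x -> {for x, continuous (fun y => w y * rho n y)}.
  by move=> Dx; apply: cont_M; [exact: cw'|exact: rho_cont].
have pw x : D x -> w x <= 2 * (w x * rho n x) + C2 * fut w * 1.
  move=> Dx; have wx := w0 x Dx; rewrite mulr1.
  have CF : 0 <= C2 * fut w by rewrite mulr_ge0// ltW.
  have [/forallP h|] := boolP [forall j, gauge j x <= t].
    have /andP[tp _] := t01; have [z Dz ->] := gauge_inner tp h.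
    apply: le_trans (hC2 w z aw Dz) _; rewrite lerDr !mulr_ge0 ?rho_ge0//.
    by apply: w0; apply: polytope_convex => //; [exact: interior_subset|apply/andP; split; lra].
  rewrite negb_forall => /existsP[j]; rewrite -ltNge => tj.
  have : 2^-1 <= rho n x.
    rewrite /rho (bigD1 j)//= -[leLHS]addr0 lerD//; last by apply: sumr_ge0 => k _; exact: posX_ge0.
    apply: (@le_trans _ _ (t ^+ n.+2)).
      apply: le_trans (bernoulli_ineq n.+2 _); last by rewrite !ltW.
      rewrite -/N /a invfM mulrCA mulfV ?gt_eqF// mulr1; lra.
    have /andP[tp _] := t01.
    rewrite /posX (max_idPr _); last by apply: ltW; exact: lt_trans tj.
    by rewrite lerXn2r ?nnegrE ?ltW//; exact: lt_trans tj.
  move=> h; have : w x * 2^-1 <= w x * rho n x by exact: ler_wpM2l.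
  lra.
have IW : int_on D w <= 2 * int_on D (fun x => w x * rho n x) + C2 * fut w * vol.
  rewrite -int_onZ//; last exact: within_of.
  rewrite -int_onZ//; last exact: within_of.
  rewrite -int_onD//; [|by apply: within_of => x Dx; apply: cont_M; [exact: cont_cst|exact: cwr]|
     by apply: within_of => x Dx; exact: cont_cst].
  apply: int_on_le => //; first exact: within_of.
  apply: within_of => x Dx; apply: cont_D; last exact: cont_cst.
  by apply: cont_M; [exact: cont_cst|exact: cwr].
have b2 : 2 * bnorm u c f w <= fut w + C1 * int_on D w.
  rewrite /futaki -/(bnorm u c f w) -[X in X <= _](subrK (int_on D (fun x => s x * w x * f x ^- (2 * m + 1)))).
  apply: lerD => //; rewrite -int_onZ//; last exact: within_of.
  apply: int_on_le => //.
  - apply: within_of => x Dx; rewrite (_ : (fun x => _) = fun x => psi x * w x).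
      by apply: cont_M; [exact: cpsi|exact: cw'].
    by apply/funext => y; rewrite /psi; ring.
  - by apply: within_of => x Dx; apply: cont_M; [exact: cont_cst|exact: cw'].
  move=> x Dx; rewrite mulrAC; apply: ler_wpM2r; first exact: w0.
  exact: le_trans (ler_norm _) (hC1 x Dx).
have := hC0 n w aw; rewrite -/N => hB.
have bn0 : 0 <= bnorm u c f w.
  have : 0 <= N * int_on D (fun x => w x * rho n x).
    apply: mulr_ge0; first exact: ltW.
    rewrite -(int_on0 D); apply: int_on_le => //; [by apply: within_of => x _; exact: cont_cst|exact: within_of|].
    by move=> x Dx; rewrite mulr_ge0 ?rho_ge0// w0.
  by move=> h; have := le_trans h hB; rewrite pmulr_rge0.
have h3 : C1 * (2 * int_on D (fun x => w x * rho n x)) <= bnorm u c f w.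
  rewrite -(ler_pM2l N0).
  have -> : N * (C1 * (2 * int_on D (fun x => w x * rho n x))) =
    2 * C1 * (N * int_on D (fun x => w x * rho n x)) by ring.
  apply: (@le_trans _ _ (2 * C1 * (C0 * bnorm u c f w))); first by apply: ler_wpM2l => //; rewrite mulr_ge0// ltW.
  by rewrite mulrA; apply: ler_wpM2r.
have h4 : C1 * int_on D w <= C1 * (2 * int_on D (fun x => w x * rho n x)) + C1 * (C2 * fut w * vol).
  by rewrite -mulrDr; apply: ler_wpM2l => //; exact: ltW.
have -> : Q * fut w = fut w + C1 * (C2 * fut w * vol) by rewrite /Q; ring.
move: b2 h3 h4; set b := bnorm _ _ _ _; set F := fut w; set I1 := C1 * int_on D w; set I2 := C1 * (2 * _).
set I3 := C1 * (_ * vol); lra.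
Qed.

End Stability.

(** * Dilations about the base point *)

Section Dilation.
Variables (R : realType) (m : nat) (x0 : 'rV[R]_m) (r : R).
Implicit Types (x v : 'rV[R]_m) (g : 'rV[R]_m -> R).

Definition shrink x := x0 + r *: (x - x0).

Lemma shrink_continuous : continuous shrink.
Proof.
move=> x; have h : (fun y : 'rV[R]_m => y - x0) y @[y --> x] --> x - x0.
  exact: (cvgB (@cvg_id _ (nbhs x)) (@cvg_cst _ x0 _ (nbhs x) _)).
exact: (cvgD (@cvg_cst _ x0 _ (nbhs x) _) (cvgZl_tmp h)).
Qed.

Lemma is_derive_shrink g x v (l : R) :
  is_derive (shrink x) v g l -> is_derive x v (fun y => g (shrink y)) (r * l).
Proof.
move=> /is_derive_line0 h; apply/is_derive_line0.
rewrite (_ : (fun t : R => _) = (fun t : R => (fun a : R => g (shrink x + a *: v)) (r * t))); last first.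
  apply/funext => t; congr g; rewrite /shrink.
  by apply/rowP => i; rewrite !mxE; ring.
have dr : is_derive (0 : R) (1 : R) (fun t : R => r * t) r.
  have := @is_deriveZ _ _ _ _ r _ _ _ (is_derive_id (0 : R) (1 : R)).
  by congr (is_derive _ _ _ _); rewrite /GRing.scale /= mulr1.
have h' : is_derive (r * 0) (1 : R) (fun a : R => g (shrink x + a *: v)) l by rewrite mulr0.
by have := is_derive_comp1 dr h'; rewrite mulrC.
Qed.

Lemma Cn_shrink n (U : set 'rV[R]_m) g : open U -> Cn n U g ->
  Cn n (shrink @^-1` U) (fun y => g (shrink y)).
Proof.
move=> oU.
have oS : open (shrink @^-1` U) by apply: open_comp => // x _; exact: shrink_continuous.
elim: n g => [|n IH] g hg; (split; first by
  move=> x Ux; exact: (cvg_comp _ _ (shrink_continuous (x := x)) (Cn_cont hg Ux))) => // i.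
have hd x : U (shrink x) -> is_derive x (unit_vec R i) (fun y => g (shrink y)) (r * pd i g (shrink x)).
  by move=> Ux; apply: is_derive_shrink; exact: Cn_is_derive hg Ux.
split=> [x /hd[]//|].
apply: (Cn_eq oS _ (Cn_M oS (Cn_cst n r oS) (IH _ (Cn_pd i hg)))) => x Ux /=.
by have [_ <-] := hd x Ux.
Qed.

End Dilation.

(** * Approximation of general test functions *)

Section Approximation.
Variables (R : realType) (m d : nat) (u : 'I_d -> 'rV[R]_m) (c : 'I_d -> R).
Variable x0 : 'rV[R]_m.
Local Notation L j := (aff (u j) (c j)).
Local Notation D := (polytope u c).
Hypotheses (cD : compact D) (u0 : forall j, u j != 0) (ix0 : interior D x0).
Implicit Types (x y : 'rV[R]_m) (w : 'rV[R]_m -> R).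

(** For [r < 1] the dilation maps D into its interior, so the composite is smooth on the open
    preimage of the interior, a neighbourhood of D. *)
Lemma admissible_shrink w (r : R) : 0 <= r < 1 -> in_Ctilde D x0 w ->
  admissible u c x0 (fun x => w (shrink x0 r x)).
Proof.
move=> r01 [[_ cw sw] wx0 w0].
have inS x : D x -> interior D (shrink x0 r x) by move=> Dx; exact: interior_seg.
exists (shrink x0 r @^-1` interior D); split.
- by apply: open_comp; [move=> x _; exact: shrink_continuous|exact: open_interior].
- by move=> x; exact: inS.
- by apply: Cn_shrink; [exact: open_interior|exact: smooth_Cn].
- move=> x y t Dx Dy t01.
  have -> : shrink x0 r (t *: x + (1 - t) *: y) = t *: shrink x0 r x + (1 - t) *: shrink x0 r y.
    by apply/rowP => i; rewrite !mxE; ring.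
  by apply: cw => //; apply: interior_subset; exact: inS.
split; first by rewrite /shrink subrr scaler0 addr0.
by move=> x Dx; rewrite -wx0; apply: w0; apply: interior_subset; exact: inS.
Qed.

(** A continuous bounded extension of w to the whole space makes the difference of w and its dilate,
    times a bump, a continuous function with [bdd_supp]; dominated convergence sends its integral to
    0, and [psi] is bounded on D. *)
Lemma int_on_shrink_cvg (psi w : 'rV[R]_m -> R) (r : nat -> R) :
  {within D, continuous psi} -> {within D, continuous w} ->
  (forall n, 0 <= r n <= 1) -> r n @[n --> \oo] --> (1 : R) ->
  (forall n, {within D, continuous (fun x => w (shrink x0 (r n) x))}) ->
  int_on D (fun x => psi x * w (shrink x0 (r n) x)) @[n --> \oo] --> int_on D (fun x => psi x * w x).
Proof.
move=> cpsi cw r01 r1 cwr.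
have [h [B [sh hw hB]]] := polytope_extension cD cw.
have [K K0 hK] := within_bounded cD cpsi.
have [M M0 DM] := polytope_bounded cD.
have B0 : 0 <= B := le_trans (normr_ge0 _) (hB 0).
pose G n x := bump M x * `|h (shrink x0 (r n) x) - h x|.
have cS n : scont (fun x => h (shrink x0 (r n) x)).
  move=> v x vx; apply: sh; apply: ccvgD; first exact: ccvg_cst.
  apply: ccvgZ; first exact: cvg_cst.
  by apply: ccvgD => //; exact: ccvg_cst.
have sG n : scont (G n).
  apply: scontM; first exact: bump_scont.
  by move=> v x vx; apply: cvg_norm; apply: cvgB; [exact: cS|exact: sh].
have bG n : bdd_supp (2 * B + (M + 1)) (G n).
  move=> x; split.
    rewrite /G normrM normr_id ger0_norm ?bump_ge0//.
    apply: (@le_trans _ _ (1 * (2 * B))); last by rewrite mul1r lerDl addr_ge0.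
    apply: ler_pM => //; [exact: bump_ge0|exact: bump_le1|].
    apply: le_trans (ler_normB _ _) _; have := hB (shrink x0 (r n) x); have := hB x; lra.
  by move=> hx; rewrite /G bump_0 ?mul0r//; apply/ltW; apply: le_lt_trans hx; rewrite lerDr mulr_ge0.
have G0 x : G n x @[n --> \oo] --> (0 : R).
  rewrite -[X in _ --> X](mulr0 (bump M x)); apply: cvgM; first exact: cvg_cst.
  rewrite -(normr0 R) -(subrr (h x)); apply: cvg_norm; apply: cvgB; last exact: cvg_cst.
  apply: sh; rewrite -[X in ccvg _ X](subrKC x0) -[x - x0 in X in ccvg _ X]scale1r.
  by apply: ccvgD; [exact: ccvg_cst|apply: ccvgZ => //; exact: ccvg_cst].
have lim := iint_dct sG bG G0; rewrite iint0 in lim.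
apply/cvgrPdist_le => e e0.
have Ke : 0 < e / K by exact: divr_gt0.
have := lim; move=> /cvgrPdist_le /(_ _ Ke); apply: filterS => n.
rewrite sub0r normrN => hn.
have gG n' : good (fun x => K * G n' x) by apply: goodZ; exact: good_scont (sG n') (bG n').
have D1 x : D x -> `|psi x * w x - psi x * w (shrink x0 (r n) x)| <= K * G n x.
  move=> Dx; have DS : D (shrink x0 (r n) x) by apply: polytope_convex => //; exact: interior_subset.
  rewrite /G bump_1 ?mul1r; last exact: DM.
  rewrite -mulrBr normrM !hw// distrC; apply: ler_wpM2r => //; exact: hK.
have KG x : 0 <= K * G n x by apply: mulr_ge0; [exact: ltW|apply: mulr_ge0 => //; exact: bump_ge0].
have g1 := good_polytope cD (within_contM cpsi cw); have g2 := good_polytope cD (within_contM cpsi (cwr n)).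
have KI : iint (fun x => K * G n x) <= e.
  rewrite iintZ; last exact: good_scont (sG n) (bG n).
  by rewrite -ler_pdivlMl// mulrC; apply: le_trans (ler_norm _) hn.
rewrite ler_norml; apply/andP; split.
  rewrite lerBrDl -lerBrDr opprK; apply: le_trans (_ : _ <= int_on D (fun x => psi x * w x) + iint (fun x => K * G n x)) _; last by rewrite lerD2l.
  rewrite /int_on -iintD//; apply: iint_le => //; first exact: goodD.
  move=> x; case: asboolP => Dx; last first.
    by rewrite add0r KG.
  by have := D1 x Dx; rewrite ler_norml => /andP[h1 _]; lra.
rewrite lerBlDl; apply: le_trans (_ : _ <= int_on D (fun x => psi x * w (shrink x0 (r n) x)) + iint (fun x => K * G n x)) _; last by rewrite lerD2l.
rewrite /int_on -iintD//; apply: iint_le => //; first exact: goodD.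
move=> x; case: asboolP => Dx; last first.
  by rewrite add0r KG.
by have := D1 x Dx; rewrite ler_norml => /andP[_ h1]; lra.
Qed.

End Approximation.

(** * Passage to the limit and conclusion *)

Section Closing.
Variables (R : realType) (m d : nat) (u : 'I_d -> 'rV[R]_m) (c : 'I_d -> R) (f s : 'rV[R]_m -> R).
Variable x0 : 'rV[R]_m.
Local Notation D := (polytope u c).
Hypotheses (cD : compact D) (u0 : forall j, u j != 0) (ix0 : interior D x0).
Hypotheses (af : affine_fun f) (fpos : forall x, D x -> 0 < f x) (asf : affine_fun s).
Implicit Types (x y : 'rV[R]_m) (w : 'rV[R]_m -> R).

(* For w_r(x) = w(x0 + r(x - x0)) one has w_r <= w, so only the interior integral needs a limit. *)
Lemma stable_closure (lambda : R) : lambda <= 1 ->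
  (forall w, admissible u c x0 w -> lambda * bnorm u c f w <= futaki u c f s w) ->
  forall w, in_Ctilde D x0 w -> lambda * bnorm u c f w <= futaki u c f s w.
Proof.
move=> l1 H w hw; have [[cw cvw _] wx0 w0] := hw.
pose r n : R := 1 - n.+1%:R^-1.
have r01 n : 0 <= r n < 1.
  by rewrite /r subr_ge0 invf_le1// ler1n /= ltrBlDr ltrDl invr_gt0.
have r01' n : 0 <= r n <= 1 by have /andP[-> /ltW ->] := r01 n.
have r1 : r n @[n --> \oo] --> (1 : R).
  rewrite -[X in _ --> X]subr0; apply: cvgB; [exact: cvg_cst|exact: cvg_natinv].
pose wr n x := w (shrink x0 (r n) x).
have ar n : admissible u c x0 (wr n) := admissible_shrink u0 ix0 (r01 n) hw.
have cwr n : {within D, continuous (wr n)} by apply: within_of => x; exact: adm_cont (ar n).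
pose psi x := s x * f x ^- (2 * m + 1).
have cpsi : {within D, continuous psi}.
  apply: within_of => x Dx; apply: cont_M; first exact: affine_fun_cont.
  exact: powV_cont Dx.
have lim := int_on_shrink_cvg cD ix0 cpsi cw r01' r1 cwr.
have futE g : futaki u c f s g = 2 * bnorm u c f g - int_on D (fun x => psi x * g x).
  rewrite /futaki; congr (_ - _); apply: int_on_eq => x _; rewrite /psi; ring.
have cwt (g : 'rV[R]_m -> R) : {within D, continuous g} -> {within D, continuous (fun x => g x * f x ^- (2 * m - 1))}.
  by move=> cg; apply: within_contM => //; apply: within_of => y Dy; exact: powV_cont Dy.
have wle n x : D x -> wr n x <= w x.
  move=> Dx; have /andP[q0 q1] := r01' n.
  have -> : wr n x = w (r n *: x + (1 - r n) *: x0).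
    by rewrite /wr /shrink; congr w; apply/rowP => i; rewrite !mxE; ring.
  apply: le_trans (cvw _ _ _ Dx (interior_subset ix0) (r01' n)) _.
  by rewrite wx0 mulr0 addr0 ler_piMl// -wx0 w0.
have ble n : bnorm u c f (wr n) <= bnorm u c f w.
  apply: ler_sum => j _; apply: int_facet_le => //; [exact: cwt|exact: cwt|].
  move=> x [Dx _]; apply: ler_wpM2r; last exact: wle.
  by rewrite invr_ge0 exprn_ge0// ltW// fpos.
(* With the boundary terms collected, the inequality bounds the interior integral by [2 - lambda]
   times the boundary norm. The norm of each dilate is at most that of w, so only the left side
   moves with [n]. *)
rewrite futE lerBrDl -lerBrDr -mulrBl.
apply: (ler_cvg_to lim (@cvg_cst _ ((2 - lambda) * bnorm u c f w) nat \oo eventually_filter)).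
apply: nearW => n /=.
apply: (@le_trans _ _ ((2 - lambda) * bnorm u c f (wr n))); last by apply: ler_wpM2l => //; lra.
by have := H _ (ar n); rewrite futE lerBrDl -lerBrDr -mulrBl.
Qed.

End Closing.

Theorem theorem3p10 (R : realType) (m d : nat)
    (u : 'I_d -> 'rV[R]_m) (c : 'I_d -> R) (f : 'rV[R]_m -> R) :
  (2 <= m)%N ->
  simple_labelled_polytope u c ->
  affine_fun f ->
  (forall x, polytope u c x -> 0 < f x) ->
  forall s : 'rV[R]_m -> R, is_extremal_affine u c f s ->
  (exists v : 'rV[R]_m -> R, in_S u c v /\
     forall x, interior (polytope u c) x ->
       - (f x ^+ (2 * m + 1)) *
         (\sum_(i < m) \sum_(j < m)
            dpart [:: i; j] (fun y => f y ^- (2 * m - 1) * Hinv v y i j) x)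
       = s x) ->
  forall x0 : 'rV[R]_m, interior (polytope u c) x0 ->
  exists lambda : R, 0 < lambda /\
    forall w : 'rV[R]_m -> R, in_Ctilde (polytope u c) x0 w ->
      lambda * bnorm u c f w <= futaki u c f s w.
Proof.
move=> _ [cD _ u0 genuine _] af fpos s [asf _].
move=> [v [[smv _ Hunit [W [Hb [[oW DW] smH HbE bdryH posH]]]] abreu]] x0 ix0.
have energy := energy_direction cD u0 genuine af fpos asf ix0 smv Hunit oW DW smH HbE bdryH posH abreu.
have [lambda [l0 l1 hl]] := admissible_stable cD u0 ix0 af fpos asf energy.
by exists lambda; split=> // w; exact: (stable_closure cD u0 ix0 af fpos asf l1 hl).
Qed.
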